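(* Let $d=2$ and consider first-passage percolation on $\mathbb{Z}^2$ with i.i.d. nonnegative edge weights $(\tau_e)$. Suppose $\mathbb{P}(\tau_e=0)<p_c(2)=1/2$, $\mathbb{E}e^{\alpha\tau_e}<\infty$ for some $\alpha>0$, and that the limit shape $\mathcal{B}$ satisfies the uniform curvature condition. Then there exists $C>0$ such that $\mathbb{P}\big(M(t)\le(\log t)^C \text{ for all large } t\big)=1$.
   Context: Paths, passage times $T(\gamma)=\sum_{e\in\gamma}\tau_e$ and $T(x,y)=\inf_{\gamma:x\to y}T(\gamma)$ over nearest-neighbor paths are as usual; $B(t)=\{x\in\mathbb{Z}^2:T(0,x)\le t\}$; $p_c(2)$ is the critical probability for Bernoulli bond percolation on $\mathbb{Z}^2$. $M(t)$ is the maximal number of vertices of a finite connected component of $\mathbb{Z}^2\setminus B(t)$. Under the stated assumptions there is a norm $g$ on $\mathbb{R}^2$ (the time constant, $g(x)=\lim_n T(0,nx)/n$) whose unit ball $\mathcal{B}=\{z:g(z)\le1\}$ is the limit shape: for all $\epsilon>0$, a.s. $(1-\epsilon)\mathcal{B}\subset\frac1t(B(t)+[0,1)^2)\subset(1+\epsilon)\mathcal{B}$ for all large $t$. $\mathcal{B}$ satisfies the uniform curvature condition if there exist $c>0,\eta>0$ such that for all $z_1,z_2\in\partial\mathcal{B}$ and $z=(1-\lambda)z_1+\lambda z_2$, $\lambda\in[0,1]$, one has $1-g(z)\ge c\min\{g(z-z_1),g(z-z_2)\}^\eta$. *)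

(* Defs.v *)
From HB Require Import structures.
From mathcomp Require Import all_boot all_order all_algebra.
From mathcomp Require Import all_classical all_reals all_analysis.
From mathcomp Require finmap.
Set Implicit Arguments. Unset Strict Implicit. Unset Printing Implicit Defensive.
Import Order.TTheory GRing.Theory Num.Theory.
Local Open Scope classical_set_scope.
Local Open Scope ring_scope.

Definition Z2 := (int * int)%type.
(* edges of Z^2: (x, true) joins x and x+(1,0); (x, false) joins x and x+(0,1) *)
Definition E := (Z2 * bool)%type.

Definition adj (u v : Z2) : bool := `|u.1 - v.1| + `|u.2 - v.2| == 1.

Definition edge_of (u v : Z2) : E :=
  if v == (u.1 + 1, u.2) then (u, true)
  else if u == (v.1 + 1, v.2) then (v, true)
  else if v == (u.1, u.2 + 1) then (u, false)
  else (v, false).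

Definition is_path (x y : Z2) (p : seq Z2) : Prop :=
  path adj x p /\ last x p = y.

Section FPP.
Variable R : realType.

Definition ptime (t : E -> R) (x : Z2) (p : seq Z2) : R :=
  \sum_(uv <- zip (x :: p) p) t (edge_of uv.1 uv.2).

Definition passage (t : E -> R) (x y : Z2) : R :=
  inf [set ptime t x p | p in [set p | is_path x y p]].

Definition origin : Z2 := (0, 0).

Definition ball_B (t : E -> R) (s : R) : set Z2 :=
  [set x | passage t origin x <= s].

Definition component (S C : set Z2) : Prop :=
  [/\ C `<=` S, C !=set0,
      (forall x y, C x -> C y -> exists p, is_path x y p /\
          (forall v, v \in x :: p -> C v))
    & (forall x y, C x -> S y -> adj x y -> C y)].

Definition M_max (t : E -> R) (s : R) : \bar R :=
  ereal_sup (0%E |` [set ((size (finmap.enum_fset (fset_set C)))%:R)%:E |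
                       C in [set C | component (~` ball_B t s) C /\ finite_set C]]).

Definition is_norm2 (g : R * R -> R) : Prop :=
  [/\ (forall z, 0 <= g z),
      (forall z, g z = 0 -> z = (0, 0)),
      (forall (c : R) z, g (c * z.1, c * z.2) = `|c| * g z)
    & (forall z w, g (z.1 + w.1, z.2 + w.2) <= g z + g w)].

Definition uniform_curvature (g : R * R -> R) : Prop :=
  exists c eta : R, 0 < c /\ 0 < eta /\
    forall z1 z2 : R * R, g z1 = 1 -> g z2 = 1 ->
    forall lam : R, 0 <= lam <= 1 ->
      let z := ((1 - lam) * z1.1 + lam * z2.1, (1 - lam) * z1.2 + lam * z2.2) in
      c * powR (Num.min (g (z.1 - z1.1, z.2 - z1.2)) (g (z.1 - z2.1, z.2 - z2.2))) eta
        <= 1 - g z.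

Definition iid_edges (d : measure_display) (Omega : measurableType d)
  (P : probability Omega R) (tau : E -> {RV P >-> R}) : Prop :=
  (forall (s : seq E) (B : E -> set R), uniq s -> (forall e, measurable (B e)) ->
     P (\bigcap_(e in [set` s]) (tau e @^-1` B e)) =
       (\prod_(e <- s) P (tau e @^-1` B e))%E) /\
  (forall (e e' : E) (B : set R), measurable B ->
     P (tau e @^-1` B) = P (tau e' @^-1` B)).

End FPP.

(* Main.v *)
(** Every value [M(t)] is controlled by a deterministic statement: if on the scales between
    [r0] and [O(t)] the passage time from [v] to [v + x] differs from [g x] by at most a power
    [|x|^(1 - delta)] of the scale, then a finite component [C] of the complement of the ball
    has diameter [O(r0)].  By uniform curvature, near-geodesics towards the origin are
    straight up to an angle that is small (the angular errors at dyadic scales are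
    summable), and the ball contains a backward cone at each of its vertices.  A long hole is
    therefore transversal to the radial direction, so it separates a boundary vertex of the ball
    just above it from the origin, and the geodesic of that vertex would have to cross it.

    The approximation holds with [r0] polylogarithmic in [t].  A renormalisation argument
    shows that, off an event of stretched exponential probability, paths of displacement
    [2 L k^4] cost at least 1; it starts from the convergence to the norm [g].  Hence optimal
    paths are short, and Talagrand's convex distance inequality concentrates the passage time over displacement
    [n = k^44] around a center [m_k(x)], at order [sqrt n] up to powers of [k].  Cutting a
    geodesic from 0 to [2x] into pieces and splitting the pieces into two halves with
    nearly equal sums gives [2 m_k(x) = m_k(2x) + O(n / k)].  Telescoping over the scales
    [k = 2^j] yields [m_k(x) = g(x) + O(n / k)], and the Borel-Cantelli lemma concludes. *)

Require Import Defs.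
From HB Require Import structures.
From mathcomp Require Import all_boot all_order all_algebra.
From mathcomp Require Import zify ring lra.
From mathcomp Require Import all_classical all_reals all_analysis.
From mathcomp Require Import measurable_realfun.
Set Implicit Arguments. Unset Strict Implicit. Unset Printing Implicit Defensive.
Import Order.TTheory GRing.Theory Num.Theory.
Import numFieldNormedType.Exports.
Local Open Scope classical_set_scope.
Local Open Scope ring_scope.

(** * Paths and passage times *)

(** Concentration compares passage times with centers, whereas curvature speaks of [g], so the
    centers need a rate of convergence to [g]. A power rate is what makes the angular errors over
    dyadic scales a convergent geometric series. In 2 m(x) = m(2x) + error, one inequality is the
    triangle inequality. The obstacle is the other one, since a geodesic to 2x need not pass near x.
    Its increments may however be reordered, because m depends on the increment and not on the
    starting point; this is the purpose of cutting. Backward cones alone cannot exclude a hole lying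
    across the radial direction; this is where planarity enters. No minimising path is assumed to
    exist: geodesics are paths with additive slack, and slack 1 adds 1/k to the relative error at
    scale k. The centers are integer quasi-medians of a discretised time on a finite product space,
    so Talagrand's inequality is an induction on finite sums and no expectation of a passage time is
    used. *)

Definition nrm (x : Z2) : nat := maxn `|x.1|%N `|x.2|%N.
Arguments nrm x%_ring_scope.

Lemma adjE (u v : Z2) : adj u v = (`|u.1 - v.1| + `|u.2 - v.2| == 1).
Proof. by []. Qed.

Lemma adj_sym (u v : Z2) : adj u v = adj v u.
Proof. case: u v => [a b] [c d]; rewrite !adjE /=; lia. Qed.

Lemma adjD (z u v : Z2) : adj (u + z) (v + z) = adj u v.
Proof. case: u v z => [a b] [c d] [e f]; rewrite !adjE /=; lia. Qed.

Lemma adj_nrm (u v : Z2) : adj u v -> (nrm (u - v) <= 1)%N.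
Proof. case: u v => [a b] [c d]; rewrite adjE /nrm /=; lia. Qed.

Lemma nrmD (u v : Z2) : (nrm (u + v) <= nrm u + nrm v)%N.
Proof. case: u v => [a b] [c d]; rewrite /nrm /=; lia. Qed.

Lemma nrmN (u : Z2) : nrm (- u) = nrm u.
Proof. case: u => [a b]; rewrite /nrm /=; lia. Qed.

Lemma nrmB (u v : Z2) : nrm (u - v) = nrm (v - u).
Proof. by rewrite -nrmN opprB. Qed.

Lemma nrm0 : nrm 0 = 0%N. Proof. by []. Qed.

Lemma nrm_eq0 (u : Z2) : (nrm u == 0%N) = (u == 0).
Proof. case: u => [a b]; rewrite /nrm -pair_eqE /pair_eq /=; lia. Qed.

Lemma nrm_tri (u v w : Z2) : (nrm (u - w) <= nrm (u - v) + nrm (v - w))%N.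
Proof. have -> : u - w = (u - v) + (v - w) by rewrite addrA subrK.
exact: nrmD. Qed.

Lemma nrm_adj_le (w u v : Z2) : adj u v -> (nrm (v - w) <= (nrm (u - w)).+1)%N.
Proof.
move=> uv; apply: (leq_trans (nrm_tri v u w)); rewrite -add1n leq_add2r.
by apply: adj_nrm; rewrite adj_sym.
Qed.

Lemma edge_of_sym (u v : Z2) : adj u v -> edge_of u v = edge_of v u.
Proof.
case: u v => [a b] [c d]; rewrite adjE /edge_of -!pair_eqE /pair_eq /=.
by do ![case: ifP => //=]; rewrite -?pair_eqE /pair_eq /=; try lia; move=> *; congr (_, _, _); lia.
Qed.

Definition shiftE (z : Z2) (e : E) : E := (e.1 + z, e.2).

Lemma shiftE_inj z : injective (shiftE z).
Proof.
by case: z => [z1 z2] [[u1 u2] b] [[v1 v2] c] [/= /addIr -> /addIr -> ->].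
Qed.

Lemma edge_ofD (z u v : Z2) : edge_of (u + z) (v + z) = shiftE z (edge_of u v).
Proof.
case: u v z => [a b] [c d] [e f]; rewrite /edge_of -!pair_eqE /pair_eq /=.
have -> : (c + e == a + e + 1) && (d + f == b + f) = (c == a + 1) && (d == b) by lia.
have -> : (a + e == c + e + 1) && (b + f == d + f) = (a == c + 1) && (b == d) by lia.
have -> : (c + e == a + e) && (d + f == b + f + 1) = (c == a) && (d == b + 1) by lia.
by do ![case: ifP].
Qed.

Lemma edge_of_end (u v : Z2) : (edge_of u v).1 = u \/ (edge_of u v).1 = v.
Proof. by rewrite /edge_of; do ![case: ifP => _ /=]; auto. Qed.

(** Locating [u] is enough for [edges_uniq]: a repeated edge would bring the first vertex of a path
    back among the later ones. *)
Lemma edge_of_inj (u v u' v' : Z2) : adj u v -> adj u' v' ->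
  edge_of u v = edge_of u' v' -> u = u' \/ u = v'.
Proof.
case: u v u' v' => [a b] [c d] [a' b'] [c' d']; rewrite !adjE /edge_of -!pair_eqE /pair_eq /=.
have EP (x y z t : int) : x = z -> y = t -> (x, y) = (z, t) by move=> -> ->.
move=> h h'.
do ![case: ifP => ?]; case=> *; subst;
 first [left; apply: EP; lia | right; apply: EP; lia].
Qed.

Definition edges (x : Z2) (p : seq Z2) : seq E :=
  [seq edge_of uv.1 uv.2 | uv <- zip (x :: p) p].

Section Ptime.
Variable R : realType.
Implicit Type t : E -> R.

Lemma ptime_nil t x : ptime t x [::] = 0.
Proof. by rewrite /ptime big_nil. Qed.

Lemma ptime_cons t x y p : ptime t x (y :: p) = t (edge_of x y) + ptime t y p.
Proof. by rewrite /ptime /= big_cons. Qed.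

Lemma ptime_cat t x p q : ptime t x (p ++ q) = ptime t x p + ptime t (last x p) q.
Proof.
elim: p x => [|y p IH] x /=; first by rewrite ptime_nil add0r.
by rewrite !ptime_cons IH addrA.
Qed.

Lemma ptime_ge0 t x p : (forall e, 0 <= t e) -> 0 <= ptime t x p.
Proof. by move=> t0; apply: sumr_ge0. Qed.

Lemma ptime_shift t z x p :
  ptime t (x + z) (map (fun v => v + z) p) = ptime (fun e => t (shiftE z e)) x p.
Proof. by elim: p x => [|y p IH] x; rewrite ?ptime_nil //= !ptime_cons IH edge_ofD. Qed.

Lemma path_shift z x p : path adj (x + z) (map (fun v => v + z) p) = path adj x p.
Proof. by elim: p x => //= y p IH x; rewrite IH adjD. Qed.

Lemma last_rev_belast (T : Type) (x : T) p : last (last x p) (rev (belast x p)) = x.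
Proof. by case: p => //= y p; rewrite rev_cons last_rcons. Qed.

Lemma ptime_rev t x p : path adj x p -> ptime t (last x p) (rev (belast x p)) = ptime t x p.
Proof.
elim: p x => [|y p IH] x /=; first by rewrite !ptime_nil.
case/andP=> xy yp; rewrite rev_cons -cats1 ptime_cat IH // last_rev_belast.
by rewrite !ptime_cons ptime_nil addr0 addrC edge_of_sym // adj_sym.
Qed.

Lemma rev_path_adj x p : path adj x p -> path adj (last x p) (rev (belast x p)).
Proof. by rewrite rev_path; under eq_path do rewrite adj_sym. Qed.

Lemma ptime_le t t' x p :
  (forall e : E, e \in edges x p -> t e <= t' e) ->
  ptime t x p <= ptime t' x p.
Proof.
rewrite /ptime /edges; elim: (zip _ _) => [|uv s IH] H; first by rewrite !big_nil.
rewrite !big_cons lerD //; first by apply: H; rewrite inE eqxx.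
by apply: IH => e he; apply: H; rewrite inE he orbT.
Qed.

Lemma steps_mem (x : Z2) (p : seq Z2) uv : uv \in zip (x :: p) p -> uv.1 \in x :: p /\ uv.2 \in p.
Proof.
elim: p x => [|y p IH] x //=; rewrite inE => /orP[/eqP ->|/IH [h1 h2]] /=.
  by rewrite !inE !eqxx.
by rewrite !inE in h1 h2 *; rewrite h2 h1 !orbT.
Qed.

Lemma steps_adj (x : Z2) (p : seq Z2) uv : path adj x p -> uv \in zip (x :: p) p -> adj uv.1 uv.2.
Proof.
elim: p x => [|y p IH] x //= /andP[xy yp]; rewrite inE => /orP[/eqP -> //|]; exact: IH.
Qed.

Lemma edges_base x p (e : E) : e \in edges x p ->
  e.1 \in x :: p.
Proof.
case/mapP=> uv /steps_mem[h1 h2] ->; case: (edge_of_end uv.1 uv.2) => -> //.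
by rewrite inE h2 orbT.
Qed.

Lemma edges_uniq x p : path adj x p -> uniq (x :: p) ->
  uniq (edges x p).
Proof.
elim: p x => [|y p IH] x //= /andP[xy yp] /andP[xyp yp'].
rewrite IH // andbT; apply/mapP=> -[uv huv].
have [h1 h2] := steps_mem huv.
have h2' : uv.2 \in y :: p by rewrite inE h2 orbT.
by case/(edge_of_inj xy (steps_adj yp huv)) => h; move: xyp; rewrite h ?h1 ?h2'.
Qed.

(** Loop erasure. The inclusion of vertices keeps the path in any box that contains the original,
    and uniqueness then bounds its length by the number of vertices of that box. *)
Lemma ptime_uniq t x p : (forall e, 0 <= t e) -> path adj x p ->
  exists p', [/\ path adj x p', last x p' = last x p, uniq (x :: p'),
    {subset p' <= p} & ptime t x p' <= ptime t x p].
Proof.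
move=> t0; have [n] := ubnP (size p); elim: n p x => // n IH p x szp xp.
have [xinp|xnp] := boolP (x \in p).
  case/splitPr: xinp szp xp => p1 p2 szp.
  rewrite cat_path /= last_cat /= => /and3P[h1 h2 h3].
  have [|p' [h4 h5 h6 h7 h8]] := IH p2 x _ h3; first by move: szp; rewrite size_cat /=; lia.
  exists p'; split => //; first by move=> z /h7; rewrite mem_cat inE => ->; rewrite !orbT.
  by rewrite ptime_cat ptime_cons (le_trans h8) // addrA lerDr addr_ge0 // ptime_ge0.
case: p szp xp xnp => [|y p] szp /=; first by exists [::].
case/andP=> xy yp; rewrite inE negb_or => /andP[xny xnp].
have [p' [h4 h5 h6 h7 h8]] := IH p y szp yp.
exists (y :: p'); split => //=; first by rewrite xy.
- move: h6 => /= ->; rewrite inE negb_or xny andbT /=; apply/negP=> /h7; exact/negP.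
- by move=> z; rewrite !inE => /orP[->//|/h7 ->]; rewrite orbT.
- by rewrite !ptime_cons lerD2l.
Qed.

Lemma straight_path (x y : Z2) : exists p, [/\ is_path x y p,
  (size p <= (nrm (y - x)).*2)%N & forall v, v \in x :: p -> (nrm (v - x) <= nrm (y - x))%N].
Proof.
have seg1 (a b : int) (n : nat) : exists p, [/\ is_path (a, b) (a + n%:Z, b) p, size p = n &
    forall v, v \in (a, b) :: p -> v.2 = b /\ a <= v.1 <= a + n%:Z].
  elim: n => [|n [p [[h1 h2] h3 h4]]].
    by exists [::]; split; rewrite ?addr0 // => v; rewrite inE => /eqP -> /=; lia.
  exists (rcons p (a + n.+1%:Z, b)); split.
  - split; last by rewrite last_rcons.
    by rewrite rcons_path h1 h2 adjE /=; lia.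
  - by rewrite size_rcons h3.
  - by move=> v; rewrite -rcons_cons mem_rcons inE => /orP[/eqP ->|/h4] /=; lia.
have seg2 (a b : int) (n : nat) : exists p, [/\ is_path (a, b) (a, b + n%:Z) p, size p = n &
    forall v, v \in (a, b) :: p -> v.1 = a /\ b <= v.2 <= b + n%:Z].
  elim: n => [|n [p [[h1 h2] h3 h4]]].
    by exists [::]; split; rewrite ?addr0 // => v; rewrite inE => /eqP -> /=; lia.
  exists (rcons p (a, b + n.+1%:Z)); split.
  - split; last by rewrite last_rcons.
    by rewrite rcons_path h1 h2 adjE /=; lia.
  - by rewrite size_rcons h3.
  - by move=> v; rewrite -rcons_cons mem_rcons inE => /orP[/eqP ->|/h4] /=; lia.
have revp (u v : Z2) (p : seq Z2) : is_path u v p ->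
    exists q, [/\ is_path v u q, size q = size p & forall w, w \in v :: q -> w \in u :: p].
  case=> up <-; exists (rev (belast u p)); split.
  - by split; [exact: rev_path_adj | exact: last_rev_belast].
  - by rewrite size_rev size_belast.
  - by move=> w; rewrite inE mem_rev => /orP[/eqP ->|/mem_belast //]; rewrite mem_last.
have hor (a b c : int) : exists p, [/\ is_path (a, b) (c, b) p, size p = `|c - a|%N &
    forall v, v \in (a, b) :: p -> v.2 = b /\ (`|v.1 - a| <= `|c - a|)%N].
  have [ac|ca] := lerP a c.
    have [p [h1 h2 h3]] := seg1 a b `|c - a|%N.
    exists p; split => //; last by move=> v /h3; lia.
    by move: h1; have -> : a + `|c - a|%N%:Z = c by lia.
  have [p [h1 h2 h3]] := seg1 c b `|c - a|%N.
  have [q [k1 k2 k3]] := revp _ _ _ h1.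
  exists q; move: k1 k3; have -> : c + `|c - a|%N%:Z = a by lia.
  move=> k1 k3; split => //; [by rewrite k2 | by move=> v /k3 /h3; lia].
have ver (a b c : int) : exists p, [/\ is_path (a, b) (a, c) p, size p = `|c - b|%N &
    forall v, v \in (a, b) :: p -> v.1 = a /\ (`|v.2 - b| <= `|c - b|)%N].
  have [ac|ca] := lerP b c.
    have [p [h1 h2 h3]] := seg2 a b `|c - b|%N.
    exists p; split => //; last by move=> v /h3; lia.
    by move: h1; have -> : b + `|c - b|%N%:Z = c by lia.
  have [p [h1 h2 h3]] := seg2 a c `|c - b|%N.
  have [q [k1 k2 k3]] := revp _ _ _ h1.
  exists q; move: k1 k3; have -> : c + `|c - b|%N%:Z = b by lia.
  move=> k1 k3; split => //; [by rewrite k2 | by move=> v /k3 /h3; lia].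
case: x y => [a b] [c d].
have [p [[h1 h2] h3 h4]] := hor a b c; have [q [[k1 k2] k3 k4]] := ver c b d.
exists (p ++ q); split.
- by split; rewrite ?cat_path ?last_cat h2 ?h1.
- rewrite size_cat h3 k3 /nrm /=; lia.
- move=> v; rewrite -cat_cons mem_cat => /orP[/h4|hv]; first by rewrite /nrm /=; lia.
  have /k4 : v \in (c, b) :: q by rewrite inE hv orbT.
  rewrite /nrm /=; lia.
Qed.

Lemma passage_set_ne t x y : [set ptime t x p | p in [set p | is_path x y p]] !=set0.
Proof. by have [p [h _ _]] := straight_path x y; exists (ptime t x p); exists p. Qed.

Lemma passage_set_lb t x y : (forall e, 0 <= t e) ->
  has_lbound [set ptime t x p | p in [set p | is_path x y p]].
Proof. by move=> t0; exists 0 => _ [p _ <-]; exact: ptime_ge0. Qed.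

Lemma passage_le t x y p : (forall e, 0 <= t e) -> is_path x y p -> passage t x y <= ptime t x p.
Proof.
move=> t0 xp; apply: ge_inf; first exact: passage_set_lb.
by exists p.
Qed.

Lemma passage_lt t x y s : passage t x y < s -> exists2 p, is_path x y p & ptime t x p < s.
Proof.
move=> h; apply: contrapT => hn.
have hi : has_inf [set ptime t x p | p in [set p | is_path x y p]].
  split; first exact: passage_set_ne.
  by exists s => _ [r hr <-]; rewrite leNgt; apply/negP => hh; apply: hn; exists r.
have sp : 0 < s - passage t x y by rewrite subr_gt0.
have [_ [p hp <-] hps] := inf_adherent sp hi.
apply: hn; exists p => //; rewrite (lt_le_trans hps) //.
by rewrite -/(passage t x y) addrC subrK.
Qed.

Lemma passage_ge t x y s : (forall p, is_path x y p -> s <= ptime t x p) -> s <= passage t x y.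
Proof.
move=> h; rewrite leNgt; apply/negP => /passage_lt [p hp]; rewrite ltNge h //.
Qed.

Lemma passage_ge0 t x y : (forall e, 0 <= t e) -> 0 <= passage t x y.
Proof. by move=> t0; apply: passage_ge => p _; exact: ptime_ge0. Qed.

Lemma passage_sym t x y : (forall e, 0 <= t e) -> passage t x y = passage t y x.
Proof.
move=> t0; wlog suff h : x y / passage t x y <= passage t y x.
  by apply/eqP; rewrite eq_le !h.
apply: passage_ge => p [yp <-]; rewrite -ptime_rev //; apply: passage_le => //.
split; [exact: rev_path_adj | exact: last_rev_belast].
Qed.

Lemma is_path_cat x y z p q : is_path x y p -> is_path y z q -> is_path x z (p ++ q).
Proof. by move=> [h1 h2] [h3 h4]; split; rewrite ?cat_path ?last_cat h2 ?h1 ?h3. Qed.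

Lemma passage_triangle t x y z : (forall e, 0 <= t e) ->
  passage t x z <= passage t x y + passage t y z.
Proof.
move=> t0; rewrite -lerBlDr; apply: passage_ge => p hp.
rewrite lerBlDr -lerBlDl; apply: passage_ge => q hq.
rewrite lerBlDl; apply: (le_trans (passage_le t0 (is_path_cat hp hq))).
by rewrite ptime_cat; case: hp => _ ->.
Qed.

Lemma passage_shift t z x y :
  passage t (x + z) (y + z) = passage (fun e => t (shiftE z e)) x y.
Proof.
rewrite /passage; congr inf; apply/seteqP; split=> _ [p [h1 h2] <-].
  exists (map (fun v => v - z) p); last first.
    rewrite -ptime_shift -map_comp map_id_in // => v _ /=; exact: subrK.
  split; first by rewrite -(path_shift z) -map_comp map_id_in // => v _ /=; exact: subrK.
  by have := last_map (fun v : Z2 => v - z) p (x + z); rewrite h2 /= !addrK.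
exists (map (fun v => v + z) p); last by rewrite ptime_shift.
split; first by rewrite path_shift.
by have := last_map (fun v : Z2 => v + z) p x; rewrite h2.
Qed.

Lemma passage0 t x : (forall e, 0 <= t e) -> passage t x x = 0.
Proof.
move=> t0; apply/eqP; rewrite eq_le passage_ge0 // andbT -(ptime_nil t x).
by apply: passage_le.
Qed.

End Ptime.

(** * Planarity *)

Definition steps (x : Z2) (p : seq Z2) := zip (x :: p) p.

Lemma sum_steps_telescope (k : Z2 -> int) x p :
  \sum_(uv <- steps x p) (k uv.2 - k uv.1) = k (last x p) - k x.
Proof.
elim: p x => [|y p IH] x; first by rewrite /steps /= big_nil subrr.
by rewrite /steps /= big_cons IH /= addrC addrA subrK.
Qed.

(* Signed contribution of a step to the number of crossings with the horizontal
   half-line starting just below and to the right of [v]. *)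
Definition cross_step (v : Z2) (uv : Z2 * Z2) : int :=
  if (v.1 < uv.1.1) && (v.1 < uv.2.1) then
    (v.2 <= uv.2.2)%R%:Z - (v.2 <= uv.1.2)%R%:Z else 0.

Definition crossings (v : Z2) x p : int := \sum_(uv <- steps x p) cross_step v uv.

(** For a horizontal move the contributions agree step by step, because a step that counts for one
    point only would visit the other. For a vertical move they differ by the increments of the
    indicator of a half-row, which telescope to 0 since both ends of the path lie off that row. *)
Lemma crossings_adj v v' x p : path adj x p -> adj v v' ->
  v \notin x :: p -> v' \notin x :: p ->
  (x.2 != v.2) -> ((last x p).2 != v.2) -> (x.2 != v'.2) -> ((last x p).2 != v'.2) ->
  crossings v x p = crossings v' x p.
Proof.
move=> xp.
have hor (a b : int) : (a, b) \notin x :: p -> (a + 1, b) \notin x :: p ->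
    crossings (a, b) x p = crossings (a + 1, b) x p.
  move=> h1 h2; rewrite /crossings; apply: eq_big_seq => -[[u1 u2] [v1 v2]] huv.
  have [/= m1 m2] := steps_mem huv; have m3 : (v1, v2) \in x :: p by rewrite inE m2 orbT.
  have := steps_adj xp huv; rewrite adjE /= => hadj.
  have n1 : (u1, u2) != (a + 1, b) by apply: contraNneq h2 => <-.
  have n2 : (v1, v2) != (a + 1, b) by apply: contraNneq h2 => <-.
  move: n1 n2; rewrite -!pair_eqE /pair_eq /= /cross_step /= => n1 n2.
  do ![case: ifP] => *; lia.
have ver (a b : int) : (a, b) \notin x :: p -> (a, b + 1) \notin x :: p ->
    x.2 != b -> (last x p).2 != b ->
    crossings (a, b) x p = crossings (a, b + 1) x p.
  move=> h1 h2 h3 h4; apply/eqP; rewrite -subr_eq0 /crossings -sumrB.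
  pose k (w : Z2) : int := ((a < w.1) && (w.2 == b))%R%:Z.
  rewrite (eq_big_seq (fun uv => k uv.2 - k uv.1)).
    rewrite sum_steps_telescope /k; move: h3 h4; lia.
  move=> -[[u1 u2] [v1 v2]] huv.
  have [/= m1 m2] := steps_mem huv; have m3 : (v1, v2) \in x :: p by rewrite inE m2 orbT.
  have := steps_adj xp huv; rewrite adjE /= => hadj.
  have n1 : (u1, u2) != (a, b) by apply: contraNneq h1 => <-.
  have n2 : (v1, v2) != (a, b) by apply: contraNneq h1 => <-.
  move: n1 n2; rewrite -!pair_eqE /pair_eq /= /cross_step /k /= => n1 n2.
  do ![case: ifP] => *; lia.
case: v v' => [a b] [c d]; rewrite adjE /= => hadj h1 h2 h3 h4 h5 h6.
have [e|e] := eqVneq b d.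
  subst d; have [e2|e2] := eqVneq c (a + 1); first by subst c; exact: hor.
  have e3 : a = c + 1 by lia.
  by subst a; rewrite -hor.
have e1 : a = c by lia.
subst c; have [e2|e2] := eqVneq d (b + 1); first by subst d; exact: ver.
have e3 : b = d + 1 by lia.
by subst b; rewrite -ver.
Qed.

(** If the paths were disjoint, the crossing number of [q] would be constant along [p]. In the two
    rows that matter at [w1], the path [q] stays on the right, so every step counts and the sum
    telescopes to -1; at [w2] it stays on the left and nothing counts. *)
Lemma paths_cross (w1 w2 top bot : Z2) (p q : seq Z2) :
  is_path w1 w2 p -> is_path top bot q ->
  (forall v, v \in w1 :: p -> bot.2 < v.2 < top.2) ->
  (forall u, u \in top :: q -> w1.2 - 1 <= u.2 <= w1.2 -> w1.1 < u.1) ->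
  (forall u, u \in top :: q -> w2.2 - 1 <= u.2 <= w2.2 -> u.1 < w2.1) ->
  exists2 v, v \in w1 :: p & v \in top :: q.
Proof.
move=> [hp1 hp2] [hq1 hq2] rows left right; apply: contrapT => hn.
have dis v : v \in w1 :: p -> v \notin top :: q by move=> hv; apply/negP => hv'; apply: hn; exists v.
have cst : crossings w1 top q = crossings w2 top q.
  rewrite -hp2; elim: p w1 hp1 rows dis {hp2 left hn} => [|y p IH] w //= /andP[wy yp] rows dis.
  have r1 := rows _ (mem_head _ _).
  have r2 : bot.2 < y.2 < top.2 by apply: rows; rewrite !inE eqxx orbT.
  rewrite -IH //; last first.
  - by move=> v hv; apply: dis; rewrite inE hv orbT.
  - by move=> v hv; apply: rows; rewrite inE hv orbT.
  apply: crossings_adj => //; rewrite ?hq2; try lia.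
    by apply: dis; rewrite mem_head.
  by apply: dis; rewrite !inE eqxx orbT.
have c1 : crossings w1 top q = - 1.
  pose k (w : Z2) : int := (w1.2 <= w.2)%R%:Z.
  rewrite /crossings (eq_big_seq (fun uv => k uv.2 - k uv.1)).
    have /andP[r1 r2] := rows _ (mem_head _ _).
    by rewrite sum_steps_telescope hq2 /k leNgt r1 (ltW r2).
  move=> -[[u1 u2] [v1 v2]] huv.
  have [/= m1 m2] := steps_mem huv; have m3 : (v1, v2) \in top :: q by rewrite inE m2 orbT.
  have := steps_adj hq1 huv; rewrite adjE /= => hadj.
  have /= l1 := left _ m1; have /= l2 := left _ m3.
  rewrite /cross_step /k /=; move: w1.1 w1.2 l1 l2 => a b l1 l2.
  case: ifP => // /negbT hh; lia.
have c2 : crossings w2 top q = 0.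
  rewrite /crossings big1_seq // => -[[u1 u2] [v1 v2]] /= huv.
  have [/= m1 m2] := steps_mem huv; have m3 : (v1, v2) \in top :: q by rewrite inE m2 orbT.
  have := steps_adj hq1 huv; rewrite adjE /= => hadj.
  have /= l1 := right _ m1; have /= l2 := right _ m3.
  rewrite /cross_step /=; move: w2.1 w2.2 l1 l2 => a b l1 l2.
  case: ifP => // hh; lia.
by move: cst; rewrite c1 c2.
Qed.

(** * The norm and its curvature *)

Section Norm.
Variable R : realType.
Implicit Types z w : R * R.

Definition sc (c : R) z : R * R := (c * z.1, c * z.2).

Variable g : R * R -> R.
Hypothesis gn : is_norm2 g.

Let g_ge0 z : 0 <= g z. Proof. by case: gn. Qed.

Lemma norm_eq0 z : g z = 0 -> z = 0. Proof. by case: gn => _ h _ _ /h. Qed.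

Lemma norm_sc c z : g (sc c z) = `|c| * g z.
Proof. by case: gn => _ _ h _; exact: h. Qed.

Lemma norm_D z w : g (z + w) <= g z + g w.
Proof. by case: gn => _ _ _ h; exact: h. Qed.

Lemma norm_N z : g (- z) = g z.
Proof.
rewrite -[RHS]mul1r -normr1 -normrN -norm_sc; congr g.
by case: z => a b; rewrite /sc /= !mulN1r.
Qed.

Lemma norm_0 : g 0 = 0.
Proof. by have := norm_sc 0 0; rewrite normr0 mul0r /sc /= mul0r. Qed.

Lemma norm_gt0 z : z != 0 -> 0 < g z.
Proof. by move=> z0; rewrite lt0r g_ge0 andbT; apply: contra z0 => /eqP/norm_eq0 ->. Qed.

Lemma norm_B z w : g (z - w) = g (w - z).
Proof. by rewrite -norm_N opprB. Qed.

Lemma norm_tri z w u : g (z - u) <= g (z - w) + g (w - u).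
Proof. have -> : z - u = (z - w) + (w - u) by rewrite addrA subrK. exact: norm_D. Qed.

Lemma norm_leB z w : g z <= g w + g (z - w).
Proof. by have := norm_D w (z - w); rewrite addrC subrK. Qed.

Definition mx z : R := Num.max `|z.1| `|z.2|.

Lemma norm_upper : exists2 c2, 0 < c2 & forall z, g z <= c2 * mx z.
Proof.
exists (g (1, 0) + g (0, 1)).
  by rewrite ltr_wpDr // norm_gt0 // -pair_eqE /pair_eq /= oner_eq0.
move=> z; have -> : z = sc z.1 (1, 0) + sc z.2 (0, 1).
  by case: z => a b; rewrite /sc /= !mulr1 !mulr0; congr (_, _) => /=; rewrite ?addr0 ?add0r.
apply: (le_trans (norm_D _ _)); rewrite !norm_sc mulrDl.
have e1 : `|z.1| <= mx z by rewrite /mx le_max lexx.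
have e2 : `|z.2| <= mx z by rewrite /mx le_max lexx orbT.
have -> : mx (sc z.1 (1, 0) + sc z.2 (0, 1)) = mx z.
  by rewrite /mx /sc /= !mulr1 !mulr0 addr0 add0r.
by rewrite lerD // mulrC ler_wpM2l.
Qed.

(** Compactness in one variable: by homogeneity it suffices to minimise [g] on the two sides (1, s)
    and (s, 1) of the sup-norm sphere, where the extreme value theorem on [-1, 1] applies. *)
Lemma norm_lower : exists2 c1, 0 < c1 & forall z, c1 * mx z <= g z.
Proof.
have lip (f : R -> R * R) (c : R) : (forall x y, g (f x - f y) <= c * `|x - y|) ->
    continuous (g \o f).
  move=> h x; apply/cvgrPdist_le => /= e e0.
  have c0 : 0 <= c.
    by have := h 1 0; rewrite subr0 normr1 mulr1; exact: le_trans.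
  have d0 : 0 < e / (c + 1) by rewrite divr_gt0 // ltr_wpDl.
  near=> y.
  have yx : `|x - y| <= e / (c + 1).
    near: y; apply/nbhs_ballP; exists (e / (c + 1)) => //= y; exact: ltW.
  have h1 : `|g (f x) - g (f y)| <= c * `|x - y|.
    rewrite ler_norml; apply/andP; split.
      by rewrite lerNl opprB lerBlDr addrC (le_trans (norm_leB _ (f x))) // lerD2l distrC.
    by rewrite lerBlDr addrC (le_trans (norm_leB _ (f y))) // lerD2l.
  apply: (le_trans h1); apply: (@le_trans _ _ (c * (e / (c + 1)))); first by rewrite ler_wpM2l.
  by rewrite mulrA ler_pdivrMr ?ltr_wpDl // mulrC ler_pM2l // lerDl.
have m11 : (-1 : R) <= 1 by lra.
have pos (f : R -> R * R) (c : R) : (forall x y, g (f x - f y) <= c * `|x - y|) ->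
   (forall x, f x != 0) -> exists2 m, 0 < m & forall x, -1 <= x <= 1 -> m <= g (f x).
  move=> h f0; have [] := @EVT_min R (g \o f) (-1) 1 m11.
    by apply: continuous_subspaceT; exact: (lip f c).
  move=> c' _ hc; exists (g (f c')); first exact: norm_gt0.
  by move=> x hx; apply: hc; rewrite in_itv /=.
have [|x|m1 m10 h1] := pos (fun s => (1, s)) (g (0, 1)).
- move=> x y; have -> : (1, x) - (1, y) = sc (x - y) (0, 1) :> R * R.
    by rewrite /sc /= mulr0 mulr1 -[in RHS](subrr 1).
  by rewrite norm_sc mulrC.
- by rewrite -pair_eqE /pair_eq /= oner_eq0.
have [|x|m2 m20 h2] := pos (fun s => (s, 1)) (g (1, 0)).
- move=> x y; have -> : (x, 1) - (y, 1) = sc (x - y) (1, 0) :> R * R.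
    by rewrite /sc /= mulr0 mulr1 -[in RHS](subrr 1).
  by rewrite norm_sc mulrC.
- by rewrite -pair_eqE /pair_eq /= oner_eq0 andbF.
exists (Num.min m1 m2); first by rewrite lt_min m10.
move=> [a b]; rewrite /mx /=.
have [ab|ba] := lerP `|a| `|b|.
  have [b0|b0] := eqVneq b 0; first by rewrite b0 normr0 mulr0.
  have -> : (a, b) = sc b (a / b, 1) by rewrite /sc /= mulr1 mulrC divfK.
  rewrite norm_sc mulrC ler_wpM2l // ge_min; apply/orP; right; apply: h2.
  by rewrite -ler_norml normf_div ler_pdivrMr ?normr_gt0 // mul1r.
have a0 : a != 0 by rewrite -normr_gt0 (le_lt_trans _ ba).
have -> : (a, b) = sc a (1, b / a) by rewrite /sc /= mulr1 mulrC divfK.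
rewrite norm_sc mulrC ler_wpM2l // ge_min; apply/orP; left; apply: h1.
by rewrite -ler_norml normf_div ler_pdivrMr ?normr_gt0 // mul1r ltW.
Unshelve. all: by end_near.
Qed.

Definition dir z : R * R := sc (g z)^-1 z.

Lemma norm_dir z : z != 0 -> g (dir z) = 1.
Proof.
move=> /norm_gt0 z0; rewrite /dir norm_sc ger0_norm ?invr_ge0 ?ltW //.
by rewrite mulVf // gt_eqF.
Qed.

Lemma scA a b z : sc a (sc b z) = sc (a * b) z.
Proof. by rewrite /sc /= !mulrA. Qed.

Lemma sc1 z : sc 1 z = z.
Proof. by case: z => a b; rewrite /sc /= !mul1r. Qed.

Lemma dirK z : sc (g z) (dir z) = z.
Proof.
have [->|z0] := eqVneq z 0; first by rewrite /sc /dir /sc /= !mulr0.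
by rewrite /dir scA mulfV ?sc1 // gt_eqF // norm_gt0.
Qed.

Lemma dir_sc c z : 0 < c -> dir (sc c z) = dir z.
Proof.
move=> c0; rewrite /dir norm_sc scA gtr0_norm //.
by rewrite invfM mulrAC mulVf ?mul1r // gt_eqF.
Qed.

Lemma scBl a b z : sc (a - b) z = sc a z - sc b z.
Proof. by rewrite /sc /= !mulrBl. Qed.

Lemma scBr a z w : sc a (z - w) = sc a z - sc a w.
Proof. by rewrite /sc /= !mulrBr. Qed.

Lemma dir_close x y : x != 0 -> y != 0 -> g (dir x - dir y) <= 2 * g (x - y) / g y.
Proof.
move=> x0 y0; have gx := norm_gt0 x0; have gy := norm_gt0 y0.
have -> : dir x - dir y = sc (g y)^-1 (x - y) + sc ((g y - g x) / g y) (dir x).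
  have := gt_eqF gx; have := gt_eqF gy; rewrite /dir /sc.
  move: (g x) (g y) => a b /negbT b0 /negbT a0.
  by case: (x) (y) => [x1 x2] [y1 y2] /=; congr (_, _) => /=; field; rewrite a0 b0.
apply: (le_trans (norm_D _ _)); rewrite norm_sc [g (sc _ (dir x))]norm_sc norm_dir // mulr1.
rewrite ger0_norm ?invr_ge0 ?(ltW gy) // normrM [`|_^-1|]ger0_norm ?invr_ge0 ?(ltW gy) //.
rewrite [(g y)^-1 * _]mulrC -mulrDl. rewrite ler_wpM2r ?invr_ge0 ?(ltW gy) //.
have : `|g y - g x| <= g (x - y).
  rewrite ler_norml; apply/andP; split.
    by rewrite lerNl opprB lerBlDr addrC norm_leB.
  by rewrite lerBlDr addrC norm_B norm_leB.
lra.
Qed.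

Lemma norm_polar x y : g (x - y) <= `|g x - g y| + g y * g (dir x - dir y).
Proof.
have [->|x0] := eqVneq x 0.
  by rewrite sub0r norm_N norm_0 sub0r normrN ger0_norm // lerDl mulr_ge0.
have -> : x - y = sc (g x - g y) (dir x) + sc (g y) (dir x - dir y).
  by rewrite scBl scBr !dirK addrA subrK.
by apply: (le_trans (norm_D _ _)); rewrite norm_sc [g (sc _ (dir x - _))]norm_sc norm_dir // mulr1 (ger0_norm (g_ge0 y)).
Qed.

(** Curvature at [dir p] and [dir q], with weights proportional to [g p] and [g q]: then z = (p + q)
    / (g p + g q), and near equality in the triangle inequality reads 1 - g z <= e. So z is close to
    one of the two ends. As z - dir p and z - dir q are proportional, the bound [B] on the ratio of
    the norms makes z close to [dir p] in either case. *)
Lemma curvature_dir : uniform_curvature g -> forall B : R, 0 <= B ->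
  exists K b : R, [/\ 0 < K, 0 < b, b <= 1 & forall p q e, 0 < g p -> g q <= B * g p ->
   0 <= e -> e <= 1 / 2 -> g p + g q <= g (p + q) + e * g p ->
   g (dir p - dir (p + q)) <= K * powR e b].
Proof.
case=> c [eta [c0 [eta0 curv]]] B B0.
(* The cap 1 on the exponent and the summand 1 in [K] pay for the distance from z to [dir (p + q)],
   which is at most e and hence at most e to the power [b]. *)
pose K := (1 + B) * powR c^-1 eta^-1 + 1; pose b := Num.min eta^-1 1.
have K0 : 0 < K by rewrite ltr_wpDl // mulr_ge0 ?powR_ge0 // addr_ge0.
exists K, b; split => //; first by rewrite lt_min invr_gt0 eta0 ltr01.
  by rewrite ge_min lexx orbT.
have powb (e x : R) : 0 <= e -> e <= 1 / 2 -> b <= x -> 0 < x -> powR e x <= powR e b.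
  have b0 : 0 < b by rewrite lt_min invr_gt0 eta0 ltr01.
  rewrite le_eqVlt => /orP[/eqP <- _ bx x0|e0 e1 bx _]; first by rewrite !powR0 ?gt_eqF.
  by apply: ger_powR => //; rewrite e0 /=; lra.
move=> p q e gp gq e0 e1 hpq.
have p0 : p != 0 by apply: contraTneq gp => ->; rewrite norm_0 ltxx.
have [q0|q0] := eqVneq q 0.
  by rewrite q0 addr0 subrr norm_0 mulr_ge0 ?powR_ge0 // ltW.
have gq0 := norm_gt0 q0; set s := g p + g q.
have s0 : 0 < s by rewrite addr_gt0.
pose l := g q / s; have l01 : 0 <= l <= 1.
  apply/andP; split; first by rewrite divr_ge0 // ltW.
  by rewrite ler_pdivrMr // mul1r lerDr ltW.
have sE : s != 0 by rewrite gt_eqF.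
have l1 : 1 - l = g p / s.
  by rewrite /l -[1](@divff _ s) // -mulrBl /s addrK.
have := curv (dir p) (dir q) (norm_dir p0) (norm_dir q0) l l01.
set z := (_, _); have zE : z = sc s^-1 (p + q).
  rewrite /z l1 /l; have gp' : g p != 0 by rewrite gt_eqF.
  have gq' : g q != 0 by rewrite gt_eqF.
  by rewrite /sc /=; congr (_, _); field; rewrite sE gp' gq'.
have gz : g z = g (p + q) / s.
  by rewrite zE norm_sc ger0_norm ?invr_ge0 ?(ltW s0) // mulrC.
have hs : s <= g (p + q) + e * g p by [].
have hz : 1 - g z <= e.
  rewrite gz lerBlDr -lerBlDl ler_pdivlMr //.
  have : e * g p <= e * s by rewrite ler_wpM2l // lerDl ltW.
  by rewrite mulrBl mul1r; lra.
move=> hc; have {}hc := le_trans hc hz.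
pose d := powR (e / c) eta^-1.
have hmin : Num.min (g (z - dir p)) (g (z - dir q)) <= d.
  rewrite leNgt; apply/negP => hh.
  have : powR d eta < powR (Num.min (g (z - dir p)) (g (z - dir q))) eta.
    by apply: gt0_ltr_powR => //; rewrite nnegrE ?powR_ge0 // (le_trans _ (ltW hh)) ?powR_ge0.
  rewrite /d -powRrM mulVf ?gt_eqF // powRr1 ?divr_ge0 // ?(ltW c0) //.
  rewrite ltr_pdivrMr // mulrC => h; move: hc; rewrite leNgt => /negP; apply.
  exact: h.
have d0 : 0 <= d by exact: powR_ge0.
have zp : g (dir p - z) <= (1 + B) * d.
  rewrite norm_B; move: hmin; rewrite ge_min => /orP[h|h].
    by rewrite (le_trans h) // ler_peMl // lerDl.
  have -> : z - dir p = sc (- (g q / g p)) (z - dir q).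
    have gp' : g p != 0 by rewrite gt_eqF.
    have gq' : g q != 0 by rewrite gt_eqF.
    have sE' : g p + g q != 0 by [].
    rewrite zE /dir /sc /s; move: (g p) (g q) gp' gq' sE' => u v a0 b0 ab0.
    by case: (p) (q) => [a1 a2] [b1 b2] /=; congr (_, _) => /=; field; rewrite a0 b0 ab0.
  rewrite norm_sc normrN ger0_norm ?divr_ge0 // ler_pM // ?divr_ge0 //.
  by rewrite ler_pdivrMr // (le_trans gq) // ler_pM2r // lerDr.
have G0 : 0 < g (p + q).
  have : e * g p <= 1 / 2 * g p by rewrite ler_pM2r.
  move: hs; rewrite /s; lra.
have zq : g (z - dir (p + q)) <= e.
  have -> : z - dir (p + q) = sc (g z - 1) (dir (p + q)).
    by rewrite scBl sc1 gz zE /dir scA mulrAC mulfV ?mul1r // gt_eqF.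
  have pq0 : p + q != 0 by apply: contraTneq G0 => ->; rewrite norm_0 ltxx.
  rewrite norm_sc norm_dir // mulr1 ler0_norm ?opprB //.
  by rewrite subr_le0 gz ler_pdivrMr // mul1r norm_D.
apply: (le_trans (norm_tri _ z _)); apply: (le_trans (lerD zp zq)).
rewrite /K [X in _ <= X]mulrDl [X in _ <= _ + X]mul1r lerD //; last first.
  rewrite -[leLHS]powRr1 //; apply: powb => //; by rewrite ge_min lexx orbT.
rewrite -mulrA ler_wpM2l ?addr_ge0 // /d powRM // ?invr_ge0 ?(ltW c0) //.
rewrite mulrC ler_wpM2l ?powR_ge0 //; apply: powb => //; last by rewrite invr_gt0.
by rewrite ge_min lexx.
Qed.

End Norm.

(** * Near-geodesics of metrics close to the norm *)

Definition boxl (v : Z2) (N : nat) : seq Z2 :=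
  [seq (v.1 - N%:Z + i%:Z, v.2 - N%:Z + j%:Z) | i <- iota 0 (N.*2.+1), j <- iota 0 (N.*2.+1)].

Lemma mem_boxl u v N : (u \in boxl v N) = (nrm (u - v) <= N)%N.
Proof.
case: u v => [a b] [c d]; apply/allpairsP/idP => [[[i j] [hi hj [-> ->]]]|h].
  by move: hi hj; rewrite !mem_iota /nrm /=; lia.
exists (absz (a - c + N%:Z)%R, absz (b - d + N%:Z)%R); move: h; rewrite !mem_iota /nrm /= => h.
by split; try lia; congr (_, _); lia.
Qed.

Lemma boxl_uniq v N : uniq (boxl v N).
Proof.
apply: allpairs_uniq; rewrite ?iota_uniq // => -[i j] [i' j'] _ _ /= [h1 h2].
congr (_, _); lia.
Qed.

Lemma size_boxl v N : size (boxl v N) = (N.*2.+1 ^ 2)%N.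
Proof. by rewrite size_allpairs !size_iota expnS expn1. Qed.

Lemma path_first (P : pred Z2) (x : Z2) (p : seq Z2) : path adj x p -> ~~ P x -> P (last x p) ->
  exists (p1 : seq Z2) (u : Z2) (p2 : seq Z2), [/\ p = p1 ++ u :: p2, P u, adj (last x p1) u &
    forall v : Z2, v \in x :: p1 -> ~~ P v].
Proof.
elim: p x => [|y p IH] x /=; first by move=> _ /negP.
case/andP=> xy yp Px hl; have [Py|Py] := boolP (P y).
  by exists [::], y, p; split=> // v; rewrite inE => /eqP ->.
have [p1 [u [p2 [-> h1 h2 h3]]]] := IH y yp Py hl.
exists (y :: p1), u, p2; split=> // v; rewrite inE => /orP[/eqP -> //|]; exact: h3.
Qed.

Lemma path_hits (f : Z2 -> nat) m (x : Z2) (p : seq Z2) :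
  (forall u v, adj u v -> (f v <= (f u).+1)%N) -> path adj x p ->
  (f x <= m)%N -> (m <= f (last x p))%N ->
  exists p1 p2 : seq Z2, [/\ p = p1 ++ p2, f (last x p1) = m &
    forall v : Z2, v \in x :: p1 -> (f v <= m)%N].
Proof.
move=> fadj xp fx fl; have [fm|fm] := eqVneq (f x) m.
  by exists [::], p; split=> // v; rewrite inE => /eqP ->; rewrite fm.
have [||p1 [u [p2 [-> h1 h2 h3]]]] := @path_first (fun v => m <= f v)%N x p xp.
- by rewrite -ltnNge ltn_neqAle fm.
- by [].
move: h1 => /= h1; have /= h4 := h3 _ (mem_last x p1); have /= h5 := fadj _ _ h2.
have fu : f u = m.
  by apply/eqP; rewrite eqn_leq h1 andbT (leq_trans h5) // ltnNge.
exists (rcons p1 u), p2; rewrite cat_rcons last_rcons; split=> // v.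
rewrite -rcons_cons mem_rcons inE => /orP[/eqP ->|/h3 /=]; first by rewrite fu.
by rewrite -ltnNge => /ltnW.
Qed.

Lemma path_nrm_hits c m (x : Z2) (p : seq Z2) : path adj x p -> (nrm (x - c) <= m <= nrm (last x p - c))%N ->
  exists p1 p2 : seq Z2, [/\ p = p1 ++ p2, nrm (last x p1 - c) = m &
    forall v : Z2, v \in x :: p1 -> (nrm (v - c) <= m)%N].
Proof.
move=> xp /andP[h1 h2]; apply: (path_hits (f := fun v => nrm (v - c))) => //.
by move=> u v; exact: nrm_adj_le.
Qed.

Section Embed.
Variable R : realType.

Definition rv (x : Z2) : R * R := (x.1%:~R, x.2%:~R).

Lemma rvD x y : rv (x + y) = rv x + rv y.
Proof. by rewrite /rv /=; congr (_, _); rewrite intrD. Qed.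

Lemma rvN x : rv (- x) = - rv x.
Proof. by rewrite /rv /=; congr (_, _); rewrite intrN. Qed.

Lemma rvB x y : rv (x - y) = rv x - rv y.
Proof. by rewrite rvD rvN. Qed.

Lemma absz_real (a : int) : (`|a|%N)%:R = `|a%:~R| :> R.
Proof. by rewrite natr_absz intr_norm. Qed.

Lemma mx_rv x : mx (rv x) = (nrm x)%:R.
Proof.
rewrite /mx /nrm /= -!absz_real; have [h|h] := leqP `|x.1|%N `|x.2|%N.
  by apply/max_idPr; rewrite ler_nat.
by apply/max_idPl; rewrite ler_nat ltnW.
Qed.

Lemma nrm_ge1 (x : Z2) : `|x.1%:~R| <= (nrm x)%:R :> R.
Proof. by rewrite -absz_real ler_nat /nrm; lia. Qed.

Lemma nrm_ge2 (x : Z2) : `|x.2%:~R| <= (nrm x)%:R :> R.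
Proof. by rewrite -absz_real ler_nat /nrm; lia. Qed.

End Embed.

Section LengthMetric.
Variable R : realType.
Implicit Type D : Z2 -> Z2 -> R.

(** Stated through [D] at two cut points and not through edge weights, so that it makes sense for
    any metric, in particular for a rotated one. *)
Definition near_geodesic D (s : R) x y p := is_path x y p /\
  forall p1 p2 p3, p = p1 ++ p2 ++ p3 ->
    D x (last x p1) + D (last x p1) (last x (p1 ++ p2)) + D (last x (p1 ++ p2)) y
      <= D x y + s.

Definition length_metric D := [/\ forall x y, 0 <= D x y, forall x y, D x y = D y x,
  forall x y z, D x z <= D x y + D y z &
  forall x y s, 0 < s -> exists p, near_geodesic D s x y p].

Lemma passage_length_metric (t : E -> R) : (forall e, 0 <= t e) -> length_metric (passage t).
Proof.
move=> t0; split.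
- by move=> x y; exact: passage_ge0.
- by move=> x y; exact: passage_sym.
- by move=> x y z; exact: passage_triangle.
move=> x y s s0; have [p hp pt] := @passage_lt R t x y (passage t x y + s) ltac:(by rewrite ltrDl).
exists p; split=> // p1 p2 p3 pE; apply: le_trans (ltW pt).
case: hp; rewrite pE !cat_path !last_cat => /and3P[h1 h2 h3] h4.
rewrite !ptime_cat addrA lerD //; last by apply: passage_le.
by rewrite lerD // passage_le.
Qed.

Lemma near_geodesic_le D s s' x y p : s <= s' -> near_geodesic D s x y p ->
  near_geodesic D s' x y p.
Proof. by move=> ss [h1 h2]; split=> // p1 p2 p3 /h2 h; rewrite (le_trans h) // lerD2l. Qed.

End LengthMetric.

Section Holes.
Variable R : realType.
Variables (g : R * R -> R) (c1 c2 : R).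
Hypotheses (gn : is_norm2 g) (c10 : 0 < c1) (c20 : 0 < c2).
Hypotheses (g_lower : forall z, c1 * mx z <= g z) (g_upper : forall z, g z <= c2 * mx z).

Let g_ge0 z : 0 <= g z. Proof. by case: gn. Qed.

Lemma rv_lower x : c1 * (nrm x)%:R <= g (rv R x).
Proof. by rewrite -(mx_rv R) g_lower. Qed.

Lemma rv_upper x : g (rv R x) <= c2 * (nrm x)%:R.
Proof. by rewrite -(mx_rv R) g_upper. Qed.

Lemma c1_le_c2 : c1 <= c2.
Proof.
have h := le_trans (rv_lower (1, 0)) (rv_upper (1, 0)).
by move: h; rewrite /nrm /= !mulr1.
Qed.

Section Straight.
Variables (D : Z2 -> Z2 -> R) (Rr r0 : nat) (psi : nat -> R).
Hypotheses (Dlm : length_metric D).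
Hypothesis HD : forall (k : nat) v x, (r0 <= k <= Rr)%N -> (nrm v <= Rr)%N ->
  (nrm x <= 8 * k)%N -> `|D v (v + x) - g (rv R x)| <= k%:R * psi k.
Hypothesis r0_gt0 : (0 < r0)%N.
Variables K b : R.
Hypothesis curv : forall p q e, 0 < g p -> g q <= (5 * c2 / c1) * g p ->
  0 <= e -> e <= 1 / 2 -> g p + g q <= g (p + q) + e * g p ->
  g (dir g p - dir g (p + q)) <= K * powR e b.

(** Three comparisons of [D] with [g], each off by [k * psi k], and the slack 1 of a near-geodesic,
    relative to the lower bound [c1 * k] of the norm. *)
Definition rel_err (k : nat) : R := (3 * psi k + k%:R^-1) / c1.

Lemma HD' (k : nat) u v : (r0 <= k <= Rr)%N -> (nrm u <= Rr)%N -> (nrm (v - u)%R <= 8 * k)%N ->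
  `|D u v - g (rv R (v - u))| <= k%:R * psi k.
Proof. by move=> h1 h2 h3; have := HD h1 h2 h3; rewrite (addrC u) subrK. Qed.

(** [curvature_dir] for the increments v - x and u - v. The ratio 5 c2 / c1 stems from the bound 5 k
    on the sup norm of u - v. *)
Lemma scale_straight (x v u : Z2) : let k := nrm (v - x) in
  (r0 <= k <= Rr)%N -> (nrm x <= Rr)%N -> (nrm v <= Rr)%N -> (nrm (u - x) <= 4 * k)%N ->
  D x v + D v u <= D x u + 1 -> 0 <= rel_err k -> rel_err k <= 1 / 2 ->
  g (dir g (rv R (v - x)) - dir g (rv R (u - x))) <= K * powR (rel_err k) b.
Proof.
move=> k; have kE : nrm (v - x) = k by [].
clearbody k => hk hx hv hu hD e0 e1.
have k0 : (0 < k)%N by lia.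
have k0R : 0 < k%:R :> R by rewrite ltr0n.
have uE : rv R (u - x) = rv R (v - x) + rv R (u - v) by rewrite -rvD [(v - x) + _]addrC addrA subrK.
have huv : (nrm (u - v) <= 5 * k)%N.
  have := nrm_tri u x v; rewrite (nrmB x v) kE; lia.
have gp : c1 * k%:R <= g (rv R (v - x)) by rewrite -kE rv_lower.
have gp0 : 0 < g (rv R (v - x)) by rewrite (lt_le_trans _ gp) // mulr_gt0.
rewrite uE; apply: curv => //.
  apply: (le_trans (rv_upper _)); apply: (@le_trans _ _ (c2 * (5 * k%:R))).
    by rewrite ler_pM2l // -natrM ler_nat.
  rewrite [5 * c2]mulrC -!mulrA ler_pM2l // ler_pM2l // mulrC ler_pdivlMr // mulrC.
  by [].
have h1 : `|D x v - g (rv R (v - x))| <= k%:R * psi k by apply: HD' => //; rewrite kE leq_pmull.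
have h2 : `|D v u - g (rv R (u - v))| <= k%:R * psi k.
  by apply: HD' => //; rewrite (leq_trans huv) // leq_mul2r orbT.
have h3 : `|D x u - g (rv R (u - x))| <= k%:R * psi k.
  by apply: HD' => //; rewrite (leq_trans hu) // leq_mul2r orbT.
have h4 : 3 * (k%:R * psi k) + 1 <= rel_err k * g (rv R (v - x)).
  apply: (@le_trans _ _ (rel_err k * (c1 * k%:R))); last by rewrite ler_wpM2l.
  rewrite /rel_err [X in _ <= X]mulrA divfK ?gt_eqF // [X in _ <= X]mulrDl mulVf ?gt_eqF //.
  by rewrite -mulrA [psi k * _]mulrC.
rewrite -uE; move: h1 h2 h3; rewrite !ler_norml => /andP[a1 _] /andP[a2 _] /andP[_ a3].
by move: a1 a2 a3 h4 hD; lra.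
Qed.

Variable Th : nat -> R.
Hypothesis Th_step : forall k, (r0 <= k)%N ->
  [/\ 0 <= rel_err k, rel_err k <= 1 / 2, 0 <= Th k & K * powR (rel_err k) b + Th (2 * k)%N <= Th k].

(** Induction towards larger scales: from [v] at distance k of [x] pass to the first later vertex
    [u] at distance 2k. The directions of [u] and [v] differ by the angular error of scale k, and
    [Th k] dominates the sum of the errors at k, 2k, 4k, and so on. *)
Lemma straight (x : Z2) p : near_geodesic D 1 x 0 p ->
  (forall v : Z2, v \in x :: p -> (4 * nrm v <= Rr)%N) ->
  forall v : Z2, v \in x :: p -> (r0 <= nrm (v - x))%N ->
  g (dir g (rv R (v - x)) - dir g (rv R (- x))) <= Th (nrm (v - x)).
Proof.
case: Dlm => D0 Dsym Dtri _ [[xp lp] ng] small.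
have hx := small _ (mem_head _ _).
move=> v; have [m] := ubnP (Rr - nrm (v - x))%N; elim: m v => // m IH v hm vp hv.
have sv := small _ vp.
have [k kE] : exists k, k = nrm (v - x) by exists (nrm (v - x)).
rewrite -kE in hm hv *.
have hk2 : (2 * k <= Rr)%N.
  by have := nrmD v (- x); rewrite nrmN -kE; move: hx sv; clear; lia.
have rk : (r0 <= k <= Rr)%N by rewrite hv; move: hk2; clear; lia.
have hxR : (nrm x <= Rr)%N by move: hx; clear; lia.
have hvR : (nrm v <= Rr)%N by move: sv; clear; lia.
have hv2 : (r0 <= 2 * k)%N by move: hv; clear; lia.
have [e0 e1 t0 t1] := Th_step hv; have [_ _ t2 _] := Th_step hv2.
have [p1 [p3 [pE vE]]] : exists p1 p3 : seq Z2, p = p1 ++ p3 /\ last x p1 = v.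
  by case/splitPl: vp => p1 p3 vE; exists p1, p3.
have ng' := ng; rewrite pE in xp lp ng'.
(* At the last scales the origin itself takes the place of [u], being within the range 4k of
   [scale_straight]. *)
have [hk|hk] := leqP (nrm x) (4 * k)%N.
  have hs := @scale_straight x v 0; rewrite /= -kE sub0r nrmN in hs.
  apply: (@le_trans _ _ (K * powR (rel_err k) b)); last by move: t1 t2; lra.
  apply: hs => //.
  have := ng' p1 p3 [::]; rewrite !cats0 lp vE => /(_ erefl).
  by have := D0 0 0; lra.
have vp3 : path adj v p3 by move: xp; rewrite cat_path vE => /andP[].
have lp3 : last v p3 = 0 by move: lp; rewrite last_cat vE.
have [||q1 [u [q2 [p3E Pu uu nP]]]] := @path_first (fun w => 2 * k <= nrm (w - x))%N v p3 vp3.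
- by rewrite -kE -ltnNge; move: hv r0_gt0; clear; lia.
- by rewrite lp3 sub0r nrmN; move: hk; clear; lia.
have ku : nrm (u - x) = (2 * k)%N.
  have := nP _ (mem_last v q1); rewrite -ltnNge => h1.
  by apply/eqP; rewrite eqn_leq Pu andbT (leq_trans (nrm_adj_le x uu)).
have up : u \in x :: p by rewrite inE pE p3E !mem_cat inE eqxx !orbT.
have hvu : D x v + D v u <= D x u + 1.
  have := ng' p1 (rcons q1 u) q2; rewrite cat_rcons p3E => /(_ erefl).
  rewrite !last_cat vE last_rcons => h.
  have := Dtri x u 0; lra.
apply: (le_trans (norm_tri gn _ (dir g (rv R (u - x))) _)).
apply: le_trans t1; rewrite lerD //.
  have hs := @scale_straight x v u; rewrite /= -kE in hs.
  by apply: hs => //; rewrite ku leq_mul2r orbT.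
have := IH u; rewrite ku => h; apply: h => //.
by move: hm hv hk2 r0_gt0; clear; lia.
Qed.

End Straight.
End Holes.

(** * Cones around an axis and lattice staircases *)

Section Axis.
Variable R : realType.
Variables (g : R * R -> R) (c1 c2 : R).
Hypotheses (gn : is_norm2 g) (c10 : 0 < c1) (c20 : 0 < c2).
Hypotheses (g_lower : forall z, c1 * mx z <= g z) (g_upper : forall z, g z <= c2 * mx z).
Variable s : R.
Hypothesis s1 : `|s| <= 1.

Let ax : R * R := (- s, - 1).

Let mx_ax : mx ax = 1.
Proof. by rewrite /mx /= !normrN normr1; apply/max_idPr. Qed.

Let ax_low : c1 <= g ax.
Proof. by have := g_lower ax; rewrite mx_ax mulr1. Qed.

Let ax_upp : g ax <= c2.
Proof. by have := g_upper ax; rewrite mx_ax mulr1. Qed.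

Let ax0 : ax != 0.
Proof. by rewrite -pair_eqE /pair_eq /= !oppr_eq0 oner_eq0 andbF. Qed.

(** Up to a positive factor, which [dir] ignores, [z] is the axis direction plus a horizontal vector
    of size at most [k]. *)
Lemma dir_axis z k : z.2 < 0 -> `|z.1 - s * z.2| <= k * - z.2 ->
  g (dir g z - dir g ax) <= 2 * k * c2 / c1.
Proof.
move=> z2 hz; pose f := (z.1 - s * z.2) / - z.2; have z20 : 0 < - z.2 by rewrite oppr_gt0.
pose z' : R * R := (- s + f, - 1).
have zE : z = sc (- z.2) z'.
  rewrite /sc /z' /f /=; case: z z2 {hz f z20 z'} => a b /= b0; congr (_, _); last by rewrite mulrN1 opprK.
  by field; rewrite lt_eqF.
have z'0 : z' != 0 by apply/eqP => /(congr1 snd) /= /eqP; rewrite oppr_eq0 oner_eq0.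
rewrite {1}zE dir_sc //; apply: (le_trans (dir_close gn z'0 ax0)).
have gf : g (z' - ax) <= c2 * k.
  apply: (le_trans (g_upper _)); rewrite ler_pM2l //.
  have -> : z' - ax = (f, 0) by congr (_, _) => /=; ring.
  rewrite /mx /= normr0.
  rewrite ge_max; have fk : `|f| <= k by rewrite normrM normfV (gtr0_norm z20) ler_pdivrMr.
  by rewrite fk /= (le_trans _ fk).
have k0 : 0 <= c2 * k by apply: le_trans gf; case: gn.
rewrite ler_pdivrMr ?(lt_le_trans c10) //.
apply: (@le_trans _ _ (2 * (c2 * k))); first by rewrite ler_pM2l.
have -> : 2 * k * c2 / c1 * g ax = 2 * (c2 * k) * (g ax / c1) by field; rewrite gt_eqF.
apply: ler_peMr; first by rewrite mulr_ge0.
by rewrite ler_pdivlMr // mul1r.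
Qed.

(** Converse of [dir_axis]. The smallness of [e] keeps the second coordinate of [dir g z] at most -1
    / (2 c2), so that [z] does point downwards. *)
Lemma axis_of_dir z e : z != 0 -> e <= c1 / (2 * c2) -> g (dir g z - dir g ax) <= e ->
  z.2 < 0 /\ `|z.1 - s * z.2| <= 4 * c2 * e / c1 * - z.2.
Proof.
move=> z0 he hd; set d := dir g z - dir g ax in hd.
have md : mx d <= e / c1.
  by rewrite ler_pdivlMr // mulrC; apply: le_trans hd; exact: g_lower.
have d1 : `|d.1| <= e / c1 by apply: le_trans md; rewrite /mx le_max lexx.
have d2 : `|d.2| <= e / c1 by apply: le_trans md; rewrite /mx le_max lexx orbT.
have gz := norm_gt0 gn z0; have gx : 0 < g ax by apply: lt_le_trans ax_low.
have z1E : z.1 = g z * (d.1 - s / g ax).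
  rewrite /d /dir /sc /=; field; by rewrite !gt_eqF.
have z2E : z.2 = g z * (d.2 - (g ax)^-1).
  rewrite /d /dir /sc /=; field; by rewrite !gt_eqF.
have e2 : e / c1 <= (2 * c2)^-1.
  rewrite ler_pdivrMr // mulrC; exact: he.
have i1 : c2^-1 <= (g ax)^-1 by rewrite lef_pV2 ?posrE.
have hc : (2 * c2)^-1 = c2^-1 / 2 by rewrite invfM mulrC.
have u2 : d.2 - (g ax)^-1 <= - (2 * c2)^-1.
  by have := ler_norm d.2; move: d2 e2 i1 hc; lra.
have c2i : 0 < (2 * c2)^-1 by rewrite invr_gt0 mulr_gt0.
have z2 : z.2 < 0 by rewrite z2E pmulr_rlt0 //; move: u2 c2i; lra.
split=> //.
have -> : z.1 - s * z.2 = g z * (d.1 - s * d.2).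
  by rewrite z1E z2E; field; rewrite gt_eqF.
have h1 : `|d.1 - s * d.2| <= 2 * (e / c1).
  rewrite (le_trans (ler_normB _ _)) // mulrDl mul1r lerD // normrM.
  by rewrite (le_trans _ d2) // ler_piMl.
have ec : 0 <= e / c1 by apply: le_trans d1.
have h2 : 2 * (e / c1) <= 4 * c2 * (e / c1) * - (d.2 - (g ax)^-1).
  apply: (@le_trans _ _ (4 * c2 * (e / c1) * (2 * c2)^-1)).
    have -> // : 4 * c2 * (e / c1) * (2 * c2)^-1 = 2 * (e / c1) by field; rewrite !gt_eqF.
  apply: ler_wpM2l; last by rewrite lerNr.
  by rewrite mulr_ge0 // mulr_ge0 // ltW.
rewrite normrM gtr0_norm // z2E; set X := d.2 - _.
have -> : 4 * c2 * e / c1 * - (g z * X) = g z * (4 * c2 * (e / c1) * - X) by ring.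
by rewrite ler_pM2l // (le_trans h1).
Qed.
End Axis.

(** The descending path is stopped just before it first meets [C]. Its last vertex is then outside
    [C] but adjacent to it, and monotonicity keeps it at least as high as [u]. *)
Lemma stair_prefix (C : pred Z2) (top u : Z2) (q : seq Z2) :
  path adj top q -> path (fun a b : Z2 => b.2 <= a.2) top q -> ~~ C top -> C u -> u \in q ->
  exists q1 : seq Z2, [/\ path adj top q1, {subset q1 <= q},
    forall v : Z2, v \in top :: q1 -> ~~ C v, u.2 <= (last top q1).2 &
    exists2 c, C c & adj (last top q1) c].
Proof.
move=> tq mono Ct Cu /splitPr uq; case: uq tq mono => q1 q2.
rewrite -cat_rcons !cat_path => /andP[tq1 _] /andP[mono _].
have [|p1 [c [p2 [pE Cc ac nC]]]] := path_first tq1 Ct; first by rewrite last_rcons.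
exists p1; split.
- by move: tq1; rewrite pE cat_path => /andP[].
- by move=> v vp; rewrite mem_cat pE mem_cat vp.
- by [].
- have : last top p1 \in top :: rcons q1 u.
    by rewrite pE -cat_cons mem_cat mem_last.
  move: (last top p1); elim: q1 top mono {tq1 pE Ct nC ac} => [|y q1 IH] top /=.
    by rewrite andbT => h v; rewrite !inE => /orP[/eqP ->|/eqP ->].
  move=> /andP[h1 h2] v; rewrite inE => /orP[/eqP ->|hv]; last exact: (IH y h2 v hv).
  by apply: le_trans h1; apply: (IH y h2); rewrite mem_head.
- by exists c.
Qed.

Section Stair.
Variable R : realType.
Variables (s kappa : R).
Hypothesis s1 : `|s| <= 1.

(** A linear form that vanishes on the axis through (s, 1); its level lines are the parallels to the
    axis that the staircases follow. *)
Definition transv (v : Z2) : R := v.1%:~R - s * v.2%:~R.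

Lemma transvB u v : transv (u - v) = transv u - transv v.
Proof. by rewrite /transv /= !intrD !intrN; ring. Qed.

Lemma transv_le v : `|transv v| <= 2 * (nrm v)%:R.
Proof.
rewrite (le_trans (ler_normB _ _)) // mulrDl mul1r lerD ?nrm_ge1 // normrM.
by rewrite (le_trans _ (nrm_ge2 R v)) // ler_piMl.
Qed.

Definition stair_col (y : int) : int := Num.floor (kappa + s * y%:~R).

(** As the slope is at most 1 in absolute value, the column changes by at most one per row, and one
    horizontal step before the step down restores adjacency. *)
Fixpoint stair (y : int) (n : nat) : seq Z2 :=
  if n is m.+1 then
    (if stair_col y == stair_col (y - 1) then [::] else [:: (stair_col (y - 1), y)])
    ++ (stair_col (y - 1), y - 1) :: stair (y - 1) m
  else [::].

Lemma stair_col_step y : `|stair_col y - stair_col (y - 1)| <= 1.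
Proof.
rewrite /stair_col; set a := kappa + s * y%:~R; set b := kappa + _.
have hab : `|a - b| <= 1.
  have -> : a - b = s by rewrite /a /b intrB; ring.
  by [].
have /andP[a1 a2] := floor_itv a; have /andP[b1 b2] := floor_itv b.
rewrite ler_norml in hab; case/andP: hab => h1 h2.
have i1 : (Num.floor a)%:~R < (Num.floor b + 1 + 1)%:~R :> R.
  by move: b2; rewrite !intrD; move: a1 h2; lra.
have i2 : (Num.floor b)%:~R < (Num.floor a + 1 + 1)%:~R :> R.
  by move: a2; rewrite !intrD; move: b1 h1; lra.
move: i1 i2; rewrite !ltr_int; clear; lia.
Qed.

Lemma stair_path y n : path adj (stair_col y, y) (stair y n) /\
  path (fun a b : Z2 => b.2 <= a.2) (stair_col y, y) (stair y n).
Proof.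
elim: n y => [|n IH] y //=; have [h1 h2] := IH (y - 1).
have := stair_col_step y; case: ifP => /= hc hs; rewrite h1 h2 !adjE /= !andbT.
  by move: (stair_col y) (stair_col (y - 1)) hc; clear; lia.
by move: (stair_col y) (stair_col (y - 1)) hc hs; clear; lia.
Qed.

Lemma stair_last y n : last (stair_col y, y) (stair y n) = (stair_col (y - n%:Z), y - n%:Z).
Proof.
elim: n y => [|n IH] y /=; first by rewrite subr0.
rewrite last_cat /= IH; have -> // : y - 1 - n%:Z = y - n.+1%:Z by lia.
Qed.

Lemma stair_mem y n v : v \in (stair_col y, y) :: stair y n ->
  `|transv v - kappa| <= 2 /\ y - n%:Z <= v.2 <= y.
Proof.
have s1' := s1; rewrite ler_norml in s1'; case/andP: s1' => sa sb.
(* One unit is lost by the floor, the other because a corner sits one row above the row that defines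
   its column. *)
have key (z w : int) : `|z - w| <= 1 -> `|transv (stair_col z, w) - kappa| <= 2.
  move=> zw; rewrite /transv /stair_col /=.
  have /andP[a1 a2] := floor_itv (kappa + s * z%:~R).
  have zw' : `|s * (z%:~R - w%:~R)| <= 1.
    rewrite normrM -[leRHS]mulr1 ler_pM //.
    by rewrite -intrB -intr_norm -[leRHS]/(1%:~R) ler_int.
  move: zw' a2; rewrite intrD !ler_norml mulrBr => /andP[h1 h2] a2.
  by apply/andP; split; move: a1 a2 h1 h2; lra.
elim: n y v => [|n IH] y v.
  rewrite inE => /eqP -> /=; split; last lia.
  by apply: key; rewrite subrr.
rewrite inE => /orP[/eqP ->|] /=.
  split; first by apply: key; rewrite subrr.
  by clear; lia.
rewrite mem_cat => /orP[|/IH [h1 h2]]; last first.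
  split=> //; case/andP: h2 => h3 h4; apply/andP; split.
    by apply: le_trans h3; clear; lia.
  by apply: (le_trans h4); clear; lia.
case: ifP => // _; rewrite inE => /eqP -> /=; split; last lia.
by apply: key; lia.
Qed.

End Stair.

(** * Holes of balls *)

(** On a finite list the values above [t] stay away from [t]. A near-geodesic between points of the
    ball whose slack is below this gap stays in the ball, which slack 1 would not ensure. *)
Lemma list_slack (R : realType) (f : Z2 -> R) t (l : seq Z2) :
  exists s, [/\ 0 < s, s <= 1 & forall v : Z2, v \in l -> t < f v -> t + s < f v].
Proof.
elim: l => [|u l [s [s0 s1 IH]]]; first by exists 1; rewrite ltr01 lexx.
have [h|h] := ltP t (f u); last first.
  exists s; split=> // v; rewrite inE => /orP[/eqP ->|/IH //].
  by rewrite ltNge h.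
exists (Num.min s ((f u - t) / 2)); split.
- by rewrite lt_min s0 divr_gt0 // subr_gt0.
- by rewrite ge_min s1.
- move=> v; rewrite inE => /orP[/eqP -> _|vl tv].
    have : Num.min s ((f u - t) / 2) <= (f u - t) / 2 by rewrite ge_min lexx orbT.
    by move: h; lra.
  have : Num.min s ((f u - t) / 2) <= s by rewrite ge_min lexx.
  by have := IH v vl tv; lra.
Qed.

Lemma path_split (x : Z2) (p : seq Z2) (v : Z2) : v \in x :: p ->
  exists p1 p3 : seq Z2, p = p1 ++ p3 /\ last x p1 = v.
Proof. by case/splitPl => p1 p3 vE; exists p1, p3. Qed.

Section Hole.
Variable R : realType.
Variables (g : R * R -> R) (c1 c2 : R).
Hypotheses (gn : is_norm2 g) (c10 : 0 < c1) (c20 : 0 < c2).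
Hypotheses (g_lower : forall z, c1 * mx z <= g z) (g_upper : forall z, g z <= c2 * mx z).

Variables (D : Z2 -> Z2 -> R) (Rr r0 : nat) (t eps : R).
Hypotheses (Dlm : length_metric D) (r0_gt0 : (0 < r0)%N).
Hypothesis HD : forall (k : nat) v x, (r0 <= k <= Rr)%N -> (nrm v <= Rr)%N ->
  (nrm x <= 8 * k)%N -> `|D v (v + x) - g (rv R x)| <= k%:R * eps.
Hypothesis Hst : forall (b : Z2) p, near_geodesic D 1 b 0 p ->
  (forall v : Z2, v \in b :: p -> (4 * nrm v <= Rr)%N) ->
  forall v : Z2, v \in b :: p -> (r0 <= nrm (v - b))%N ->
  g (dir g (rv R (v - b)) - dir g (rv R (- b))) <= eps.
Hypotheses (eps0 : 0 <= eps) (eps1 : eps <= c1 / 8) (eps2 : eps <= 1 / 8).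
Hypothesis tR1 : 8 * (t + 3 + c1) <= c1 * Rr%:R.
Hypothesis tR2 : c1 * Rr%:R <= 32 * t.
Hypothesis tr1 : 4 * c1 * r0%:R <= t.
Hypothesis tr2 : (c2 + 2) * r0%:R < t.

Let g_ge0 z : 0 <= g z. Proof. by case: gn. Qed.
Let low := rv_lower g_lower.
Let upp := rv_upper g_upper.
Let Dge0 x y : 0 <= D x y. Proof. by case: Dlm. Qed.
Let Dsym x y : D x y = D y x. Proof. by case: Dlm. Qed.
Let Dtri x y z : D x z <= D x y + D y z. Proof. by case: Dlm => _ _ h _; exact: h. Qed.

Let r01 : 1 <= r0%:R :> R. Proof. by rewrite ler1n. Qed.
Let c12 : c1 <= c2. Proof. exact: c1_le_c2 g_lower g_upper. Qed.

Let t0 : 0 < t.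
Proof. by apply: le_lt_trans tr2; rewrite mulr_ge0 // addr_ge0 // ltW. Qed.

Let r0R : (16 * r0 <= Rr)%N.
Proof.
rewrite -(ler_nat R) natrM -(ler_pM2l c10) (le_trans _ tR1) //.
by move: tr1 t0 c10; lra.
Qed.

Let HD2 (k : nat) u v : (r0 <= k <= Rr)%N -> (nrm u <= Rr)%N -> (nrm (v - u)%R <= 8 * k)%N ->
  `|D u v - g (rv R (v - u))| <= k%:R * eps.
Proof. by move=> h1 h2 h3; have := HD h1 h2 h3; rewrite (addrC u) subrK. Qed.

(** [v] may be out of the range of [HD], so the near-geodesic from 0 is cut on the sphere of radius
    Rr / 4, where the approximation already makes the passage time too large. *)
Lemma ball_small v : D 0 v <= t + 1 -> (4 * nrm v <= Rr)%N.
Proof.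
move=> Dv; rewrite leqNgt; apply/negP => hv.
have [_ _ _ /(_ 0 v 1 ltr01)[p [[xp lp] ng]]] := Dlm.
pose m := (Rr %/ 4)%N.
have mR : (Rr < 4 * m + 4)%N by rewrite /m; clear; lia.
have [|p1 [p2 [pE hm _]]] := @path_nrm_hits 0 m 0 p xp.
  by rewrite lp !subr0 nrm0; move: hv; rewrite /m; clear; lia.
have := ng p1 [::] p2 pE; rewrite cats0; set y := last 0 p1 in hm *.
have mr : (r0 <= m <= Rr)%N by move: r0R r0_gt0 mR; rewrite /m; clear; lia.
have hy : nrm (y - 0) = m by [].
have := @HD2 m 0 y mr; rewrite hy nrm0 subr0 => /(_ isT)/(_ ltac:(by rewrite leq_pmull)).
rewrite ler_norml => /andP[h _].
have lowy := low y; rewrite subr0 in hy; rewrite hy in lowy.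
have em : m%:R * eps <= m%:R * (c1 / 8) by rewrite ler_wpM2l.
have mR' : c1 * Rr%:R <= c1 * (4 * m%:R + 4).
  by rewrite ler_pM2l // -natrM -natrD ler_nat ltnW.
by move: tR1 h lowy em mR' Dv (Dge0 y v) (Dge0 y y) c10 t0; lra.
Qed.

Lemma out_big w : t < D 0 w -> t <= (c2 + 1) * (nrm w)%:R.
Proof.
move=> Dw; have [hw|hw] := leqP (nrm w) Rr; last first.
  have h1 : c1 * Rr%:R <= c2 * (nrm w)%:R.
    by rewrite ler_pM ?(ltW c10) // ler_nat ltnW.
  have h2 : 0 <= (nrm w)%:R :> R by [].
  by move: tR1 t0 c10 h1 h2; nra.
pose k := maxn r0 (nrm w).
have hk : (r0 <= k <= Rr)%N by move: r0R hw; rewrite /k; clear; lia.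
have := @HD2 k 0 w hk; rewrite subr0 nrm0 => /(_ isT) /(_ ltac:(rewrite /k; clear; lia)).
rewrite ler_norml => /andP[_ h].
have [hr|hr] := leqP (nrm w) r0.
  have kE : k = r0 by rewrite /k; move: hr; clear; lia.
  have h1 : (nrm w)%:R <= r0%:R :> R by rewrite ler_nat.
  have h2 := upp w; rewrite kE in h.
  have h3 : c2 * (nrm w)%:R <= c2 * r0%:R by rewrite ler_pM2l.
  have h4 : r0%:R * eps <= r0%:R * 1 by rewrite ler_wpM2l //; move: eps2; lra.
  by move: tr2 Dw h h2 h3 h4 r01; lra.
have kE : k = nrm w by rewrite /k; move: hr; clear; lia.
have h2 := upp w; rewrite kE in h.
have h4 : (nrm w)%:R * eps <= (nrm w)%:R * 1.
  by rewrite ler_wpM2l //; move: eps2; lra.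
by move: Dw h h2 h4; lra.
Qed.

Lemma ball_geodesic b : D 0 b <= t ->
  exists p, near_geodesic D 1 b 0 p /\ forall v : Z2, v \in b :: p -> D 0 v <= t.
Proof.
move=> Db; have [s [s0 s1 hs]] := list_slack (D 0) t (boxl 0 Rr).
have [_ _ _ /(_ b 0 s s0)[p ng]] := Dlm.
exists p; split; first exact: near_geodesic_le ng.
case: ng => _ ng v /path_split[p1 [p3 [pE vE]]].
have := ng p1 [::] p3 pE; rewrite cats0 vE => h.
have h1 : D 0 v <= t + s.
  by move: h Db (Dge0 b v) (Dge0 v v); rewrite (Dsym v 0) (Dsym b 0); lra.
rewrite leNgt; apply/negP => tv; have := hs v; rewrite mem_boxl subr0.
have h2 : (4 * nrm v <= Rr)%N by apply: ball_small; rewrite (le_trans h1) // lerD2l.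
have h3 : (nrm v <= Rr)%N by move: h2; clear; lia.
by move=> /(_ h3 tv); rewrite ltNge h1.
Qed.

(** Beyond this multiple of [r0] the gain in [back_cone], a fixed fraction of the distance, exceeds
    the additive errors. *)
Definition cone_dist : R := 2 * (2 + 2 * c2 + c1) / c1.

(** Let G be the norm of w - b. At distance about G the near-geodesic from [b] to 0 has a vertex [v]
    in nearly the direction of [w]. Then D v w is a small fraction of G, whereas D 0 v is below [t]
    by most of G, and the triangle inequality puts [w] in the ball. *)
Lemma back_cone b w : D 0 b <= t -> t < D 0 w -> (2 * nrm w <= Rr)%N ->
  cone_dist * r0%:R <= (nrm (w - b))%:R -> g (rv R (w - b)) <= g (rv R b) ->
  g (dir g (rv R (w - b)) - dir g (rv R (- b))) <= 1 / 8 -> False.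
Proof.
move=> Db Dw wR hwb hgb hdir.
have [p [ng hp]] := ball_geodesic Db.
have small v : v \in b :: p -> (4 * nrm v <= Rr)%N.
  by move=> /hp h; apply: ball_small; rewrite (le_trans h) // lerDl.
set G := g (rv R (w - b)) in hgb *.
have G1 : 2 * (2 + 2 * c2 + c1) * r0%:R <= G.
  apply: le_trans (low _); rewrite -ler_pdivrMl // mulrA; apply: le_trans hwb.
  by rewrite /cone_dist [_ / c1]mulrC.
have G0 : 0 < G.
  by apply: lt_le_trans G1; rewrite !mulr_gt0 ?addr_gt0 ?ltr0n // mulr_gt0.
have [[xp lp] _] := ng.
have [||p1 [v [p2 [pE Pv av nP]]]] := @path_first (fun v => G <= g (rv R (v - b))) b p xp.
- by rewrite subrr -ltNge norm_0.
- by rewrite lp sub0r rvN norm_N.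
have vp : v \in b :: p by rewrite pE inE mem_cat mem_head !orbT.
have sv := small v vp; have sb := small b (mem_head _ _).
have vG : g (rv R (v - b)) <= G + c2.
  have := nP _ (mem_last b p1); rewrite -ltNge => h.
  have -> : v - b = (last b p1 - b) + (v - last b p1) by rewrite [RHS]addrC addrA subrK.
  rewrite rvD (le_trans (norm_D gn _ _)) // lerD ?(ltW h) // (le_trans (upp _)) //.
  by rewrite ler_piMr ?(ltW c20) // lern1 adj_nrm // adj_sym.
set k := nrm (v - b).
have kv : (k <= nrm v + nrm b)%N by have := nrmD v (- b); rewrite nrmN.
have kR1 : c1 * k%:R <= G + c2 by apply: le_trans vG; exact: low.
have kR2 : G <= c2 * k%:R by apply: (le_trans Pv); exact: upp.
have rk : (r0 <= k)%N.
  rewrite -(ler_nat R) -(ler_pM2l c20); apply: le_trans kR2; apply: le_trans G1.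
  by rewrite ler_pM2r ?ltr0n //; move: c10 c20; lra.
have hk : (r0 <= k <= Rr)%N by rewrite rk; move: sv sb kv; clear; lia.
have vR : (nrm v <= Rr)%N by move: sv; clear; lia.
have bR : (nrm b <= Rr)%N by move: sb; clear; lia.
have hd := Hst ng small vp rk.
have := HD2 hk bR (leq_pmull _ (isT : (0 < 8)%N)); rewrite ler_norml => /andP[h1 _].
have Dvt : D 0 v <= t + 1 - D b v.
  case: ng => _ /(_ (rcons p1 v) [::] p2); rewrite cat_rcons cats0 last_rcons => /(_ pE).
  by move: (Dge0 v v) Db; rewrite (Dsym v 0) (Dsym b 0); lra.
have gvw : g (rv R (w - v)) <= c2 + G * (eps + 1 / 8).
  have -> : w - v = (w - b) - (v - b) by rewrite opprB addrA subrK.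
  rewrite rvB norm_B //; apply: (le_trans (norm_polar gn _ _)); rewrite -/G lerD //.
    by rewrite ger0_norm ?subr_ge0 // lerBlDl.
  rewrite ler_wpM2l ?(ltW G0) //; apply: (le_trans (norm_tri gn _ (dir g (rv R (- b))) _)).
  by rewrite lerD // norm_B.
have eg : G * eps <= G * (1 / 8) by rewrite ler_wpM2l // ltW.
pose k' := maxn r0 (nrm (w - v)).
have wv : (nrm (w - v) <= nrm w + nrm v)%N by have := nrmD w (- v); rewrite nrmN.
have hk' : (r0 <= k' <= Rr)%N by move: r0R wR sv wv; rewrite /k'; clear; lia.
have := HD2 hk' vR (_ : (nrm (w - v) <= 8 * k')%N).
have -> : (nrm (w - v) <= 8 * k')%N by rewrite /k'; clear; lia.
move=> /(_ isT); rewrite ler_norml => /andP[_ h2].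
have k'R : k'%:R * eps <= r0%:R * eps + (nrm (w - v))%:R * eps.
  by rewrite -mulrDl ler_wpM2r // -natrD ler_nat /k'; clear; lia.
have e1 : r0%:R * eps <= r0%:R * (c1 / 8) by rewrite ler_wpM2l.
have e2 : (nrm (w - v))%:R * eps <= (nrm (w - v))%:R * (c1 / 8) by rewrite ler_wpM2l.
have e3 : k%:R * eps <= k%:R * (c1 / 8) by rewrite ler_wpM2l.
have e4 := low (w - v).
have e5 : c1 * 1 <= c1 * r0%:R by rewrite ler_pM2l.
have e6 : c2 * 1 <= c2 * r0%:R by rewrite ler_pM2l.
have Dw' := Dtri 0 v w.
move: Dw Dw' Dvt gvw eg h1 h2 k'R e1 e2 e3 e4 e5 e6 kR1 kR2 G1 G0 Pv c10 c20 r01; rewrite -/G.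
lra.
Qed.

Variables (K2 e2 e6 : R) (nn : nat).
Hypothesis hK2 : 16 * (c2 + 1) <= c1 * K2.
Hypotheses (e20 : 0 < e2) (e21 : e2 <= 1) (he2 : c2 * e2 * (34 + 2 * K2) <= c1).
Hypotheses (e60 : 0 < e6) (he6 : e6 <= e2).
Hypothesis h35 : 64 * c2 * (eps + 2 * e6 * c2 / c1) <= c1 * (e2 / 4).
Hypothesis n1 : 96 * r0%:R <= e2 * nn%:R.
Hypothesis n1' : 2 * (cone_dist + 4 / e2) * r0%:R <= nn%:R.
Hypothesis n2 : 8 * (nn.+1)%:R * (c2 + 1) <= e6 * t.

Let K20 : 0 < K2.
Proof.
rewrite -(pmulr_rgt0 _ c10) (lt_le_trans _ hK2) // mulr_gt0 // addr_gt0 //.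
Qed.

Let cone_dist0 : 0 < cone_dist.
Proof. by rewrite /cone_dist divr_gt0 // mulr_gt0 // !addr_gt0 // mulr_gt0. Qed.

Section Slope.
Variable s : R.
Hypothesis s1 : `|s| <= 1.

Let rv_transv v : rv R v = sc (v.2%:~R) (s, 1) + sc (transv s v) (1, 0).
Proof. by rewrite /rv /sc /transv /=; congr (_, _) => /=; ring. Qed.

Let ge1 : g (1, 0) <= c2.
Proof. by have := upp (1, 0); rewrite /nrm /= mulr1. Qed.

Let gs : c1 <= g (s, 1) <= c2.
Proof.
have m1 : mx (s, 1) = 1 by rewrite /mx /= normr1; apply/max_idPr.
by have := g_lower (s, 1); have := g_upper (s, 1); rewrite m1 !mulr1 => -> ->.
Qed.

(** Cones of aperture [e2] in the coordinates height and [transv]. The bound [K2] on the ratio of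
    heights and [he2] make the norm of w - b at most that of [b], so that the geodesic from [b] to 0
    is long enough for [back_cone]. *)
Lemma back_cone_axis b w : D 0 b <= t -> t < D 0 w -> (2 * nrm w <= Rr)%N ->
  cone_dist * r0%:R <= (b.2%:~R - w.2%:~R : R) ->
  `|transv s (w - b)| <= e2 * (b.2%:~R - w.2%:~R) -> `|transv s b| <= e2 * b.2%:~R ->
  0 < (w.2%:~R : R) -> (b.2%:~R : R) <= K2 * w.2%:~R -> False.
Proof.
move=> Db Dw wR hd ht hb w20 hbw; set dl : R := b.2%:~R - w.2%:~R in hd ht.
have dl0 : 0 < dl by apply: lt_le_trans hd; rewrite mulr_gt0 // ltr0n.
have wb2 : (w - b).2%:~R = - dl by rewrite /dl /= intrD intrN; ring.
have [gs1 gs2] := andP gs.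
have b20 : 0 < (b.2%:~R : R) by move: dl0 w20; rewrite /dl; lra.
have k0 : 0 < c2 * e2 by rewrite mulr_gt0.
have k32 : c2 * e2 <= c1 / 32.
  have h : 0 <= c2 * e2 * K2 by rewrite mulr_ge0 // ltW.
  by move: he2 k0 h; lra.
apply: (@back_cone b w) => //.
- apply: (le_trans hd).
  by have := nrm_ge2 R (w - b); rewrite wb2 normrN gtr0_norm.
- have h1 : g (rv R (w - b)) <= dl * (g (s, 1) + c2 * e2).
    rewrite rv_transv (le_trans (norm_D gn _ _)) // !norm_sc // wb2 normrN gtr0_norm //.
    rewrite mulrDr lerD2l (le_trans (ler_pM _ _ ht ge1)) //.
    have -> : e2 * (b.2%:~R - w.2%:~R) * c2 = dl * (c2 * e2) by rewrite /dl; ring.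
    by [].
  have h2 : b.2%:~R * (g (s, 1) - c2 * e2) <= g (rv R b).
    have := norm_leB gn (sc b.2%:~R (s, 1)) (rv R b).
    rewrite {2}rv_transv opprD addrA subrr add0r norm_N // !norm_sc // (gtr0_norm b20) => h.
    have : `|transv s b| * g (1, 0) <= e2 * b.2%:~R * c2 by rewrite ler_pM.
    by move: h; lra.
  apply: (le_trans h1); apply: le_trans h2.
  have h3 : c2 * e2 * b.2%:~R <= c2 * e2 * (K2 * w.2%:~R) by rewrite ler_pM2l.
  have h4 : c2 * e2 * (34 + 2 * K2) * w.2%:~R <= c1 * w.2%:~R by rewrite ler_pM2r.
  have h5 : c1 * w.2%:~R <= g (s, 1) * w.2%:~R by rewrite ler_pM2r.
  have h6 : 0 < c2 * e2 * w.2%:~R by rewrite mulr_gt0.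
  by move: h3 h4 h5 h6; rewrite /dl; lra.
- have hk : 2 * e2 * c2 / c1 <= 1 / 16.
    by rewrite ler_pdivrMr //; move: k32; lra.
  apply: (le_trans (norm_tri gn _ (dir g (- s, - 1)) _)).
  have h1 : g (dir g (rv R (w - b)) - dir g (- s, - 1)) <= 2 * e2 * c2 / c1.
    by apply: dir_axis => //=; rewrite wb2 ?oppr_lt0 // opprK; move: ht; rewrite /transv /= wb2.
  have h2 : g (dir g (rv R (- b)) - dir g (- s, - 1)) <= 2 * e2 * c2 / c1.
    apply: dir_axis => //=; rewrite !intrN ?oppr_lt0 // opprK.
    by rewrite mulrN -opprB normrN opprK addrC.
  rewrite [X in _ + X <= _]norm_B //.
  by move: h1 h2 hk; lra.
Qed.

Variables (C : pred Z2) (Y0 : nat) (w1 : Z2).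
Hypothesis C_out : forall v, C v -> t < D 0 v.
Hypothesis C_adj : forall x y, C x -> t < D 0 y -> adj x y -> C y.
Hypothesis C_bnd : forall v, C v -> (nrm v < Y0)%N.
Hypotheses (Cw1 : C w1) (w12 : w1.2 = (nrm w1)%:Z) (sw1 : s * w1.2%:~R = w1.1%:~R).

Let tw1 : transv s w1 = 0. Proof. by rewrite /transv sw1 subrr. Qed.

(** The staircase starts above the bounded set [C] and is stopped before it enters [C]. By [C_adj]
    its last vertex, a neighbour of the hole outside the hole, lies in the ball. *)
Lemma outward kappa (Y n : nat) u : (Y0 <= Y)%N -> C u ->
  u \in (stair_col s kappa Y, Y%:Z) :: stair s kappa Y n ->
  exists q1 b, [/\ is_path (stair_col s kappa Y, Y%:Z) b q1,
    forall v : Z2, v \in (stair_col s kappa Y, Y%:Z) :: q1 ->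
      ~~ C v /\ `|transv s v - kappa| <= 2,
    u.2 <= b.2, `|transv s b - kappa| <= 2 & D 0 b <= t].
Proof.
move=> YY Cu; set top := (_, _); move=> ut.
have Ctop : ~~ C top.
  by apply/negP => /C_bnd; rewrite ltnNge => /negP; apply; rewrite /nrm /top /=; move: YY; clear; lia.
have us : u \in stair s kappa Y n.
  by move: ut; rewrite inE => /orP[/eqP uE|//]; move: Ctop; rewrite -uE Cu.
have [h1 h2] := stair_path kappa s1 Y n.
have [q1 [k1 k2 k3 k4 [c Cc bc]]] := stair_prefix h1 h2 Ctop Cu us.
have mem v : v \in top :: q1 -> `|transv s v - kappa| <= 2.
  move=> hv; have : v \in top :: stair s kappa Y n.
    by move: hv; rewrite !inE => /orP[->//|/k2 ->]; rewrite orbT.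
  by case/(stair_mem s1).
exists q1, (last top q1); split=> //.
- by move=> v hv; rewrite k3 // mem.
- by apply: mem; exact: mem_last.
- rewrite leNgt; apply/negP => hb; have := k3 _ (mem_last top q1); rewrite (C_adj Cc) //.
  by rewrite adj_sym.
Qed.

Lemma outward_at u : C u -> 0 <= u.2 ->
  exists b, [/\ u.2 <= b.2, `|transv s b - transv s u| <= 2 & D 0 b <= t].
Proof.
move=> Cu u0.
have [Y [n [YY YE]]] : exists Y n : nat, (Y0 <= Y)%N /\ Y%:Z - n%:Z = u.2.
  exists (maxn Y0 `|u.2|%N), (maxn Y0 `|u.2|%N - `|u.2|%N)%N.
  by split; [rewrite leq_maxl | move: u.2 u0; clear => z; lia].
(* On the level line through [u] the floor is exact in the row of [u], so the staircase ends at
   [u]. *)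
have uE : u = last (stair_col s (transv s u) Y, Y%:Z) (stair s (transv s u) Y n).
  rewrite stair_last // YE /stair_col /transv subrK intrKfloor.
  by case: (u).
have [|q1 [b [_ _ h1 h2 h3]]] := @outward (transv s u) Y n u YY Cu; last by exists b.
by rewrite {1}uE mem_last.
Qed.

Let H : R := (nrm w1)%:R.

Let H_t : t <= (c2 + 1) * H.
Proof. exact: out_big (C_out Cw1). Qed.

Let H_nn : 8 * (nn.+1)%:R <= H /\ 8 * (nn.+1)%:R <= e6 * H.
Proof.
have c21 : 0 < c2 + 1 by rewrite addr_gt0.
have h : 8 * (nn.+1)%:R <= e6 * H.
  rewrite -(ler_pM2r c21) (le_trans n2) // -mulrA [H * _]mulrC ler_pM2l //.
split=> //; apply: (le_trans h); rewrite ler_piMl // (le_trans he6) //.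
Qed.

Let w1_small : (4 * nrm w1 <= Rr)%N.
Proof.
have [|b [h1 _ h2]] := outward_at Cw1; first by rewrite w12.
have : (4 * nrm b <= Rr)%N by apply: ball_small; rewrite (le_trans h2) // lerDl.
have : (nrm w1 <= nrm b)%N.
  by move: h1; rewrite w12 [nrm b]/nrm; move: (nrm w1) b.1 b.2; clear; lia.
by clear; lia.
Qed.

Let local (v : Z2) := C v /\ (nrm (v - w1) <= nn)%N.

Let local_bounds v : local v ->
  [/\ (2 * nrm v <= Rr)%N, 7 / 8 * H <= (v.2%:~R : R), (v.2%:~R : R) <= H + nn%:R
    & `|transv s v| <= 2 * nn%:R].
Proof.
case=> _ hv; have [h1 _] := H_nn.
have hv2 := nrm_ge2 R (v - w1); have hvn : (nrm (v - w1))%:R <= nn%:R :> R by rewrite ler_nat.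
have n8 : (8 * nn.+1 <= nrm w1)%N by rewrite -(ler_nat R) natrM.
have e : (v - w1).2%:~R = v.2%:~R - H :> R.
  by rewrite /= intrD intrN w12.
rewrite e ler_norml in hv2; case/andP: hv2 => h2 h3.
have nn1 : (nn.+1)%:R = nn%:R + 1 :> R by rewrite -natr1.
have nn0 : 0 <= nn%:R :> R by [].
split.
- have := nrmD (v - w1) w1; rewrite subrK; move: hv w1_small n8; clear; lia.
- by move: h1 h2 hvn; rewrite nn1; lra.
- by move: h3 hvn; lra.
- rewrite -[transv s v]subr0 -tw1 -transvB (le_trans (transv_le s1 _)) //.
  by rewrite ler_pM2l.
Qed.

Let ball_local b v : local v -> D 0 b <= t -> (b.2%:~R : R) <= K2 * v.2%:~R.
Proof.
move=> /local_bounds[_ h1 _ _] Db.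
have hb : (4 * nrm b <= Rr)%N by apply: ball_small; rewrite (le_trans Db) // lerDl.
have hb2 : (4 * nrm b)%:R <= Rr%:R :> R by rewrite ler_nat.
rewrite natrM in hb2.
have hb3 : (b.2%:~R : R) <= (nrm b)%:R by apply: le_trans (nrm_ge2 R b); exact: ler_norm.
rewrite -(ler_pM2l c10) mulrA.
have H0 : 0 <= H by [].
have v0 : 0 <= (v.2%:~R : R) by move: h1 H0; lra.
have e1 : c1 * (4 * (b.2%:~R : R)) <= c1 * Rr%:R.
  by rewrite ler_pM2l //; move: hb2 hb3; lra.
have e3 : 16 * (c2 + 1) * v.2%:~R <= c1 * K2 * v.2%:~R by rewrite ler_wpM2r.
have e4 : (c2 + 1) * H <= (c2 + 1) * (2 * v.2%:~R).
  by rewrite ler_pM2l ?addr_gt0 //; move: h1 H0; lra.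
by move: e1 e3 e4 H_t tR2; lra.
Qed.

Lemma back_cone_local b v : local v -> D 0 b <= t -> `|transv s b| <= 2 * nn%:R + 4 ->
  cone_dist * r0%:R <= (b.2%:~R - v.2%:~R : R) ->
  `|transv s v - transv s b| <= e2 * (b.2%:~R - v.2%:~R) -> False.
Proof.
move=> lv Db hb hd ht; have [vR v1 v2 _] := local_bounds lv.
have [h1 h2] := H_nn; have nn1 : (nn.+1)%:R = nn%:R + 1 :> R by rewrite -natr1.
have nn0 : 0 <= nn%:R :> R by [].
have H0 : 0 < H by move: h1 nn0; rewrite nn1; lra.
have v0 : 0 < (v.2%:~R : R) by move: v1 H0; lra.
have cd : 0 < cone_dist * r0%:R by rewrite mulr_gt0 // ltr0n.
apply: (@back_cone_axis b v) => //; first by apply: C_out; case: lv.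
- by rewrite transvB.
- apply: (le_trans hb); apply: (@le_trans _ _ (e6 * (H / 2))).
    by move: h2 nn0; rewrite nn1; lra.
  by rewrite ler_pM ?(ltW e60) //; [rewrite divr_ge0 // ltW|move: v1 hd cd H0; lra].
- exact: ball_local.
Qed.

(** Otherwise the displacement from [w1] to [w2] is essentially along the axis, with a difference in
    height of at least 3/4 nn. Above the higher of the two there is a ball vertex, and the lower one
    lies in its backward cone although it is outside the ball. *)
Lemma transversal w2 : local w2 -> nrm (w2 - w1) = nn ->
  e2 / 4 * nn%:R <= `|transv s w2|.
Proof.
move=> lw2 hw2; have lw1 : local w1 by split; rewrite // subrr nrm0.
have [_ w1b _ _] := local_bounds lw1; have [_ w2b _ tw2] := local_bounds lw2.
have nn0 : 0 <= nn%:R :> R by [].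
rewrite leNgt; apply/negP => hlt.
have [h1 h2] := H_nn; have nn1 : (nn.+1)%:R = nn%:R + 1 :> R by rewrite -natr1.
have H0 : 0 < H by move: h1 nn0; rewrite nn1; lra.
have en : e2 / 4 * nn%:R <= nn%:R / 4 by rewrite mulrAC ler_pM2r // ler_piMl.
have r0' : 1 <= r0%:R :> R by [].
have D2 : 3 / 4 * nn%:R <= `|w2.2%:~R - w1.2%:~R : R|.
  have trE : transv s w2 = (w2.1%:~R - w1.1%:~R) - s * (w2.2%:~R - w1.2%:~R).
    by rewrite /transv -sw1; ring.
  have := mx_rv R (w2 - w1); rewrite hw2 /mx /= !intrD !intrN => mxE.
  have hs : `|s * (w2.2%:~R - w1.2%:~R)| <= `|w2.2%:~R - w1.2%:~R : R|.
    by rewrite normrM ler_piMl.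
  have D1 : `|w2.1%:~R - w1.1%:~R : R| <= `|transv s w2| + `|w2.2%:~R - w1.2%:~R : R|.
    have -> : w2.1%:~R - w1.1%:~R = transv s w2 + s * (w2.2%:~R - w1.2%:~R).
      by rewrite trE subrK.
    by rewrite (le_trans (ler_normD _ _)) // lerD2l.
  have : nn%:R <= `|transv s w2| + `|w2.2%:~R - w1.2%:~R : R|.
    by rewrite -mxE ge_max D1 /= lerDr.
  by move: hlt en nn0; lra.
have hcd : cone_dist * r0%:R <= nn%:R / 2.
  have : 0 <= 4 / e2 * r0%:R by rewrite mulr_ge0 // divr_ge0 // ltW.
  by move: n1'; lra.
have hcore b : e2 * (nn%:R / 2) <= e2 * b -> `|transv s w2| + 2 <= e2 * b.
  by apply: le_trans; move: hlt n1 r0'; lra.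
have [hle|hlt2] := lerP (w1.2%:~R : R) w2.2%:~R.
  rewrite ger0_norm ?subr_ge0 // in D2.
  have [|b [b1 b2 b3]] := @outward_at w2 (lw2.1).
    by rewrite -(ler_int R); move: w2b H0; lra.
  have b1' : (w2.2%:~R : R) <= b.2%:~R by rewrite ler_int.
  apply: (@back_cone_local b w1) => //.
  - by have := ler_normD (transv s b - transv s w2) (transv s w2); rewrite subrK; move: b2 tw2; lra.
  - by move: hcd D2 b1' nn0; lra.
  - rewrite tw1 sub0r normrN; apply: (@le_trans _ _ (`|transv s w2| + 2)).
      by have := ler_normD (transv s b - transv s w2) (transv s w2); rewrite subrK; move: b2; lra.
    by apply: hcore; rewrite ler_pM2l //; move: D2 b1' nn0; lra.
rewrite ltr0_norm ?subr_lt0 // in D2.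
have [|b [b1 b2 b3]] := @outward_at w1 Cw1; first by rewrite w12.
have b1' : (w1.2%:~R : R) <= b.2%:~R by rewrite ler_int.
rewrite tw1 subr0 in b2.
apply: (@back_cone_local b w2) => //.
- by move: b2 nn0; lra.
- by move: hcd D2 b1' nn0; lra.
- apply: (@le_trans _ _ (`|transv s w2| + 2)).
    by rewrite (le_trans (ler_normB _ _)) // lerD2l.
  by apply: hcore; rewrite ler_pM2l //; move: D2 b1' nn0; lra.
Qed.

Let transv_col v u : (u.2 - 1 <= v.2 <= u.2) -> transv s u + 1 < transv s v -> u.1 < v.1.
Proof.
move=> hv ht; rewrite -(ltr_int R).
have h1 : `|s * (u.2%:~R - v.2%:~R)| <= 1.
  rewrite normrM -[leRHS]mulr1 ler_pM // -intrB -intr_norm -[leRHS]/(1%:~R) ler_int.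
  by move: u.2 v.2 hv; clear => a b; lia.
rewrite ler_norml in h1; case/andP: h1 => h1 h2.
by move: ht h1 h2; rewrite /transv; lra.
Qed.

Let transv_col' v u : (u.2 - 1 <= v.2 <= u.2) -> transv s v < transv s u - 1 -> v.1 < u.1.
Proof.
move=> hv ht; rewrite -(ltr_int R).
have h1 : `|s * (u.2%:~R - v.2%:~R)| <= 1.
  rewrite normrM -[leRHS]mulr1 ler_pM // -intrB -intr_norm -[leRHS]/(1%:~R) ler_int.
  by move: u.2 v.2 hv; clear => a b; lia.
rewrite ler_norml in h1; case/andP: h1 => h1 h2.
by move: ht h1 h2; rewrite /transv; lra.
Qed.

(** The first alternative covers the vertices within [r0] of [b], whose direction is not controlled.
    Further on the near-geodesic stays in a cone around the axis that is much narrower than the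
    separation e2 / 4 of [transversal]. *)
Lemma geodesic_transv b p u : D 0 b <= t -> near_geodesic D 1 b 0 p ->
  (forall v : Z2, v \in b :: p -> D 0 v <= t) -> u \in b :: p ->
  `|transv s b| <= 2 * nn%:R + 4 -> H / 2 <= (b.2%:~R : R) ->
  `|transv s u - transv s b| <= 2 * r0%:R \/
  `|transv s u - transv s b| <= e2 / 64 * (b.2%:~R - u.2%:~R).
Proof.
move=> Db ng hp up hb b2.
have small v : v \in b :: p -> (4 * nrm v <= Rr)%N.
  by move=> /hp h; apply: ball_small; rewrite (le_trans h) // lerDl.
rewrite -transvB; have [ur|ur] := ltnP (nrm (u - b)) r0.
  by left; rewrite (le_trans (transv_le s1 _)) // ler_pM2l // ler_nat ltnW.
right; have hd := Hst ng small up ur.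
have [h1 h2] := H_nn; have nn1 : (nn.+1)%:R = nn%:R + 1 :> R by rewrite -natr1.
have nn0 : 0 <= nn%:R :> R by [].
have H0 : 0 < H by move: h1 nn0; rewrite nn1; lra.
have b20 : 0 < (b.2%:~R : R) by move: b2 H0; lra.
have hb6 : `|transv s b| <= e6 * b.2%:~R.
  apply: (le_trans hb); apply: (@le_trans _ _ (e6 * (H / 2))).
    by move: h2 nn0; rewrite nn1; lra.
  by rewrite ler_pM2l.
have d2 : g (dir g (rv R (- b)) - dir g (- s, - 1)) <= 2 * e6 * c2 / c1.
  apply: dir_axis => //=; rewrite !intrN ?oppr_lt0 // opprK.
  by rewrite mulrN -opprB normrN opprK addrC.
have z0 : rv R (u - b) != 0.
  apply: contraTneq ur => h; rewrite -ltnNge.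
  by have := low (u - b); rewrite h norm_0 // pmulr_rle0 // -[0]/(0%:R) ler_nat leqn0 => /eqP ->.
have d3 : g (dir g (rv R (u - b)) - dir g (- s, - 1)) <= eps + 2 * e6 * c2 / c1.
  by rewrite (le_trans (norm_tri gn _ (dir g (rv R (- b))) _)) // lerD.
have h35' := h35; set e5 := eps + _ in h35' d3.
have e5b : e5 <= c1 / (2 * c2).
  rewrite ler_pdivlMr ?mulr_gt0 //.
  have : c1 * (e2 / 4) <= c1 * 1 by rewrite ler_pM2l //; move: e21; lra.
  have := c10; move: h35'; lra.
have [k1 k2] := axis_of_dir gn c10 c20 g_lower g_upper s1 z0 e5b d3.
have e5c : 4 * c2 * e5 / c1 <= e2 / 64.
  by rewrite ler_pdivrMr //; move: h35'; lra.
rewrite /transv (le_trans k2) //.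
have -> : b.2%:~R - u.2%:~R = - (rv R (u - b)).2 by rewrite /= intrD intrN opprB.
by rewrite ler_wpM2r // oppr_ge0 ltW.
Qed.

(* The staircase from beyond the hole down to the ball vertex [b] from which it enters [C],
   continued by a geodesic from [b] to 0, avoids [C] but separates [wl] from [wr]. *)
Lemma no_crossing wl wr p : is_path wl wr p ->
  (forall v : Z2, v \in wl :: p -> local v) ->
  e2 / 4 * nn%:R <= transv s wr - transv s wl -> False.
Proof.
move=> hp loc htr; have [hp1 hp2] := hp.
have lwl := loc _ (mem_head _ _); have lwr : local wr by apply: loc; rewrite -hp2 mem_last.
have [h1 h2] := H_nn; have nn1 : (nn.+1)%:R = nn%:R + 1 :> R by rewrite -natr1.
have nn0 : 0 <= nn%:R :> R by [].
have H0 : 0 < H by move: h1 nn0; rewrite nn1; lra.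
have r0' : 1 <= r0%:R :> R by [].
have [_ _ _ twl] := local_bounds lwl; have [_ _ _ twr] := local_bounds lwr.
pose kappa := (transv s wl + transv s wr) / 2.
have hk : `|kappa| <= 2 * nn%:R.
  rewrite normrM [`|2^-1|]ger0_norm // ler_pdivrMr //.
  by have := ler_normD (transv s wl) (transv s wr); move: twl twr; lra.
have n8 : (8 * nn.+1 <= nrm w1)%N by rewrite -(ler_nat R) natrM.
have rows v : local v -> ((nrm w1)%:Z - nn%:Z <= v.2 <= (nrm w1)%:Z + nn%:Z).
  case=> _ hv; have : (`|v.2 - w1.2| <= nn)%N by rewrite (leq_trans _ hv) // leq_maxr.
  by rewrite w12; move: v.2 (nrm w1); clear => a b; lia.
pose Y := maxn Y0 (nrm w1 + nn).+1; pose n := (Y - (nrm w1 - nn).-1)%N.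
have YY : (Y0 <= Y)%N by rewrite leq_maxl.
have Yn : Y%:Z - n%:Z = (nrm w1)%:Z - nn%:Z - 1.
  by move: n8; rewrite /n /Y; move: (nrm w1); clear => a; lia.
have Yt : (nrm w1)%:Z + nn%:Z < Y%:Z by rewrite /Y; move: (nrm w1); clear => a; lia.
set top := (stair_col s kappa Y, Y%:Z).
(* Half of the separation is e2 / 8 * nn. By [n1] it has room for the drift e2 / 16 * nn of the
   geodesic, for its uncontrolled start and for the rounding of the staircase. *)
have farl x : `|x - kappa| <= e2 / 16 * nn%:R + 2 * r0%:R + 2 -> transv s wl + 1 < x.
  rewrite ler_norml => /andP[k1 _]; move: k1 htr n1 r0'; rewrite /kappa; lra.
have farr x : `|x - kappa| <= e2 / 16 * nn%:R + 2 * r0%:R + 2 -> x < transv s wr - 1.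
  rewrite ler_norml => /andP[_ k1]; move: k1 htr n1 r0'; rewrite /kappa; lra.
have en0 : 0 <= e2 / 16 * nn%:R by rewrite mulr_ge0 // divr_ge0 // ltW.
have near2 x : `|x - kappa| <= 2 -> `|x - kappa| <= e2 / 16 * nn%:R + 2 * r0%:R + 2.
  by move=> /le_trans; apply; move: en0 r0'; lra.
(* Crossing the complete staircase first yields a vertex [v0] of the hole on it, hence a ball vertex
   [b] at least as high on the same staircase. *)
have [v0 v0p v0s] : exists2 v : Z2, v \in wl :: p & v \in top :: stair s kappa Y n.
  have [q1 q2] := stair_path kappa s1 Y n; have q3 := stair_last kappa s1 Y n.
  apply: (@paths_cross wl wr top (stair_col s kappa (Y%:Z - n%:Z), Y%:Z - n%:Z) p) => //.
  - move=> v /loc/rows hv; rewrite /top /= Yn.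
    by move: hv Yt; move: v.2 (nrm w1); clear => a b; lia.
  - by move=> u /(stair_mem s1)[k1 k2] k3; apply: transv_col => //; apply: farl; exact: near2.
  - by move=> u /(stair_mem s1)[k1 k2] k3; apply: transv_col' => //; apply: farr; exact: near2.
have lv0 := loc _ v0p; have [_ v0b v0c _] := local_bounds lv0.
have [tv0 _] := stair_mem s1 v0s.
have [q1 [b [q1p q1C b2 tb Db]]] := outward YY (lv0.1) v0s.
have b2' : (v0.2%:~R : R) <= b.2%:~R by rewrite ler_int.
have tb2 : `|transv s b| <= 2 * nn%:R + 4.
  by have := ler_normD (transv s b - kappa) kappa; rewrite subrK; move: tb hk; lra.
have bH : H / 2 <= (b.2%:~R : R) by move: b2' v0b H0; lra.
have cd4 : 0 < 4 / e2 * r0%:R by rewrite mulr_gt0 ?divr_gt0 ?ltr0n.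
have cd : 0 < cone_dist * r0%:R by rewrite mulr_gt0 // ltr0n.
(* [b] cannot be much higher than [v0], which would otherwise lie in its backward cone. This bounds
   the drop from [b] to the rows of the hole, and with it the drift of the geodesic there. *)
have bup : (b.2%:~R : R) - v0.2%:~R <= nn%:R / 2.
  rewrite leNgt; apply/negP => hb.
  apply: (@back_cone_local b v0) => //; first by move: hb n1' cd4; lra.
  apply: (@le_trans _ _ 4).
    have -> : transv s v0 - transv s b = (transv s v0 - kappa) - (transv s b - kappa) by ring.
    by rewrite (le_trans (ler_normB _ _)) //; move: tv0 tb; lra.
  have e4 : e2 * (4 / e2 * r0%:R) <= e2 * (b.2%:~R - v0.2%:~R).
    by rewrite ler_pM2l //; move: hb n1' cd; lra.
  apply: le_trans e4; rewrite mulrA mulrCA divff ?gt_eqF // mulr1.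
  by move: r0'; lra.
have [pb [ng hpb]] := ball_geodesic Db.
have [pbp _] := ng.
have farq w u : local w -> u \in top :: q1 ++ pb -> w.2 - 1 <= u.2 <= w.2 ->
    `|transv s u - kappa| <= e2 / 16 * nn%:R + 2 * r0%:R + 2.
  move=> lw; rewrite -cat_cons mem_cat => /orP[/q1C[_ hu] _|upb hu]; first exact: near2.
  have ub : u \in b :: pb by rewrite inE upb orbT.
  have -> : transv s u - kappa = (transv s u - transv s b) + (transv s b - kappa).
    by rewrite addrA subrK.
  rewrite (le_trans (ler_normD _ _)) // lerD //.
  case: (geodesic_transv Db ng hpb ub tb2 bH) => hgeo; apply: (le_trans hgeo).
    by rewrite lerDr.
  have [_ wb1 wb2 _] := local_bounds lw.
  have u1 : (w.2%:~R : R) - 1 <= u.2%:~R.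
    by rewrite -[1]/(1%:~R) -intrB ler_int; case/andP: hu.
  have : e2 / 64 * (b.2%:~R - u.2%:~R) <= e2 / 64 * (4 * nn%:R + 32).
    rewrite ler_pM2l ?divr_gt0 //.
    have := rows _ lw => /andP[r1 _]; have r1' : H - nn%:R <= (w.2%:~R : R).
      by rewrite /H -[nn%:R]/(nn%:Z%:~R) -[(nrm w1)%:R]/((nrm w1)%:Z%:~R) -intrB ler_int.
    by move: u1 v0c bup r1' nn0; lra.
  by move: e21 e20 r0'; lra.
have [v vp vq] : exists2 v : Z2, v \in wl :: p & v \in top :: q1 ++ pb.
  apply: (@paths_cross wl wr top 0 p); first exact: hp.
  - exact: is_path_cat q1p pbp.
  - move=> v /loc/rows hv; rewrite /top /=.
    by move: hv Yt n8; move: v.2 (nrm w1); clear => a c; lia.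
  - by move=> u uq hu; apply: (transv_col hu); apply: farl; exact: (farq wl u lwl uq hu).
  - by move=> u uq hu; apply: (transv_col' hu); apply: farr; exact: (farq wr u lwr uq hu).
have Cv := (loc _ vp).1; move: vq; rewrite -cat_cons mem_cat => /orP[/q1C[]|vpb].
  by rewrite Cv.
have := hpb v; rewrite inE vpb orbT => /(_ isT); rewrite leNgt => /negP; apply.
exact: C_out.
Qed.

Lemma no_long_path w2 p : is_path w1 w2 p -> (forall v : Z2, v \in w1 :: p -> C v) ->
  (nn <= nrm (w2 - w1))%N -> False.
Proof.
move=> [hp1 hp2] hC hw; have [|p1 [p2 [pE e h]]] := @path_nrm_hits w1 nn w1 p hp1.
  by rewrite subrr nrm0 hp2.
have loc v : v \in w1 :: p1 -> local v.
  by move=> hv; split; [apply: hC; rewrite pE -cat_cons mem_cat hv | exact: h].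
have p1p : path adj w1 p1 by move: hp1; rewrite pE cat_path => /andP[].
set w := last w1 p1 in e; have lw : local w by apply: loc; exact: mem_last.
have := transversal lw e; have [tw|tw] := lerP 0 (transv s w).
  rewrite ger0_norm // => htr; apply: (@no_crossing w1 w p1) => //.
  by rewrite tw1 subr0.
rewrite ltr0_norm // => htr; apply: (@no_crossing w w1 (rev (belast w1 p1))).
- by split; [exact: rev_path_adj | exact: last_rev_belast].
- move=> v; rewrite inE mem_rev => /orP[/eqP -> //|/mem_belast]; exact: loc.
- by rewrite tw1 sub0r.
Qed.

End Slope.
End Hole.

(** * Choice of the constants and quarter turns *)

Section Det.
Variable R : realType.

Lemma powR_small (c a e : R) : 0 < c -> 0 < a -> 0 < e ->
  exists N : nat, forall k : nat, (N <= k)%N -> (0 < k)%N -> c * powR k%:R (- a) <= e.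
Proof.
move=> c0 a0 e0; pose x := powR (c / e) a^-1.
have x0 : 0 <= x by exact: powR_ge0.
exists (Num.truncn x).+1 => k Nk k0.
have xk : x <= k%:R.
  have /andP[_ h] := truncn_itv x0; apply: (le_trans (ltW h)); by rewrite ler_nat.
have k0R : 0 < k%:R :> R by rewrite ltr0n.
have : c / e <= powR k%:R a.
  have -> : c / e = powR x a.
    by rewrite /x -powRrM mulVf ?gt_eqF // powRr1 // divr_ge0 // ltW.
  by apply: ge0_ler_powR => //; rewrite ?nnegrE // ltW.
have p0 : 0 < powR k%:R a :> R by rewrite powR_gt0.
by rewrite powRN ler_pdivrMr // mulrC ler_pdivrMr.
Qed.

Section Dyadic.
Variables (cpsi delta c1 K b : R).
Hypotheses (cpsi0 : 0 < cpsi) (d0 : 0 < delta) (d1 : delta <= 1) (c10 : 0 < c1).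
Hypotheses (K0 : 0 < K) (b0 : 0 < b).

Let psi (k : nat) : R := cpsi * powR k%:R (- delta).

(* The angular errors at the scales k, 2k, 4k, ... add up to a geometric series. *)
Lemma summable_angles (e : R) : 0 < e -> exists (Th : nat -> R) (N : nat), (0 < N)%N /\
  forall k, (N <= k)%N -> [/\ 0 <= rel_err c1 psi k, rel_err c1 psi k <= 1 / 2, 0 <= Th k,
    K * powR (rel_err c1 psi k) b + Th (2 * k)%N <= Th k & Th k <= e /\ psi k <= e].
Proof.
move=> e0; pose c4 := (3 * cpsi + 1) / c1; pose c5 := K * powR c4 b.
have c40 : 0 < c4 by rewrite divr_gt0 // addr_gt0 // mulr_gt0.
have c50 : 0 < c5 by rewrite mulr_gt0 // powR_gt0.
pose d' := delta * b; have d'0 : 0 < d' by rewrite mulr_gt0.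
pose q : R := powR 2 (- d').
have q1 : q < 1.
  have one : 1 = powR 1 d' :> R by rewrite powR1.
  by rewrite /q powRN invf_lt1 ?powR_gt0 // [ltLHS]one gt0_ltr_powR ?nnegrE // ltr1n.
have q0 : 0 <= q by exact: powR_ge0.
pose c3 := c5 / (1 - q); have c30 : 0 < c3 by rewrite divr_gt0 // subr_gt0.
have half : 0 < 1 / 2 :> R by [].
have [N1 h1] := powR_small c40 d0 half.
have [N2 h2] := powR_small c30 d'0 e0.
have [N3 h3] := powR_small cpsi0 d0 e0.
exists (fun k => c3 * powR k%:R (- d')), (maxn 1 (maxn N1 (maxn N2 N3))).
split; first by rewrite leq_maxl.
move=> k; rewrite !geq_max => /and4P[k0 k1 k2 k3].
have k0R : 0 < k%:R :> R by rewrite ltr0n.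
have e40 : 0 <= rel_err c1 psi k.
  by rewrite divr_ge0 ?(ltW c10) // addr_ge0 ?invr_ge0 // !mulr_ge0 ?powR_ge0 // ltW.
have e4 : rel_err c1 psi k <= c4 * powR k%:R (- delta).
  rewrite /rel_err /c4 mulrAC ler_pM2r ?invr_gt0 // [leRHS]mulrDl mul1r lerD //.
    by rewrite /psi mulrA.
  rewrite -powR_inv1 // ; apply: ler_powR; first by rewrite ler1n.
  by rewrite lerN2.
split.
- exact: e40.
- exact: le_trans (h1 k k1 k0).
- by rewrite mulr_ge0 ?powR_ge0 // ltW.
- have -> : powR (2 * k)%:R (- d') = q * powR k%:R (- d') :> R.
    by rewrite natrM powRM.
  have hp : K * powR (rel_err c1 psi k) b <= c5 * powR k%:R (- d').
    rewrite /c5 -mulrA ler_pM2l //.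
    have -> : powR c4 b * powR k%:R (- d') = powR (c4 * powR k%:R (- delta)) b.
      by rewrite powRM ?powR_ge0 ?(ltW c40) // -powRrM mulNr.
    by apply: ge0_ler_powR; rewrite ?nnegrE ?(ltW b0) // mulr_ge0 ?powR_ge0 // ltW.
  apply: (@le_trans _ _ (c5 * powR k%:R (- d') + c3 * (q * powR k%:R (- d')))).
    by rewrite lerD2r.
  have -> // : c5 * powR k%:R (- d') + c3 * (q * powR k%:R (- d')) = c3 * powR k%:R (- d').
  rewrite /c3; field; rewrite subr_eq0 eq_sym lt_eqF //.
- by split; [exact: h2 | exact: h3].
Qed.
End Dyadic.

Variables (delta cpsi : R).
Hypotheses (cpsi0 : 0 < cpsi) (d0 : 0 < delta) (d1 : delta <= 1).

Definition metric_approx (g : R * R -> R) (c1 : R) D (Rr r0 : nat) (t : R) :=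
  [/\ length_metric D,
   forall (k : nat) v x, (r0 <= k <= Rr)%N -> (nrm v <= Rr)%N -> (nrm x <= 8 * k)%N ->
    `|D v (v + x) - g (rv R x)| <= k%:R * (cpsi * powR k%:R (- delta)),
   8 * (t + 3 + c1) <= c1 * Rr%:R & c1 * Rr%:R <= 32 * t].

Definition hole_in (D : Z2 -> Z2 -> R) (t : R) (C : pred Z2) (Y0 : nat) :=
  [/\ forall v, C v -> t < D 0 v,
      forall x y, C x -> t < D 0 y -> adj x y -> C y &
      forall v, C v -> (nrm v < Y0)%N].

(** [U] restricts the starting vertex, so that the directions can be treated one quadrant at a time.
    The constants are chosen before [D], [t] and the scales: they depend on the norm and the error
    rate only. *)
Definition holes_bounded (g : R * R -> R) (c1 : R) (U : Z2 -> Prop) :=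
  exists (A rmin : nat) (T : R), forall D Rr r0 t, metric_approx g c1 D Rr r0 t ->
  (rmin <= r0)%N -> (0 < r0)%N -> T * r0%:R <= t ->
  forall C Y0, hole_in D t C Y0 -> forall w1 w2 p, U w1 -> is_path w1 w2 p ->
  (forall v : Z2, v \in w1 :: p -> C v) -> (nrm (w2 - w1) < A * r0)%N.

Lemma holes_bounded_up g c1 c2 : is_norm2 g -> uniform_curvature g -> 0 < c1 -> 0 < c2 ->
  (forall z, c1 * mx z <= g z) -> (forall z, g z <= c2 * mx z) ->
  holes_bounded g c1 (fun w => w.2 = (nrm w)%:Z).
Proof.
move=> gn curv c10 c20 low upp.
have c12 : c1 <= c2 by exact: c1_le_c2 low upp.
have B0 : 0 <= 5 * c2 / c1 by rewrite divr_ge0 ?(ltW c10) // mulr_ge0 // ltW.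
have [K [b [K0 b0 _ hKb]]] := curvature_dir gn curv B0.
pose K2 := 16 * (c2 + 1) / c1.
have K20 : 0 < K2 by rewrite divr_gt0 // mulr_gt0 // addr_gt0.
pose e2 := c1 / (c2 * (34 + 2 * K2)).
have den0 : 0 < c2 * (34 + 2 * K2) by rewrite mulr_gt0 // addr_gt0 // mulr_gt0.
have e20 : 0 < e2 by rewrite divr_gt0.
have e21 : e2 <= 1.
  rewrite ler_pdivrMr // mul1r (le_trans c12) // ler_peMr ?(ltW c20) //.
  by move: K20; lra.
have he2 : c2 * e2 * (34 + 2 * K2) <= c1.
  by rewrite /e2 mulrAC mulrCA divff ?mulr1 // gt_eqF.
(* Chosen so that the term with [e6] uses exactly half of the budget c1 e2 / 4 in [h35]; [eps] is
   bounded so as to fit into the other half. *)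
pose e6 := c1 ^+ 2 * e2 / (16 * (64 * c2 ^+ 2)).
have c22 : 0 < c2 ^+ 2 by rewrite exprn_gt0.
have e60 : 0 < e6.
  by apply: divr_gt0; apply: mulr_gt0 => //; [exact: exprn_gt0 | exact: mulr_gt0].
have he6 : e6 <= e2.
  rewrite ler_pdivrMr; last by apply: mulr_gt0 => //; exact: mulr_gt0.
  rewrite mulrC ler_pM2l //.
  have h : c1 ^+ 2 <= c2 ^+ 2 by rewrite ler_sqr ?nnegrE // ltW.
  by move: h c22; lra.
pose eps := Num.min (Num.min (c1 / 8) (1 / 8)) (c1 * e2 / (8 * (64 * c2))).
have eps0 : 0 < eps.
  rewrite !lt_min; apply/andP; split; first by rewrite !divr_gt0.
  apply: divr_gt0; first exact: mulr_gt0.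
  by apply: mulr_gt0 => //; exact: mulr_gt0.
have eps1 : eps <= c1 / 8 by rewrite !ge_min lexx.
have eps2 : eps <= 1 / 8 by rewrite !ge_min lexx orbT.
have eps3 : eps <= c1 * e2 / (8 * (64 * c2)) by rewrite !ge_min lexx orbT.
have h35 : 64 * c2 * (eps + 2 * e6 * c2 / c1) <= c1 * (e2 / 4).
  have h : 64 * c2 * (2 * e6 * c2 / c1) = c1 * e2 / 8.
    by rewrite /e6; field; rewrite !gt_eqF.
  have h' : 64 * c2 * eps <= c1 * e2 / 8.
    apply: (@le_trans _ _ (64 * c2 * (c1 * e2 / (8 * (64 * c2))))); first by rewrite ler_pM2l // mulr_gt0.
    have -> // : 64 * c2 * (c1 * e2 / (8 * (64 * c2))) = c1 * e2 / 8 by field; rewrite gt_eqF.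
  by rewrite mulrDr h; move: h'; lra.
have [Th [N [N0 hTh]]] := summable_angles cpsi0 d0 d1 c10 K0 b0 eps0.
pose cd := cone_dist c1 c2.
have cd0 : 0 < cd by rewrite divr_gt0 // mulr_gt0 // !addr_gt0 // mulr_gt0.
pose A := maxn (Num.truncn (96 / e2)).+1 (Num.truncn (2 * (cd + 4 / e2))).+1.
have trunc (x : R) : 0 <= x -> x <= (Num.truncn x).+1%:R.
  by move=> x0; have /andP[_ /ltW] := truncn_itv x0.
have A1 : 96 / e2 <= A%:R.
  by rewrite (le_trans (trunc _ _)) ?ler_nat ?leq_maxl // divr_ge0 // ltW.
have A2 : 2 * (cd + 4 / e2) <= A%:R.
  by rewrite (le_trans (trunc _ _)) ?ler_nat ?leq_maxr // mulr_ge0 // addr_ge0 ?(ltW cd0) // divr_ge0 // (ltW e20).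
pose T := Num.max (Num.max (4 * c1) (c2 + 3)) (8 * (A.+1)%:R * (c2 + 1) / e6).
exists A, N, T => D Rr r0 t [lm happ t1 t2] r0N r00 tT C Y0 [C1 C2 C3] w1 w2 p w12 hp hC.
rewrite ltnNge; apply/negP => hbig.
have r0R : 1 <= r0%:R :> R by rewrite ler1n.
have r0R' : 0 < r0%:R :> R by rewrite ltr0n.
have T1 : 4 * c1 * r0%:R <= t.
  by apply: le_trans tT; rewrite ler_pM2r // !le_max lexx.
have T2 : (c2 + 2) * r0%:R < t.
  apply: (@lt_le_trans _ _ ((c2 + 3) * r0%:R)); first by rewrite ltr_pM2r // ltrD2l ltr_nat.
  by apply: le_trans tT; rewrite ler_pM2r // !le_max lexx orbT.
have T3 : 8 * ((A * r0).+1)%:R * (c2 + 1) <= e6 * t.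
  apply: (@le_trans _ _ (8 * ((A.+1)%:R * r0%:R) * (c2 + 1))).
    rewrite ler_pM2r ?addr_gt0 // ler_pM2l // -natrM ler_nat mulSn.
    by rewrite -add1n leq_add2r.
  have : 8 * (A.+1)%:R * (c2 + 1) / e6 * r0%:R <= t.
    by apply: le_trans tT; rewrite ler_pM2r // !le_max lexx !orbT.
  rewrite -(ler_pM2l e60); apply: le_trans.
  have -> // : 8 * ((A.+1)%:R * r0%:R) * (c2 + 1) = e6 * (8 * (A.+1)%:R * (c2 + 1) / e6 * r0%:R).
  by field; rewrite gt_eqF.
have hTh' k : (r0 <= k)%N -> _ := fun h => hTh k (leq_trans r0N h).
(* The slope of the ray through [w1]. If [w1] is the origin the quotient is 0 by convention, and
   both claims still hold. *)
have sw : `|w1.1%:~R / w1.2%:~R : R| <= 1 /\ w1.1%:~R / w1.2%:~R * w1.2%:~R = w1.1%:~R :> R.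
  have [z|z] := eqVneq w1.2 0.
    have : (nrm w1 == 0)%N by move: w12; rewrite z; clear; lia.
    by rewrite nrm_eq0 => /eqP ->; rewrite /= !mul0r normr0.
  rewrite divfK ?intr_eq0 //; split=> //.
  rewrite normf_div ler_pdivrMr ?normr_gt0 ?intr_eq0 // mul1r w12.
  by rewrite [leRHS]ger0_norm ?ler0z //; exact: nrm_ge1.
have K2h : 16 * (c2 + 1) <= c1 * K2 by rewrite /K2 mulrCA divff ?mulr1 // gt_eqF.
have HDe : forall (k : nat) v x, (r0 <= k <= Rr)%N -> (nrm v <= Rr)%N ->
    (nrm x <= 8 * k)%N -> `|D v (v + x) - g (rv R x)| <= k%:R * eps.
  move=> k v x hk hv hx; apply: (le_trans (happ k v x hk hv hx)).
  by rewrite ler_wpM2l //; case/andP: hk => /hTh'[_ _ _ _ [_ h]] _.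
apply: (@no_long_path R g c1 c2 gn c10 c20 low upp D Rr r0 t eps lm r00 HDe _ (ltW eps0)
  eps1 eps2 t1 t2 T1 T2 K2 e2 e6 (A * r0)%N K2h e20 e21 he2 e60 he6 h35 _ _ T3
  _ sw.1 C Y0 w1 C1 C2 C3 _ w12 sw.2 w2 p hp hC hbig).
- move=> b' p' ng small v vp hv; apply: (@le_trans _ _ (Th (nrm (v - b')))).
    apply: (@straight R g c1 c2 gn c10 c20 low upp D Rr r0 (fun k => cpsi * powR k%:R (- delta))
      lm happ r00 K b hKb Th _ b' p' ng small v vp hv).
    by move=> k /hTh'[].
  by have [_ _ _ _ []] := hTh' _ hv.
- by rewrite natrM mulrA ler_pM2r // -ler_pdivrMl // mulrC.
- by rewrite natrM ler_pM2r.
- by apply: hC; exact: mem_head.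
Qed.

Definition rot (v : Z2) : Z2 := (- v.2, v.1).
Definition irot (v : Z2) : Z2 := (v.2, - v.1).
Definition rotR (z : R * R) : R * R := (- z.2, z.1).

Let rotK v : irot (rot v) = v. Proof. by case: v => a b; rewrite /irot /rot /= opprK. Qed.
Let irotK v : rot (irot v) = v. Proof. by case: v => a b; rewrite /irot /rot /= opprK. Qed.

Let adj_irot u v : adj (irot u) (irot v) = adj u v.
Proof. by case: u v => [a b] [c d]; rewrite !adjE /=; lia. Qed.

Let adj_rot u v : adj (rot u) (rot v) = adj u v.
Proof. by rewrite -adj_irot !rotK. Qed.

Let rotD u v : rot (u + v) = rot u + rot v.
Proof. by case: u v => [a b] [c d]; rewrite /rot /=; congr (_, _) => /=; lia. Qed.

Let nrm_rot v : nrm (rot v) = nrm v.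
Proof. by case: v => [a b]; rewrite /nrm /rot /=; lia. Qed.

Let nrm_irot v : nrm (irot v) = nrm v.
Proof. by rewrite -[in RHS](irotK v) nrm_rot. Qed.

Let path_irot x p : path adj (irot x) (map irot p) = path adj x p.
Proof. by elim: p x => //= y p IH x; rewrite IH adj_irot. Qed.

Let rv_rot v : rv R (rot v) = rotR (rv R v).
Proof. by rewrite /rv /rotR /rot /= intrN. Qed.

Let is_path_irot x y p : is_path x y p -> is_path (irot x) (irot y) (map irot p).
Proof. by case=> h1 h2; split; rewrite ?path_irot // last_map h2. Qed.

Lemma length_metric_rot D : length_metric D -> length_metric (fun x y => D (rot x) (rot y) : R).
Proof.
case=> h1 h2 h3 h4; split=> // x y s s0; have [p [hp hng]] := h4 (rot x) (rot y) s s0.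
exists (map irot p); split; first by rewrite -(rotK x) -(rotK y); exact: is_path_irot.
move=> p1 p2 p3 pE; have pE' : p = map rot p1 ++ map rot p2 ++ map rot p3.
  by rewrite -!map_cat -pE -map_comp map_id_in // => v _ /=; exact: irotK.
by have := hng _ _ _ pE'; rewrite -map_cat !last_map.
Qed.

(** Hole and metric are pulled back by the quarter turn, which preserves adjacency and [nrm]; the
    new metric is close to the turned norm. *)
Lemma holes_bounded_rot g c1 U : holes_bounded (fun z => g (rotR z)) c1 U ->
  holes_bounded g c1 (fun w => U (irot w)).
Proof.
case=> A [rmin [T hT]]; exists A, rmin, T => D Rr r0 t [lm happ t1 t2] rr r00 Tt C Y0 [C1 C2 C3].
move=> w1 w2 p Uw hp hC; rewrite -nrm_irot.
have -> : irot (w2 - w1) = irot w2 - irot w1.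
  by case: (w1) (w2) => [a b] [c d]; rewrite /irot /=; congr (_, _) => /=; lia.
apply: (hT (fun x y => D (rot x) (rot y)) Rr r0 t _ rr r00 Tt (fun v => C (rot v)) Y0 _ _ _
  (map irot p) Uw).
- split=> //; first exact: length_metric_rot.
  move=> k v x hk hv hx; rewrite rotD -rv_rot; apply: happ => //; by rewrite nrm_rot.
- split.
  + by move=> v /C1; have -> : rot 0 = 0 by rewrite /rot /= oppr0.
  + move=> x y Cx; have -> : rot 0 = 0 by rewrite /rot /= oppr0.
    by move=> hy xy; apply: (C2 (rot x)); rewrite // adj_rot.
  + by move=> v /C3; rewrite nrm_rot.
- exact: is_path_irot.
- by move=> v; rewrite -map_cons => /mapP[u /hC Cu ->]; rewrite irotK.
Qed.

Lemma holes_bounded_sub g c1 (U V : Z2 -> Prop) : (forall w, V w -> U w) ->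
  holes_bounded g c1 U -> holes_bounded g c1 V.
Proof.
move=> VU [A [rmin [T hT]]]; exists A, rmin, T => D Rr r0 t hm rr r00 Tt C Y0 hC w1 w2 p Vw.
exact: (hT D Rr r0 t hm rr r00 Tt C Y0 hC w1 w2 p (VU _ Vw)).
Qed.

Lemma holes_bounded_or g c1 (U V : Z2 -> Prop) :
  holes_bounded g c1 U -> holes_bounded g c1 V -> holes_bounded g c1 (fun w => U w \/ V w).
Proof.
move=> [A [rmin [T hT]]] [A' [rmin' [T' hT']]].
exists (maxn A A'), (maxn rmin rmin'), (Num.max T T') => D Rr r0 t hm rr r00 Tt C Y0 hC w1 w2 p.
have r0R : 0 <= r0%:R :> R by [].
have Tt1 : T * r0%:R <= t by apply: le_trans Tt; rewrite ler_wpM2r // le_max lexx.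
have Tt2 : T' * r0%:R <= t by apply: le_trans Tt; rewrite ler_wpM2r // le_max lexx orbT.
move: rr; rewrite geq_max => /andP[r1 r2] [Uw|Vw] hp hv.
  rewrite (leq_trans (hT D Rr r0 t hm r1 r00 Tt1 C Y0 hC w1 w2 p Uw hp hv)) //.
  by rewrite leq_mul2r leq_maxl orbT.
rewrite (leq_trans (hT' D Rr r0 t hm r2 r00 Tt2 C Y0 hC w1 w2 p Vw hp hv)) //.
by rewrite leq_mul2r leq_maxr orbT.
Qed.

Lemma norm2_rot g : is_norm2 g -> is_norm2 (fun z => g (rotR z)).
Proof.
case=> h1 h2 h3 h4; split=> //.
- move=> [a b] /h2; rewrite /rotR /= => -[/eqP e1 ->]; congr (_, _).
  by move: e1; rewrite oppr_eq0 => /eqP.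
- by move=> c z; rewrite -h3 /rotR /= mulrN.
- by move=> z w; rewrite /rotR /= opprD; exact: (h4 (rotR z) (rotR w)).
Qed.

Lemma curvature_rot g : uniform_curvature g -> uniform_curvature (fun z => g (rotR z)).
Proof.
case=> c [eta [c0 [eta0 h]]]; exists c, eta; split=> //; split=> // z1 z2 g1 g2 l hl.
have := h _ _ g1 g2 l hl; rewrite /rotR /=.
have -> : (1 - l) * - z1.2 + l * - z2.2 = - ((1 - l) * z1.2 + l * z2.2) by ring.
have opB (x y : R) : - (x - y) = - x - - y by ring.
by rewrite !opB.
Qed.

(** Up to quarter turns, the second coordinate of a vertex equals its sup norm; the turns preserve
    the norm axioms, the curvature condition and the bounds [c1] and [c2]. *)
Lemma holes_bounded_all g c1 c2 : is_norm2 g -> uniform_curvature g -> 0 < c1 -> 0 < c2 ->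
  (forall z, c1 * mx z <= g z) -> (forall z, g z <= c2 * mx z) ->
  holes_bounded g c1 (fun=> True).
Proof.
move=> gn curv c10 c20 low upp.
have mx_rot z : mx (rotR z) = mx z by rewrite /mx /rotR /= normrN maxC.
have low' : forall z, c1 * mx z <= g (rotR z) by move=> z; rewrite -mx_rot.
have upp' : forall z, g (rotR z) <= c2 * mx z by move=> z; rewrite -[mx z]mx_rot.
have low2 : forall z, c1 * mx z <= g (rotR (rotR z)) by move=> z; rewrite -mx_rot.
have upp2 : forall z, g (rotR (rotR z)) <= c2 * mx z by move=> z; rewrite -[mx z]mx_rot.
have low3 : forall z, c1 * mx z <= g (rotR (rotR (rotR z))) by move=> z; rewrite -mx_rot.
have upp3 : forall z, g (rotR (rotR (rotR z))) <= c2 * mx z by move=> z; rewrite -[mx z]mx_rot.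
have gn1 := norm2_rot gn; have gn2 := norm2_rot gn1; have gn3 := norm2_rot gn2.
have cu1 := curvature_rot curv; have cu2 := curvature_rot cu1; have cu3 := curvature_rot cu2.
have b0 := holes_bounded_up gn curv c10 c20 low upp.
have b1 := holes_bounded_rot (holes_bounded_up gn1 cu1 c10 c20 low' upp').
have b2 := holes_bounded_rot (holes_bounded_rot (holes_bounded_up gn2 cu2 c10 c20 low2 upp2)).
have b3 := holes_bounded_rot (holes_bounded_rot (holes_bounded_rot
  (holes_bounded_up gn3 cu3 c10 c20 low3 upp3))).
apply: holes_bounded_sub (holes_bounded_or b0 (holes_bounded_or b1 (holes_bounded_or b2 b3))).
move=> [a b] _; rewrite /irot /nrm /=; clear; lia.
Qed.

End Det.

(** * Talagrand's concentration inequality *)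

Section ProductSpace.
Variables (R : realType) (V : finType) (p : V -> R).
Hypotheses (p0 : forall v, 0 <= p v) (p1 : \sum_v p v = 1).

(** Expectation under the n-fold product of [p]. Peeling off the first coordinate is the induction
    step both of Talagrand's inequality and of the transfer to edge weights. *)
Fixpoint Exl (n : nat) (F : seq V -> R) : R :=
  if n is m.+1 then \sum_v p v * Exl m (fun l => F (v :: l)) else F [::].

Definition Prl n (A : pred (seq V)) : R := Exl n (fun l => (A l)%:R).

Lemma Exl_le n F G : (forall l, size l = n -> F l <= G l) -> Exl n F <= Exl n G.
Proof.
elim: n F G => [|n IH] F G h /=; first exact: h.
by apply: ler_sum => v _; rewrite ler_wpM2l // IH // => l sl; apply: h; rewrite /= sl.
Qed.

Lemma Exl_eq n F G : (forall l, size l = n -> F l = G l) -> Exl n F = Exl n G.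
Proof. by move=> h; apply/eqP; rewrite eq_le !Exl_le // => l /h ->. Qed.

Lemma Exl_cst n c : Exl n (fun=> c) = c.
Proof. by elim: n => //= n ->; rewrite -mulr_suml p1 mul1r. Qed.

Lemma ExlD n F G : Exl n (fun l => F l + G l) = Exl n F + Exl n G.
Proof.
elim: n F G => //= n IH F G; rewrite -big_split /=; apply: eq_bigr => v _.
by rewrite IH mulrDr.
Qed.

Lemma ExlZ n c F : Exl n (fun l => c * F l) = c * Exl n F.
Proof.
elim: n F => //= n IH F; rewrite mulr_sumr; apply: eq_bigr => v _.
by rewrite IH mulrCA.
Qed.

Lemma Exl_ge0 n F : (forall l, size l = n -> 0 <= F l) -> 0 <= Exl n F.
Proof. by move=> h; rewrite -(Exl_cst n 0); exact: Exl_le. Qed.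

Lemma Exl_cat m n F : Exl (m + n) F = Exl m (fun l1 => Exl n (fun l2 => F (l1 ++ l2))).
Proof. by elim: m F => //= m IH F; apply: eq_bigr => v _; rewrite IH. Qed.

Lemma Prl_ge0 n A : 0 <= Prl n A.
Proof. by apply: Exl_ge0 => l _; case: (A l). Qed.

Lemma Prl_le n (A B : pred (seq V)) : (forall l, size l = n -> A l -> B l) -> Prl n A <= Prl n B.
Proof.
by move=> h; apply: Exl_le => l /h; case: (A l) => [->//|_]; case: (B l).
Qed.

Lemma PrlC n A : Prl n (fun l => ~~ A l) = 1 - Prl n A.
Proof.
apply/eqP; rewrite eq_sym subr_eq -ExlD -[X in X == _](Exl_cst n 1); apply/eqP.
by apply: Exl_eq => l _; case: (A l); rewrite ?addr0 ?add0r.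
Qed.

Lemma PrlU n A B : Prl n (fun l => A l || B l) <= Prl n A + Prl n B.
Proof.
rewrite -ExlD; apply: Exl_le => l _.
by case: (A l); case: (B l); rewrite /= ?addr0 ?add0r // lerDl.
Qed.

Lemma Prl_prod m n A B :
  Prl (m + n) (fun l => A (take m l) && B (drop m l)) = Prl m A * Prl n B.
Proof.
rewrite /Prl Exl_cat; transitivity (Exl m (fun l1 => Prl n B * (A l1)%:R)); last first.
  by rewrite ExlZ mulrC.
apply: Exl_eq => l1 s1; rewrite mulrC -ExlZ; apply: Exl_eq => l2 _.
by rewrite take_cat drop_cat s1 ltnn subnn take0 drop0 cats0 -natrM mulnb.
Qed.

Lemma Exl_prod n (f : V -> R) :
  Exl n (fun l => \prod_(v <- l) f v) = (\sum_v p v * f v) ^+ n.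
Proof.
elim: n => [|n IH] /=; first by rewrite big_nil expr0.
rewrite exprS mulr_suml; apply: eq_bigr => v _; rewrite -mulrA -IH -[f v * _]ExlZ.
by congr (_ * _); apply: Exl_eq => l _; rewrite big_cons.
Qed.

Lemma Exl_markov n (F : seq V -> R) (A : pred (seq V)) c : (forall l, size l = n -> 0 <= F l) ->
  (forall l, size l = n -> A l -> c <= F l) -> c * Prl n A <= Exl n F.
Proof.
move=> F0 h; rewrite -ExlZ; apply: Exl_le => l sl.
have := h l sl; case: (A l) => [/(_ isT) hl|_]; first by rewrite mulr1.
by rewrite mulr0 F0.
Qed.

Lemma expR_convex (l x y : R) : 0 <= l -> l <= 1 ->
  expR (l * x + (1 - l) * y) <= l * expR x + (1 - l) * expR y.
Proof.
move=> l0 l1; set m := l * x + _.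
have h z : expR m * (1 + (z - m)) <= expR z.
  have -> : expR z = expR m * expR (z - m) by rewrite -expRD addrC subrK.
  by rewrite ler_pM2l ?expR_gt0 // expR_ge1Dx.
have hx : l * (expR m * (1 + (x - m))) <= l * expR x by rewrite ler_wpM2l.
have hy : (1 - l) * (expR m * (1 + (y - m))) <= (1 - l) * expR y.
  by rewrite ler_wpM2l // subr_ge0.
apply: le_trans (lerD hx hy); rewrite le_eqVlt; apply/orP; left; apply/eqP.
by rewrite /m; ring.
Qed.

(** In the induction of [talagrand], a ratio exp(-r) of probabilities with the weight lam = 1 - 4 r
    yields the factor exp(lam r + (1 - lam)^2 / 8), which is the left-hand side; it has to be at
    most 2 minus the ratio. *)
Lemma expR_parabola (r : R) : 0 <= r -> r <= 1 / 4 -> expR (r - 2 * r ^+ 2) <= 2 - expR (- r).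
Proof.
move=> r0 r1; have d0 : 0 < 1 - r + 2 * r ^+ 2 by have := sqr_ge0 r; lra.
have h1 : expR (r - 2 * r ^+ 2) <= (1 - r + 2 * r ^+ 2)^-1.
  rewrite -[leLHS]invrK -expRN lef_pV2 ?posrE ?invr_gt0 ?expR_gt0 //.
  by apply: le_trans (expR_ge1Dx _); lra.
have h2 : expR (- r) <= (1 + r)^-1.
  by rewrite expRN lef_pV2 ?posrE ?expR_gt0 ?expR_ge1Dx //; lra.
apply: (le_trans h1); have : (1 - r + 2 * r ^+ 2)^-1 + (1 + r)^-1 <= 2; last by move: h2; lra.
have r1' : 0 < 1 + r by lra.
have -> : (1 - r + 2 * r ^+ 2)^-1 + (1 + r)^-1 =
    (2 + 2 * r ^+ 2) / ((1 - r + 2 * r ^+ 2) * (1 + r)) by field; rewrite !gt_eqF.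
rewrite ler_pdivrMr ?mulr_gt0 //.
have -> : 2 * ((1 - r + 2 * r ^+ 2) * (1 + r)) = 2 + 2 * r ^+ 2 + 4 * r ^+ 3 by ring.
by rewrite lerDl mulr_ge0 // exprn_ge0.
Qed.

(** The endpoint r = 1/4 of [expR_parabola], where the weight of the section is 0; it also serves
    all smaller ratios. *)
Lemma expR_eighth : expR (1 / 8 : R) <= 2 - expR (- (1 / 4)).
Proof.
have h1 : expR (1 / 8 : R) <= 8 / 7.
  have -> : 8 / 7 = (7 / 8)^-1 :> R by rewrite invf_div.
  rewrite -[leLHS]invrK -expRN lef_pV2 ?posrE ?expR_gt0 //.
  by have := expR_ge1Dx (- (1 / 8) : R); lra.
have h2 : expR (- (1 / 4) : R) <= 4 / 5.
  have -> : 4 / 5 = (5 / 4)^-1 :> R by rewrite invf_div.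
  rewrite expRN lef_pV2 ?posrE ?expR_gt0 //.
  by have := expR_ge1Dx (1 / 4 : R); lra.
by move: h1 h2; lra.
Qed.

(** Coordinate [i] of a combination of the difference vectors between [l] and the points listed in
    [c]. The least sum of squares over convex combinations of points of a set is the squared convex
    distance to it. *)
Definition mismatch (v0 : V) (c : seq (R * seq V)) (l : seq V) (i : nat) : R :=
  \sum_(x <- c) x.1 * (nth v0 l i != nth v0 x.2 i)%:R.

Definition convex_in (A : pred (seq V)) n (c : seq (R * seq V)) :=
  \sum_(x <- c) x.1 = 1 /\
  forall x, x \in c -> [/\ 0 <= x.1, size x.2 = n & A x.2].

Lemma mismatch_cat v0 c c' l i : mismatch v0 (c ++ c') l i = mismatch v0 c l i + mismatch v0 c' l i.
Proof. by rewrite /mismatch big_cat. Qed.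

Definition lift_comb (a : R) (h : seq V -> V) (c : seq (R * seq V)) :=
  [seq (a * x.1, h x.2 :: x.2) | x <- c].

Lemma lift_comb_sum a h c : \sum_(x <- lift_comb a h c) x.1 = a * \sum_(x <- c) x.1.
Proof. by rewrite big_map mulr_sumr. Qed.

Lemma mismatch_liftS v0 a h c v l i :
  mismatch v0 (lift_comb a h c) (v :: l) i.+1 = a * mismatch v0 c l i.
Proof. by rewrite /mismatch big_map mulr_sumr; apply: eq_bigr => x _; rewrite mulrA. Qed.

Lemma mismatch_lift0 v0 a h c v l :
  mismatch v0 (lift_comb a h c) (v :: l) 0 = a * \sum_(x <- c) x.1 * (v != h x.2)%:R.
Proof. by rewrite /mismatch big_map mulr_sumr; apply: eq_bigr => x _; rewrite mulrA. Qed.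

(* Talagrand's convex distance inequality; [F] bounds the squared convex distance. *)
Lemma talagrand v0 n (A : pred (seq V)) : 0 < Prl n A ->
  exists F : seq V -> R, Exl n (fun l => expR (F l / 8)) <= (Prl n A)^-1 /\
  forall l, size l = n -> exists2 c, convex_in A n c &
    \sum_(i < n) mismatch v0 c l i ^+ 2 <= F l.
Proof.
elim: n A => [|n IH] A PA.
  have A0 : A [::] by move: PA; rewrite /Prl /=; case: (A _) => //; rewrite ltxx.
  exists (fun=> 0); split; first by rewrite /Prl /= A0 mul0r expR0 invr1.
  move=> l /size0nil ->; exists [:: (1, [::])]; last by rewrite big_ord0.
  by split; [rewrite big_seq1|move=> x; rewrite inE => /eqP ->; rewrite ler01].
(* Sections of [A] at a fixed first coordinate, and the projection that forgets it. Using the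
   section costs nothing in the first coordinate; using the projection costs at most 1. *)
pose Av v := [pred l | A (v :: l)]; pose B := [pred l | [exists v, A (v :: l)]].
pose a v := Prl n (Av v); pose PB := Prl n B.
have aB v : a v <= PB by apply: Prl_le => l _ h; apply/existsP; exists v.
have PAE : Prl n.+1 A = \sum_v p v * a v by [].
have PAB : Prl n.+1 A <= PB.
  rewrite PAE -[PB]mul1r -p1 mulr_suml; apply: ler_sum => v _; exact: ler_wpM2l.
have PB0 : 0 < PB by exact: lt_le_trans PAB.
have [FB [FB1 FB2]] := IH B PB0.
have /choice[FA hFA] : forall v, exists F : seq V -> R, 0 < a v ->
    Exl n (fun l => expR (F l / 8)) <= (a v)^-1 /\
    forall l, size l = n -> exists2 c, convex_in (Av v) n c &
      \sum_(i < n) mismatch v0 c l i ^+ 2 <= F l.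
  move=> v; have [h|h] := ltP 0 (a v); last by exists (fun=> 0).
  by have [F hF] := IH (Av v) h; exists F.
pose r v := a v / PB.
have r1 v : r v <= 1 by rewrite ler_pdivrMr // mul1r.
(* The weight 1 + 4 ln r is nonnegative exactly from this threshold on; below it only the projection
   is used. *)
pose big v := expR (- (1 / 4)) <= r v.
pose lam v := if big v then 1 + 4 * ln (r v) else 0.
have bigP v : big v -> [/\ 0 < a v, 0 <= lam v, lam v <= 1 & 0 <= - ln (r v) <= 1 / 4].
  move=> bv; have rv : 0 < r v by apply: lt_le_trans bv; exact: expR_gt0.
  have l1 : ln (r v) <= 0 by rewrite -ln1 ler_ln ?posrE.
  have l2 : - (1 / 4) <= ln (r v) by rewrite -(expRK (- (1 / 4))) ler_ln ?posrE ?expR_gt0.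
  rewrite /lam bv; split; [|lra|lra|lra].
  by move: rv; rewrite /r pmulr_lgt0 // invr_gt0.
pose F l := if l is v :: l' then
  if big v then lam v * FA v l' + (1 - lam v) * FB l' + (1 - lam v) ^+ 2 else FB l' + 1 else 0.
exists F; split.
  rewrite /= PAE; apply: (@le_trans _ _ (\sum_v p v * ((2 - r v) / PB))).
    apply: ler_sum => v _; apply: ler_wpM2l => //; rewrite ler_pdivlMr //.
    have [bv|bv] := boolP (big v); last first.
      have -> : Exl n (fun l => expR ((FB l + 1) / 8)) = expR (1 / 8) * Exl n (fun l => expR (FB l / 8)).
        by rewrite -ExlZ; apply: Exl_eq => l _; rewrite mulrDl expRD mulrC.
      rewrite mulrAC -mulrA; apply: (@le_trans _ _ (expR (1 / 8))).
        by rewrite ler_piMr ?expR_ge0 // mulrC -ler_pdivlMr // mul1r.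
      apply: (le_trans expR_eighth); rewrite lerD2l lerN2 ltW //.
      by move: bv; rewrite /big -ltNge.
    have [av la0 la1 /andP[rr0 rr1]] := bigP v bv; have [F1 _] := hFA v av.
    set rho := - ln (r v) in rr0 rr1.
    have lamE : lam v = 1 - 4 * rho by rewrite /lam bv /rho mulrN opprK.
    have rv0 : 0 < r v by rewrite divr_gt0.
    have rE : expR (- rho) = r v by rewrite /rho opprK lnK // posrE.
    (* Convexity of the exponential plays the part of Hoelder's inequality: it leaves a convex
       combination of two exponentials whose expectations are bounded by induction. *)
    have key l : expR ((lam v * FA v l + (1 - lam v) * FB l + (1 - lam v) ^+ 2) / 8) <=
      expR (rho - 2 * rho ^+ 2) / PB *
      (lam v * (a v * expR (FA v l / 8)) + (1 - lam v) * (PB * expR (FB l / 8))).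
      have lnr : ln (a v) = ln PB - rho.
        by rewrite /rho opprK /r ln_div ?posrE // addrC subrK.
      have -> : (lam v * FA v l + (1 - lam v) * FB l + (1 - lam v) ^+ 2) / 8 =
        (rho - 2 * rho ^+ 2 - ln PB) + (lam v * (ln (a v) + FA v l / 8) +
          (1 - lam v) * (ln PB + FB l / 8)).
        by rewrite lnr lamE; field.
      rewrite expRD expRB lnK ?posrE // ler_pM2l ?divr_gt0 ?expR_gt0 //.
      by apply: (le_trans (expR_convex _ _ la0 la1)); rewrite !expRD !lnK ?posrE.
    apply: (@le_trans _ _ (expR (rho - 2 * rho ^+ 2) / PB * PB)); last first.
      by rewrite divfK ?gt_eqF // -rE expR_parabola.
    rewrite ler_pM2r //; apply: (le_trans (Exl_le (fun l _ => key l))).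
    rewrite ExlZ ler_piMr ?divr_ge0 ?expR_ge0 ?(ltW PB0) // ExlD !ExlZ.
    apply: (@le_trans _ _ (lam v * 1 + (1 - lam v) * 1)); last by rewrite !mulr1 addrC subrK.
    rewrite lerD //; apply: ler_wpM2l; rewrite ?subr_ge0 // mulrC -ler_pdivlMr // mul1r //.
  have -> : \sum_v p v * ((2 - r v) / PB) = (2 - Prl n.+1 A / PB) / PB.
    rewrite PAE mulr_suml -[2 in RHS]mulr1 -p1 mulr_sumr -sumrB mulr_suml.
    by apply: eq_bigr => v _; rewrite /r; field; rewrite gt_eqF.
  (* What remains is u (2 - u) <= 1. *)
  rewrite -[leRHS]mul1r ler_pdivlMr // mulrAC -mulrA; set u := _ / PB.
  by have := sqr_ge0 (1 - u); rewrite sqrrB expr1n mul1r; lra.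
pose pickB l v := if [pick w | A (w :: l)] is Some w then w else v.
have pickP l v : B l -> A (pickB l v :: l).
  by rewrite /pickB => /existsP[w Aw]; case: pickP => // /(_ w); rewrite Aw.
have liftB v a' c' : 0 <= a' -> convex_in B n c' ->
  forall x, x \in lift_comb a' (fun l => pickB l v) c' -> [/\ 0 <= x.1, size x.2 = n.+1 & A x.2].
  move=> a0 [_ h] x /mapP[y /h[y0 ys By] ->] /=; split.
  - exact: mulr_ge0.
  - by rewrite ys.
  - exact: pickP.
case=> // v l [sl]; have [c' cB hc'] := FB2 l sl; rewrite /F.
have cB1 : \sum_(x <- c') x.1 * (v != pickB x.2 v)%:R <= 1.
  case: (cB) => h1 h; apply: (@le_trans _ _ (\sum_(x <- c') x.1)); last by rewrite h1.
  rewrite big_seq [leRHS]big_seq; apply: ler_sum => x /h[x0 _ _].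
  by apply: ler_piMr => //; rewrite lern1 leq_b1.
have cB0 : 0 <= \sum_(x <- c') x.1 * (v != pickB x.2 v)%:R.
  by case: (cB) => h1 h; rewrite big_seq; apply: sumr_ge0 => x /h[x0 _ _]; rewrite mulr_ge0.
have [bv|bv] := boolP (big v); last first.
  exists (lift_comb 1 (fun l => pickB l v) c').
    by split; [rewrite lift_comb_sum mul1r; case: cB | exact: liftB].
  rewrite big_ord_recl mismatch_lift0 mul1r addrC lerD //.
    by under eq_bigr do rewrite mismatch_liftS mul1r.
  by rewrite expr_le1.
have [av la0 la1 _] := bigP v bv; have [_ /(_ l sl)[c cA hc]] := hFA v av.
have la1' : 0 <= 1 - lam v by rewrite subr_ge0.
exists (lift_comb (lam v) (fun=> v) c ++ lift_comb (1 - lam v) (fun l => pickB l v) c').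
  split; first by rewrite big_cat /= !lift_comb_sum cA.1 cB.1; ring.
  move=> x; rewrite mem_cat => /orP[/mapP[y /cA.2[y0 ys Ay] ->]|]; last exact: liftB.
  by split; rewrite /= ?ys // mulr_ge0.
rewrite big_ord_recl mismatch_cat !mismatch_lift0.
rewrite big1_seq ?mulr0 ?add0r; last by move=> x _; rewrite eqxx mulr0.
rewrite addrC lerD //; last first.
  rewrite exprMn ler_piMr ?sqr_ge0 // expr_le1 //.
apply: (@le_trans _ _ (lam v * \sum_(i < n) mismatch v0 c l i ^+ 2 +
                       (1 - lam v) * \sum_(i < n) mismatch v0 c' l i ^+ 2)); last first.
  by rewrite lerD // ler_wpM2l.
rewrite !mulr_sumr -big_split /=; apply: ler_sum => i _.
rewrite mismatch_cat !mismatch_liftS; set x := mismatch _ _ _ _; set y := mismatch _ _ _ _.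
have -> : lam v * x ^+ 2 + (1 - lam v) * y ^+ 2 =
  (lam v * x + (1 - lam v) * y) ^+ 2 + lam v * (1 - lam v) * (x - y) ^+ 2 by ring.
by rewrite lerDl mulr_ge0 ?sqr_ge0 // mulr_ge0.
Qed.

Section Concentration.
Variables (v0 : V) (n : nat) (T : seq V -> R) (Gd : pred (seq V)) (K M s : R).
Hypotheses (K0 : 0 <= K) (M0 : 0 < M) (s0 : 0 < s).
Hypothesis certif : forall l, size l = n -> Gd l -> exists S : {set 'I_n},
  #|S|%:R <= M ^+ 2 /\ forall y, size y = n ->
  T y <= T l + 1 + K * \sum_(i in S) (nth v0 l i != nth v0 y i)%:R.

(** A configuration in the second event has a certificate [S]. Averaged over a convex combination of
    points with a <= T, it shows by Cauchy-Schwarz on [S] that the convex distance to these points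
    is at least [s]; Markov's inequality for the exponential of F / 8 concludes. *)
Lemma lower_deviation (a : R) :
  Prl n (fun l => a <= T l) * Prl n (fun l => Gd l && (T l < a - 1 - K * M * s))
    <= expR (- (s ^+ 2 / 8)).
Proof.
set A := (fun l => a <= T l); set Bd := (fun l => _ && _).
have [PA|PA] := ltP 0 (Prl n A); last first.
  by apply: (@le_trans _ _ 0); rewrite ?expR_ge0 // mulr_le0_ge0 // Prl_ge0.
have [F [F1 F2]] := talagrand v0 PA.
have hF l : size l = n -> Bd l -> s ^+ 2 <= F l.
  move=> sl /andP[Gl Tl]; rewrite leNgt; apply/negP => Fs.
  have [c [c1 cA] hc] := F2 l sl; have [S [SM hS]] := certif sl Gl.
  have avg : a <= T l + 1 + K * \sum_(i in S) mismatch v0 c l i.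
    have -> : a = \sum_(x <- c) x.1 * a by rewrite -mulr_suml c1 mul1r.
    apply: (@le_trans _ _ (\sum_(x <- c) x.1 * (T l + 1 + K * \sum_(i in S) (nth v0 l i != nth v0 x.2 i)%:R))).
      rewrite big_seq [leRHS]big_seq; apply: ler_sum => x /cA[x0 xs Ax].
      by rewrite ler_wpM2l // (le_trans Ax) // hS.
    under eq_bigr do rewrite mulrDr.
    rewrite big_split /= -mulr_suml c1 mul1r lerD2l.
    under eq_bigr do rewrite mulrCA.
    rewrite -mulr_sumr ler_wpM2l // /mismatch exchange_big /= le_eqVlt; apply/orP; left.
    by apply/eqP; apply: eq_bigr => x _; rewrite mulr_sumr.
  have sq : \sum_(i in S) mismatch v0 c l i ^+ 2 <= s ^+ 2.
    apply: le_trans (ltW Fs); apply: le_trans hc; rewrite [leRHS](bigID (mem S)) /= lerDl.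
    by apply: sumr_ge0 => i _; exact: sqr_ge0.
  (* AM-GM: 2 nu <= (M / s) nu^2 + s / M *)
  have am i : mismatch v0 c l i <= (M / s * mismatch v0 c l i ^+ 2 + s / M) / 2.
    set nu := mismatch _ _ _ _; have := sqr_ge0 (M * nu - s) => h.
    have -> : (M / s * nu ^+ 2 + s / M) / 2 = nu + (M * nu - s) ^+ 2 / (2 * (M * s)).
      by field; rewrite !gt_eqF.
    by rewrite lerDl divr_ge0 // mulr_ge0 // mulr_ge0 // ltW.
  have tot : \sum_(i in S) mismatch v0 c l i <= M * s.
    apply: (@le_trans _ _ (\sum_(i in S) ((M / s * mismatch v0 c l i ^+ 2 + s / M) / 2))).
      by apply: ler_sum => i _.
    rewrite -mulr_suml big_split /= -mulr_sumr sumr_const -[_ *+ #|S|]mulr_natr.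
    have h1 : M / s * \sum_(i in S) mismatch v0 c l i ^+ 2 <= M / s * s ^+ 2.
      by rewrite ler_wpM2l // divr_ge0 // ltW.
    have h2 : s / M * #|S|%:R <= s / M * M ^+ 2 by rewrite ler_wpM2l // divr_ge0 // ltW.
    have h3 : M / s * s ^+ 2 = M * s by field; rewrite gt_eqF.
    have h4 : s / M * M ^+ 2 = M * s by field; rewrite gt_eqF.
    by move: h1 h2; rewrite h3 h4; lra.
  have : K * \sum_(i in S) mismatch v0 c l i <= K * (M * s) by rewrite ler_wpM2l.
  by move: avg Tl; rewrite mulrA; lra.
have hexp l : size l = n -> Bd l -> expR (s ^+ 2 / 8) <= expR (F l / 8).
  by move=> sl Bl; rewrite ler_expR ler_pM2r // hF.
have := Exl_markov (fun l _ => expR_ge0 (F l / 8)) hexp.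
move=> /le_trans /(_ F1) h.
by rewrite -ler_pdivlMl // expRN ler_pdivlMr ?expR_gt0 // mulrC.
Qed.

(** The center is the largest integer i such that i <= T has probability at least 1/2.
    [lower_deviation] at a = i gives the lower tail. At a = i + 2 + K M s it gives the upper tail,
    since T < i + 1 has probability at least 1/2, of which bad configurations take at most 1/4. *)
Lemma concentration B : (forall l, size l = n -> 0 <= T l < B%:R) ->
  Prl n (fun l => ~~ Gd l) <= 1 / 4 ->
  exists m : R, Prl n (fun l => Gd l && (T l < m - (K * M * s + 2))) <= 2 * expR (- (s ^+ 2 / 8))
    /\ Prl n (fun l => m + (K * M * s + 2) < T l) <= 4 * expR (- (s ^+ 2 / 8)).
Proof.
move=> hB hG; pose P (i : nat) := 1 / 2 <= Prl n (fun l => i%:R <= T l).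
have P0 : exists i, P i.
  exists 0%N; apply: (@le_trans _ _ (Exl n (fun=> 1))); first by rewrite Exl_cst; lra.
  by apply: Exl_le => l /hB/andP[-> _].
have PB i : P i -> (i <= B)%N.
  move=> Pi; rewrite leqNgt; apply/negP => iB.
  have : Prl n (fun l => i%:R <= T l) <= 0.
    apply: (@le_trans _ _ (Exl n (fun=> 0))); last by rewrite Exl_cst.
    apply: Exl_le => l /hB/andP[_ h].
    have -> // : (i%:R <= T l) = false.
    by apply/negbTE; rewrite -ltNge (lt_le_trans h) // ler_nat ltnW.
  by move: Pi; rewrite /P; lra.
case: (ex_maxnP P0 PB) => i Pi imax.
exists i%:R; split.
  have h := lower_deviation i%:R.
  have {}h : 1 / 2 * Prl n (fun l => Gd l && (T l < i%:R - 1 - K * M * s)) <= expR (- (s ^+ 2 / 8)).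
    by apply: le_trans h; rewrite ler_wpM2r ?Prl_ge0.
  have : Prl n (fun l => Gd l && (T l < i%:R - (K * M * s + 2))) <=
         Prl n (fun l => Gd l && (T l < i%:R - 1 - K * M * s)).
    apply: Prl_le => l _ /andP[-> /= h']; apply: (lt_le_trans h'); lra.
  by move: h; lra.
pose a := i%:R + 2 + K * M * s.
have h := lower_deviation a.
have hi : 1 / 2 <= Prl n (fun l => T l < i.+1%:R).
  have Pn : ~~ P i.+1 by apply/negP => /imax; rewrite ltnn.
  have -> : Prl n (fun l => T l < i.+1%:R) = 1 - Prl n (fun l => i.+1%:R <= T l).
    by rewrite -PrlC; apply: Exl_eq => l _; rewrite ltNge.
  by move: Pn; rewrite /P -ltNge; lra.
have hG' : 1 / 4 <= Prl n (fun l => Gd l && (T l < a - 1 - K * M * s)).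
  have : Prl n (fun l => T l < i.+1%:R) <=
    Prl n (fun l => Gd l && (T l < a - 1 - K * M * s)) + Prl n (fun l => ~~ Gd l).
    apply: le_trans (PrlU _ _ _); apply: Prl_le => l _ h'.
    case: (Gd l) => //=; rewrite orbF /a; apply: (lt_le_trans h').
    by rewrite -natr1; lra.
  by move: hi hG; lra.
have h2 : Prl n (fun l => a <= T l) * (1 / 4) <= expR (- (s ^+ 2 / 8)).
  by apply: le_trans h; rewrite ler_wpM2l ?Prl_ge0.
have : Prl n (fun l => i%:R + (K * M * s + 2) < T l) <= Prl n (fun l => a <= T l).
  by apply: Prl_le => l _ h'; rewrite /a; apply: le_trans (ltW h'); lra.
by move: h2; lra.
Qed.

End Concentration.
End ProductSpace.

(** * Discretisation of i.i.d. weights *)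

Section Bounded.
Context (R : realType) (d : measure_display) (Omega : measurableType d) (P : probability Omega R).

(* [A] itself need not be measurable: passage events are covered by discretised ones. *)
Definition Pbd (A : set Omega) (e : R) :=
  exists B, [/\ measurable B, A `<=` B & (P B <= e%:E)%E].

Lemma Pbd_sub A B e : A `<=` B -> Pbd B e -> Pbd A e.
Proof. by move=> AB [C [mC BC PC]]; exists C; split=> //; exact: subset_trans BC. Qed.

Lemma Pbd_le A e e' : e <= e' -> Pbd A e -> Pbd A e'.
Proof. by move=> ee [C [mC BC PC]]; exists C; split=> //; rewrite (le_trans PC) // lee_fin. Qed.

Lemma Pbd_meas A e : measurable A -> (P A <= e%:E)%E -> Pbd A e.
Proof. by move=> mA PA; exists A; split. Qed.

Lemma PbdU A B e e' : Pbd A e -> Pbd B e' -> Pbd (A `|` B) (e + e').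
Proof.
move=> [C [mC BC PC]] [C' [mC' BC' PC']]; exists (C `|` C'); split.
- exact: measurableU.
- exact: setUSS.
- by rewrite EFinD; apply: (le_trans (measureU2 P mC mC')); exact: leeD.
Qed.

Lemma Pbd_set0 e : 0 <= e -> Pbd set0 e.
Proof. by move=> e0; exists set0; split; rewrite ?measure0 ?lee_fin. Qed.

Lemma Pbd_list (I : eqType) (l : seq I) (A : I -> set Omega) e :
  (forall i, i \in l -> Pbd (A i) e) ->
  Pbd [set w | exists2 i, i \in l & A i w] ((size l)%:R * e).
Proof.
elim: l => [|i l IH] h.
  by apply: (@Pbd_sub _ set0); [move=> w [] | rewrite mul0r; exact: Pbd_set0].
apply: (@Pbd_sub _ (A i `|` [set w | exists2 j, j \in l & A j w])).
  move=> w [j]; rewrite inE => /orP[/eqP ->|jl] Aj; [by left|by right; exists j].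
rewrite /= -[in X in Pbd _ X]add1n natrD mulrDl mul1r; apply: PbdU.
  by apply: h; exact: mem_head.
by apply: IH => j jl; apply: h; rewrite inE jl orbT.
Qed.

Lemma Pbd_ex A e : Pbd A e -> e < 1 -> exists w, ~ A w.
Proof.
move=> [C [mC AC PC]] e1; apply: contrapT => h.
have CT : C = setT.
  by apply/seteqP; split=> // w _; apply: AC; apply: contrapT => hA; apply: h; exists w.
move: PC; rewrite CT probability_setT lee_fin => h'.
by move: e1; rewrite ltNge h'.
Qed.

Lemma probability_partition (V : finType) (f : Omega -> V) X : measurable X ->
  (forall v, measurable [set w | f w = v]) ->
  P X = (\sum_v P (X `&` [set w | f w = v]))%E.
Proof.
move=> mX mf.
suff H (l : seq V) : uniq l -> measurable [set w | f w \in l] /\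
    P (X `&` [set w | f w \in l]) = (\sum_(v <- l) P (X `&` [set w | f w = v]))%E.
  have [_] := H _ (index_enum_uniq V); move=> <-; congr (P _).
  by apply/seteqP; split=> [w Xw|w []//]; split=> //=; rewrite mem_index_enum.
elim: l => [|v l IH] /=.
  split; first by rewrite [X in measurable X](_ : _ = set0) //; apply/seteqP; split.
  by rewrite big_nil [X in P X](_ : _ = set0) ?measure0 //; apply/seteqP; split=> // w [].
case/andP=> vl /IH [ml Pl].
have E : [set w | f w \in v :: l] = [set w | f w = v] `|` [set w | f w \in l].
  apply/seteqP; split=> w /=; rewrite inE.
    by case/orP => [/eqP ->|]; [left|right].
  by case=> [->|->]; rewrite ?eqxx ?orbT.
split; first by rewrite E; exact: measurableU.
rewrite big_cons -Pl E setIUr measureU //.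
- exact: measurableI.
- exact: measurableI.
- by apply/seteqP; split=> // w [[_ /= h1] [_ /=]]; rewrite h1 (negbTE vl).
Qed.

End Bounded.

Section Cell.
Variables (R : realType) (q m : nat).

(** Weights of m / q and above share the last cell, so that a finite alphabet suffices. *)
Definition cellv (x : R) : nat := minn m (Num.truncn (q%:R * x)).
Definition cell (x : R) : 'I_m.+1 := inord (cellv x).

Lemma cellE x : cell x = cellv x :> nat.
Proof. by rewrite inordK // ltnS geq_minl. Qed.

Lemma cellv_ge x i : (i <= cellv x)%N = (i == 0)%N || ((i <= m)%N && (i%:R <= q%:R * x)).
Proof. by rewrite /cellv leq_min; case: i => [|i] //=; rewrite truncn_gt_nat. Qed.

Lemma cell_measurable v : measurable (cell @^-1` [set v]).
Proof.
have mge (i : nat) : measurable [set x | (i <= cellv x)%N].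
  have [->|i0] := eqVneq i 0%N.
    by rewrite [X in measurable X](_ : _ = setT) //; apply/seteqP; split.
  have [im|im] := leqP i m; last first.
    rewrite [X in measurable X](_ : _ = set0) //; apply/seteqP; split=> // x /=.
    by rewrite cellv_ge (negbTE i0) leqNgt im.
  rewrite [X in measurable X](_ : _ = (fun x => q%:R * x) @^-1` `[i%:R, +oo[%classic).
    rewrite -[X in measurable X]setTI.
    by apply: (@mulrl_measurable R setT q%:R) => //; exact: measurable_itv.
  by apply/seteqP; split=> x /=; rewrite cellv_ge (negbTE i0) im /= in_itv /= andbT.
rewrite [X in measurable X](_ : _ = [set x | (v <= cellv x)%N] `\` [set x | (v.+1 <= cellv x)%N]).
  exact: measurableD.
apply/seteqP; split=> x /=.
  by move=> <-; rewrite cellE leqnn ltnn.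
case=> h1 /negP; rewrite -leqNgt => h2; apply/val_inj => /=.
by rewrite cellE; apply/eqP; rewrite eqn_leq h1 h2.
Qed.

End Cell.

Section Transfer.
Context (R : realType) (d : measure_display) (Omega : measurableType d) (P : probability Omega R).
Variables (tau : E -> {RV P >-> R}) (q m : nat).
Hypothesis iid : iid_edges tau.

Notation V := 'I_m.+1.
Let cl (e : E) (w : Omega) : V := cell q m (tau e w).

Definition pmf (v : V) : R := fine (P (tau ((0, 0), true) @^-1` (cell q m @^-1` [set v]))).

Lemma cl_measurable e v : measurable [set w | cl e w = v].
Proof.
exact: (measurable_funPTI (tau e) (@cell_measurable R q m v)).
Qed.

Lemma cl_pmf e v : P [set w | cl e w = v] = (pmf v)%:E.
Proof.
have -> : [set w | cl e w = v] = tau e @^-1` (cell q m @^-1` [set v]) by [].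
rewrite (iid.2 e ((0, 0), true) _ (@cell_measurable R q m v)) /pmf fineK //.
by apply: fin_num_measure; exact: cl_measurable.
Qed.

Lemma pmf_ge0 v : 0 <= pmf v.
Proof. by rewrite /pmf fine_ge0. Qed.

Lemma pmf_sum1 : \sum_v pmf v = 1.
Proof.
apply: EFin_inj; rewrite -sumEFin.
have := @probability_partition _ _ _ P V (cl ((0, 0), true)) setT measurableT (cl_measurable _).
rewrite probability_setT => ->; apply: eq_bigr => v _.
by rewrite setTI cl_pmf.
Qed.

(** The edges of [s0] already have their values [b]. Each step fixes one more edge of [s] and sums
    over its value, until only a cylinder remains, to which independence applies. *)
Lemma transfer_aux s (A : pred (seq V)) s0 (b : E -> V) : uniq (s0 ++ s) ->
  measurable [set w | A (map (fun e => cl e w) s)] /\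
  P ([set w | forall e, e \in s0 -> cl e w = b e] `&` [set w | A (map (fun e => cl e w) s)])
    = ((\prod_(e <- s0) pmf (b e)) * Prl pmf (size s) A)%:E.
Proof.
elim: s s0 b A => [|e s IH] s0 b A.
  rewrite cats0 => us0; rewrite /Prl /=; case: (A [::]).
    split; first by rewrite [X in measurable X](_ : _ = setT) //; apply/seteqP; split.
    have -> : [set w | forall e, e \in s0 -> cl e w = b e] `&` [set _ | true] =
      \bigcap_(e in [set` s0]) (tau e @^-1` (cell q m @^-1` [set b e])).
      by apply/seteqP; split=> w /= => [[h _] e /= /h|h] //; split=> // e /h.
    rewrite (iid.1 s0 _ us0); last by move=> e; exact: (@cell_measurable R q m).
    rewrite mulr1 -prodEFin; apply: eq_bigr => e _; exact: cl_pmf.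
  split; first by rewrite [X in measurable X](_ : _ = set0) //; apply/seteqP; split.
  by rewrite mulr0 [X in P X](_ : _ = set0) ?measure0 //; apply/seteqP; split=> // w [].
move=> us; have es0 : e \notin s0.
  by move: us; rewrite cat_uniq => /and3P[_ /hasPn/(_ e (mem_head _ _))].
have us' : uniq ((e :: s0) ++ s).
  by rewrite -cat_rcons in us; rewrite -(perm_uniq (_ : perm_eq (rcons s0 e ++ s) _)) // perm_cat2r perm_rcons.
pose b' v e' := if e' == e then v else b e'.
pose Av v l := A (v :: l).
have mAv v := (IH (e :: s0) (b' v) (Av v) us').1.
have E1 : [set w | A (map (fun e => cl e w) (e :: s))] =
  \bigcup_(v in [set: V]) ([set w | cl e w = v] `&` [set w | Av v (map (fun e => cl e w) s)]).
  apply/seteqP; split=> w /=; first by move=> h; exists (cl e w).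
  by case=> v _ [<-].
have mA : measurable [set w | A (map (fun e => cl e w) (e :: s))].
  rewrite E1; apply: fin_bigcup_measurable => // v _; apply: measurableI => //.
  exact: cl_measurable.
split; first exact: mA.
have ms0 : measurable [set w | forall e, e \in s0 -> cl e w = b e].
  rewrite [X in measurable X](_ : _ = \bigcap_(e in [set` s0]) [set w | cl e w = b e]) //.
  by apply: fin_bigcap_measurable => // e' _; exact: cl_measurable.
rewrite (@probability_partition _ _ _ P V (cl e)); last 2 first.
- exact: measurableI.
- exact: cl_measurable.
rewrite /Prl /= mulr_sumr -sumEFin; apply: eq_bigr => v _.
have bE : b' v e = v by rewrite /b' eqxx.
have := (IH (e :: s0) (b' v) (Av v) us').2; rewrite big_cons bE.
have -> : \prod_(j <- s0) pmf (b' v j) = \prod_(j <- s0) pmf (b j).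
  rewrite big_seq [RHS]big_seq; apply: eq_bigr => j js0; rewrite /b'.
  by case: eqP => // je; move: es0; rewrite -je js0.
rewrite mulrCA mulrA => <-; congr (P _); apply/seteqP; split=> w /=.
  case=> [[h1 h2] h3]; split; last by rewrite /Av -h3.
  move=> j; rewrite inE /b'; case: eqP => [-> //|_] /=; exact: h1.
case=> h1 h2; have h3 : cl e w = v by rewrite h1 ?mem_head // /b' eqxx.
split=> //; split; last by rewrite h3.
move=> j js0; rewrite h1 ?inE ?js0 ?orbT // /b'.
by case: eqP => // je; move: es0; rewrite -je js0.
Qed.

Lemma transfer s (A : pred (seq V)) : uniq s ->
  measurable [set w | A (map (fun e => cl e w) s)] /\
  P [set w | A (map (fun e => cl e w) s)] = (Prl pmf (size s) A)%:E.
Proof.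
move=> us; have [h1 h2] := @transfer_aux s A [::] (fun=> ord0) us; split=> //.
rewrite big_nil mul1r in h2; rewrite -h2; congr (P _).
by apply/seteqP; split=> w //= [].
Qed.

End Transfer.

Section DiscreteEvents.
Context (R : realType) (d : measure_display) (Omega : measurableType d) (P : probability Omega R).
Variables (tau : E -> {RV P >-> R}).
Hypothesis iid : iid_edges tau.

Definition shift_rv (z : Z2) : E -> {RV P >-> R} := fun e => tau (shiftE z e).

Lemma iid_shift z : iid_edges (shift_rv z).
Proof.
split=> [s B us mB|e e' B mB]; last exact: (iid.2 (shiftE z e) (shiftE z e') B mB).
pose B' e := B (e.1 - z, e.2).
have B'E e : B' (shiftE z e) = B e by rewrite /B' /shiftE /= addrK; case: e.
have us' : uniq (map (shiftE z) s) by rewrite map_inj_uniq //; exact: shiftE_inj.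
have := iid.1 _ B' us' (fun e => mB _); rewrite big_map.
have -> : \bigcap_(e in [set` map (shiftE z) s]) tau e @^-1` B' e =
          \bigcap_(e in [set` s]) shift_rv z e @^-1` B e.
  apply/seteqP; split=> w /= h e he.
    by have := h (shiftE z e); rewrite /= B'E; apply; exact: map_f.
  by case/mapP: he => e' he' ->; rewrite /preimage /= B'E; exact: h.
by move=> ->; apply: eq_bigr => e _; rewrite B'E.
Qed.

Variables (q m : nat).
Notation V := 'I_m.+1.
Variable va : V -> R.

Definition disc (t : E -> {RV P >-> R}) (w : Omega) (e : E) : R := va (cell q m (t e w)).

Lemma pmf_shift z (v : V) : pmf (shift_rv z) q v = pmf tau q v.
Proof.
by rewrite /pmf /shift_rv (iid.2 _ ((0, 0), true) _ (@cell_measurable R q m v)).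
Qed.

Definition depends_on (s : seq E) (phi : (E -> R) -> Prop) :=
  forall t t' : E -> R, (forall e, e \in s -> t e = t' e) -> phi t -> phi t'.

(** Edges outside [s] receive the default cell [ord0]; events with [depends_on s] do not see
    them. *)
Definition conf (s : seq E) (l : seq V) (e : E) : R := va (nth ord0 l (index e s)).

Definition on_conf s (phi : (E -> R) -> Prop) : pred (seq V) := fun l => `[< phi (conf s l) >].

Lemma conf_disc (s : seq E) (t : E -> {RV P >-> R}) w e : e \in s ->
  conf s (map (fun e => cell q m (t e w)) s) e = disc t w e.
Proof. by move=> es; rewrite /conf (nth_map e) ?index_mem // nth_index. Qed.

Lemma on_confE (s : seq E) phi (t : E -> {RV P >-> R}) w : depends_on s phi ->
  on_conf s phi (map (fun e => cell q m (t e w)) s) <-> phi (disc t w).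
Proof.
move=> dp; rewrite /on_conf; split.
  by move=> /asboolP; apply: dp => e es; exact: conf_disc.
by move=> h; apply/asboolP; apply: dp h => e es; rewrite conf_disc.
Qed.

Lemma disc_eventE s phi (t : E -> {RV P >-> R}) : depends_on s phi ->
  [set w | phi (disc t w)] = [set w | on_conf s phi (map (fun e => cell q m (t e w)) s)].
Proof. by move=> dp; apply/seteqP; split=> w /=; rewrite on_confE. Qed.

Lemma disc_event (s : seq E) phi : uniq s -> depends_on s phi ->
  measurable [set w | phi (disc tau w)] /\
  P [set w | phi (disc tau w)] = (Prl (@pmf R d Omega P tau q m) (size s) (on_conf s phi))%:E.
Proof. by move=> us dp; rewrite (disc_eventE _ dp); exact: transfer. Qed.

Lemma disc_event_shift z (s : seq E) phi : uniq s -> depends_on s phi ->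
  measurable [set w | phi (disc (shift_rv z) w)] /\
  P [set w | phi (disc (shift_rv z) w)] = P [set w | phi (disc tau w)].
Proof.
move=> us dp; rewrite (disc_event us dp).2 (disc_eventE _ dp).
have [h1 h2] := @transfer _ _ _ _ (shift_rv z) q m (iid_shift z) s (on_conf s phi) us; split=> //.
by rewrite h2; congr (Prl _ _ _)%:E; apply/funext => v; exact: pmf_shift.
Qed.

Lemma disc_event_indep (s s' : seq E) phi psi : uniq (s ++ s') -> depends_on s phi -> depends_on s' psi ->
  P [set w | phi (disc tau w) /\ psi (disc tau w)] =
  (P [set w | phi (disc tau w)] * P [set w | psi (disc tau w)])%E.
Proof.
move=> us dp dp'; have us1 : uniq s by move: us; rewrite cat_uniq => /and3P[].
have us2 : uniq s' by move: us; rewrite cat_uniq => /and3P[].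
rewrite (disc_event us1 dp).2 (disc_event us2 dp').2 -EFinM -Prl_prod.
have := (@transfer _ _ _ _ tau q m iid _ (fun l => on_conf s phi (take (size s) l) && on_conf s' psi (drop (size s) l)) us).2.
rewrite size_cat => <-; congr (P _); apply/seteqP; split=> w /=.
  case=> h1 h2; rewrite map_cat take_cat drop_cat size_map ltnn subnn take0 drop0 cats0.
  by apply/andP; split; [exact/(on_confE tau w dp)|exact/(on_confE tau w dp')].
rewrite map_cat take_cat drop_cat size_map ltnn subnn take0 drop0 cats0.
by move=> /andP[/(on_confE tau w dp) h1 /(on_confE tau w dp') h2].
exact: pmf_ge0.
Qed.

End DiscreteEvents.

(** * Exponential moments of the weights *)

Section Moments.
Context (R : realType) (d : measure_display) (Omega : measurableType d) (P : probability Omega R).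
Variables (tau : E -> {RV P >-> R}).
Hypothesis iid : iid_edges tau.
Hypothesis tau0 : forall e w, 0 <= tau e w.
Variable alpha : R.
Hypothesis a0 : 0 < alpha.
Hypothesis expint : forall e, (\int[P]_w (expR (alpha * tau e w))%:E < +oo)%E.

Let e0 : E := ((0, 0), true).
Definition expmoment : R := fine (\int[P]_w (expR (alpha * tau e0 w))%:E).

Let mexp : measurable_fun [set: Omega] (fun w => (expR (alpha * tau e0 w))%:E).
Proof.
apply/measurable_EFinP; apply: (measurableT_comp (@measurable_expR R)).
exact: (measurableT_comp (@mulrl_measurable R setT alpha)).
Qed.

Let expE : (\int[P]_w (expR (alpha * tau e0 w))%:E)%E = expmoment%:E.
Proof.
rewrite fineK // ge0_fin_numE; first exact: expint.
by apply: integral_ge0 => w _; rewrite lee_fin expR_ge0.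
Qed.

Lemma expmoment_ge0 : 0 <= expmoment.
Proof. by apply: fine_ge0; apply: integral_ge0 => w _; rewrite lee_fin expR_ge0. Qed.

Lemma tail_bound e (x : R) : (P [set w | (x <= tau e w)%R] <= (expmoment * expR (- (alpha * x)))%:E)%E.
Proof.
have -> : [set w | x <= tau e w] = tau e @^-1` `[x, +oo[%classic.
  by apply/seteqP; split=> w /=; rewrite in_itv /= andbT.
rewrite (iid.2 e e0 _ (measurable_itv _)).
have -> : tau e0 @^-1` `[x, +oo[%classic = [set w | (x <= tau e0 w)%R].
  by apply/seteqP; split=> w /=; rewrite in_itv /= andbT.
apply: (le_trans (chernoff (tau e0) x a0)).
rewrite EFinM lee_pmul2r ?lte_fin ?expR_gt0 //.
rewrite /mmt_gen_fun unlock -expE le_eqVlt; apply/orP; left; apply/eqP.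
by apply: eq_integral => w _ /=; rewrite mulrC.
Qed.

Lemma tau_measurable_ge e (x : R) : measurable [set w | x <= tau e w].
Proof.
have -> : [set w | x <= tau e w] = tau e @^-1` `[x, +oo[%classic.
  by apply/seteqP; split=> w /=; rewrite in_itv /= andbT.
exact: (measurable_funPTI (tau e) (measurable_itv _)).
Qed.

(** The value v / q of a cell never exceeds the weight, so the moment bound is uniform in the
    discretisation. *)
Lemma pmf_expmoment q m : (0 < q)%N ->
  \sum_(v : 'I_m.+1) pmf tau q v * expR (alpha * (v%:R / q%:R)) <= expmoment.
Proof.
move=> q0; rewrite -lee_fin -expE -sumEFin.
pose c (v : 'I_m.+1) := expR (alpha * (v%:R / q%:R)).
pose A (v : 'I_m.+1) := [set w | cell q m (tau e0 w) = v].
have mA v : measurable (A v) by exact: cl_measurable.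
have PA v : P (A v) = (pmf tau q v)%:E by exact: cl_pmf.
have -> : (\sum_(v < m.+1) (pmf tau q v * c v)%:E)%E =
    (\int[P]_w (\sum_(v < m.+1) ((c v)%:E * (\1_(A v) w)%:E)))%E.
  rewrite ge0_integral_sum //; last 2 first.
  - move=> v; apply/measurable_EFinP.
    by apply: measurableT_comp; [exact: mulrl_measurable | exact: measurable_indic].
  - by move=> v w _; rewrite -EFinM lee_fin mulr_ge0 ?expR_ge0 // indicE.
  apply: eq_bigr => v _; rewrite ge0_integralZl_EFin ?expR_ge0 //; last first.
  - by apply/measurable_EFinP; exact: measurable_indic.
  rewrite mulrC EFinM; congr (_ * _)%E; rewrite integral_indic // setIT.
  by rewrite -PA.
apply: ge0_le_integral => //.
- by move=> w _; apply: sume_ge0 => v _; rewrite -EFinM lee_fin mulr_ge0 ?expR_ge0 // indicE.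
- apply: emeasurable_sum => v; apply/measurable_EFinP.
  by apply: measurableT_comp; [exact: mulrl_measurable | exact: measurable_indic].
move=> w _; rewrite (bigD1 (cell q m (tau e0 w))) //= big1 ?adde0; last first.
  move=> v vne; rewrite indicE memNset ?mule0 //.
  by move=> h; move: vne; rewrite -h eqxx.
rewrite indicE mem_set // mule1 lee_fin ler_expR ler_pM2l //.
rewrite ler_pdivrMr ?ltr0n // mulrC cellE /cellv.
have h : 0 <= q%:R * tau e0 w by rewrite mulr_ge0.
have /andP[h1 _] := truncn_itv h; apply: le_trans h1; rewrite ler_nat.
exact: geq_minr.
Qed.

End Moments.

(** * Renormalisation of cheap crossings *)

Definition boxE (v : Z2) (N : nat) : seq E := [seq (x, b) | x <- boxl v N, b <- [:: true; false]].

Lemma mem_boxE v N (e : E) : (e \in boxE v N) = (nrm (e.1 - v) <= N)%N.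
Proof.
case: e => x b; rewrite -mem_boxl; apply/allpairsP/idP => /=.
  by case=> -[y c] /= [hy _ [-> _]].
by move=> hx; exists (x, b); split=> //=; case: b.
Qed.

Lemma boxE_uniq v N : uniq (boxE v N).
Proof. by apply: allpairs_uniq => //; [exact: boxl_uniq | move=> [x b] [y c]]. Qed.

Lemma size_boxE v N : size (boxE v N) = (2 * N.*2.+1 ^ 2)%N.
Proof. by rewrite size_allpairs size_boxl mulnC. Qed.

Section Cross.
Variable R : realType.
Implicit Type t : E -> R.

(** A cheap crossing from the box of radius L to the sphere of radius 2L. Confinement to the larger
    box makes it an event of finitely many edges. *)
Definition Cross t (v : Z2) (L : nat) : Prop := exists (u : Z2) (p : seq Z2),
  [/\ (nrm (u - v) <= L)%N, path adj u p, nrm (last u p - v) = (2 * L)%N,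
      forall x : Z2, x \in u :: p -> (nrm (x - v) <= 2 * L)%N & ptime t u p < 1].

Lemma ptime_eq_on t t' (s : seq E) (u : Z2) p : (forall e, e \in s -> t e = t' e) ->
  (forall e : E, e \in edges u p -> e \in s) -> ptime t u p = ptime t' u p.
Proof.
move=> h hs; apply/eqP; rewrite eq_le; apply/andP; split; apply: ptime_le => e /hs/h ->; exact: lexx.
Qed.

Lemma edges_in_box (u : Z2) p v N : (forall x : Z2, x \in u :: p -> (nrm (x - v) <= N)%N) ->
  forall e : E, e \in edges u p -> e \in boxE v N.
Proof. by move=> h e /edges_base/h; rewrite mem_boxE. Qed.

Lemma Cross_depends v L : depends_on (boxE v (2 * L)) (fun t => Cross t v L).
Proof.
move=> t t' tt [u [p [h1 h2 h3 h4 h5]]]; exists u, p; split=> //.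
by rewrite -(ptime_eq_on tt) //; exact: edges_in_box.
Qed.

Lemma Cross_shift t v L : Cross t v L <-> Cross (fun e => t (shiftE v e)) 0 L.
Proof.
split=> -[u [p [h1 h2 h3 h4 h5]]].
  exists (u - v), (map (fun x => x - v) p); split.
  - by rewrite subr0.
  - by rewrite -(path_shift v) -map_comp subrK map_id_in // => x _ /=; exact: subrK.
  - by rewrite subr0 (last_map (fun x : Z2 => x - v)).
  - by move=> x; rewrite subr0 -(map_cons (fun x : Z2 => x - v)) => /mapP[y /h4 hy ->].
  - by rewrite -ptime_shift -map_comp subrK map_id_in // => x _ /=; exact: subrK.
exists (u + v), (map (fun x => x + v) p); split.
- by move: h1; rewrite subr0 addrK.
- by rewrite path_shift.
- by rewrite (last_map (fun x : Z2 => x + v)) addrK; move: h3; rewrite subr0.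
- move=> x; rewrite -(map_cons (fun x : Z2 => x + v)) => /mapP[y /h4 hy ->].
  by rewrite addrK; move: hy; rewrite subr0.
- by rewrite ptime_shift.
Qed.

Lemma Cross_path t v L (u : Z2) p : (forall e, 0 <= t e) -> (nrm (u - v) <= L)%N -> path adj u p ->
  (2 * L <= nrm (last u p - v))%N -> ptime t u p < 1 -> Cross t v L.
Proof.
move=> t0 hu up hl pt; have [|p1 [p2 [pE e h]]] := @path_nrm_hits v (2 * L) u p up.
  by rewrite hl andbT (leq_trans hu) // leq_pmull.
exists u, p1; split=> //; first by move: up; rewrite pE cat_path => /andP[].
by apply: le_lt_trans pt; rewrite pE ptime_cat lerDl ptime_ge0.
Qed.

Definition scaleZ (L : nat) (z : Z2) : Z2 := (L%:Z * z.1, L%:Z * z.2).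

Lemma nrm_scaleZ L z : nrm (scaleZ L z) = (L * nrm z)%N.
Proof. by rewrite /nrm /scaleZ /= !abszM maxnMr. Qed.

Lemma grid_point L (y : Z2) : (0 < L)%N -> exists z, (nrm (y - scaleZ L z) <= L)%N.
Proof.
move=> L0; exists ((y.1 %/ L%:Z)%Z, (y.2 %/ L%:Z)%Z); rewrite /nrm /scaleZ /=.
have L0' : L%:Z != 0 by rewrite eqz_nat -lt0n.
have e1 := divz_eq y.1 L%:Z; have e2 := divz_eq y.2 L%:Z.
have m1 := modz_ge0 y.1 L0'; have m2 := modz_ge0 y.2 L0'.
have LZ : 0 < L%:Z by rewrite ltz_nat.
have l1 := ltz_pmod y.1 LZ; have l2 := ltz_pmod y.2 LZ.
rewrite {1}e1 {1}e2 ![L%:Z * _]mulrC addrAC subrr add0r addrAC subrr add0r geq_max.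
by move: m1 m2 l1 l2; move: (y.1 %% L)%Z (y.2 %% L)%Z; clear; lia.
Qed.

(* A crossing at scale 16 L passes near the spheres of radius 20 L and 28 L, hence
   contains crossings at scale L of two disjoint boxes. *)
Lemma Cross_renorm t v L : (forall e, 0 <= t e) -> (0 < L)%N -> Cross t v (16 * L) ->
  exists z1 z2 : Z2, [/\ (nrm z1 <= 32)%N, (nrm z2 <= 32)%N, (L * nrm z1 + 6 * L <= L * nrm z2)%N,
    Cross t (v + scaleZ L z1) L & Cross t (v + scaleZ L z2) L].
Proof.
move=> t0 L0 [u [p [h1 h2 h3 h4 h5]]].
have key m : (16 * L <= m <= 29 * L)%N -> exists z : Z2,
    (m <= L * nrm z + L)%N /\ (L * nrm z <= m + L)%N /\ Cross t (v + scaleZ L z) L.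
  move=> hm; have [|p1 [p2 [pE e h]]] := @path_nrm_hits v m u p h2.
    by rewrite h3; move: h1 hm; clear; lia.
  set y := last u p1 in e; have [z hz] := grid_point (y - v) L0.
  have y2 : path adj y p2 by move: h2; rewrite pE cat_path => /andP[].
  exists z; have hz1 := nrm_scaleZ L z.
  have t1 : (nrm (scaleZ L z) <= nrm (y - v) + nrm (y - v - scaleZ L z))%N.
    have := nrm_tri (scaleZ L z) (y - v) 0; rewrite !subr0 nrmB.
    by rewrite addnC.
  have t2 : (nrm (y - v) <= nrm (y - v - scaleZ L z) + nrm (scaleZ L z))%N.
    by have := nrm_tri (y - v) (scaleZ L z) 0; rewrite !subr0.
  split; first by move: t2 hz; rewrite e hz1; clear; lia.
  split; first by move: t1 hz; rewrite e hz1; clear; lia.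
  apply: (@Cross_path t _ L y p2) => //.
  - by rewrite opprD addrA.
  - have t3 : (nrm (last y p2 - v) <= nrm (last y p2 - (v + scaleZ L z)) + nrm (scaleZ L z))%N.
      have -> : last y p2 - v = (last y p2 - (v + scaleZ L z)) + scaleZ L z.
        by rewrite opprD addrA subrK.
      exact: nrmD.
    have lE : last y p2 = last u p by rewrite pE last_cat.
    by move: t3 t1 hz hm; rewrite lE h3 e hz1; clear; lia.
  - apply: le_lt_trans h5; rewrite pE ptime_cat -/y lerDr ptime_ge0 //.
have [|z1 [a1 [b1 c1]]] := key (20 * L)%N; first by clear; lia.
have [|z2 [a2 [b2 c2]]] := key (28 * L)%N; first by clear; lia.
exists z1, z2; split=> //.
- by rewrite -(leq_pmul2l L0); move: b1; clear; lia.
- by rewrite -(leq_pmul2l L0); move: b2; clear; lia.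
- by move: b1 a2; clear; lia.
Qed.

End Cross.

Section Renorm.
Context (R : realType) (d : measure_display) (Omega : measurableType d) (P : probability Omega R).
Variables (tau : E -> {RV P >-> R}).
Hypothesis iid : iid_edges tau.
Variables (q m : nat).
Variable va : 'I_m.+1 -> R.
Hypothesis va0 : forall v, 0 <= va v.

Let dsc := disc q va tau.

Let Cmeas v L : measurable [set w | Cross (dsc w) v L].
Proof. exact: (disc_event iid q va (boxE_uniq v (2 * L)) (@Cross_depends R v L)).1. Qed.

Lemma Cross_stat v L : P [set w | Cross (dsc w) v L] = P [set w | Cross (dsc w) 0 L].
Proof.
rewrite -(disc_event_shift iid q va v (boxE_uniq 0 (2 * L)) (@Cross_depends R 0 L)).2.
congr (P _); apply/seteqP; split=> w /= h.
  exact: (Cross_shift (dsc w) v L).1.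
exact: (Cross_shift (dsc w) v L).2.
Qed.

(* Locked so that its thousands of points are never computed. *)
Definition grid : seq Z2 := locked (boxl 0 32).
Let c : R := (size grid)%:R.

Lemma grid_size_ge1 : 1 <= c.
Proof. by rewrite /c /grid -lock ler1n size_boxl. Qed.

(** Union bound over pairs of grid points. The two centers are at least 6L apart, so the boxes of
    radius 2L share no edge and the crossings are independent. *)
Lemma Cross_square L (x : R) : (0 < L)%N -> (P [set w | Cross (dsc w) 0%R L] <= x%:E)%E ->
  (P [set w | Cross (dsc w) 0%R (16 * L)] <= (c ^+ 2 * x ^+ 2)%:E)%E.
Proof.
move=> L0 hx.
have x0 : 0 <= x by rewrite -lee_fin (le_trans _ hx).
pose pairs := [seq (z1, z2) | z1 <- grid, z2 <- grid].
pose A (z : Z2 * Z2) := [set w | [/\ (L * nrm z.1 + 6 * L <= L * nrm z.2)%N,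
  Cross (dsc w) (scaleZ L z.1) L & Cross (dsc w) (scaleZ L z.2) L]].
have hA z : z \in pairs -> Pbd P (A z) (x ^+ 2).
  move=> _; have [hz|hz] := boolP (L * nrm z.1 + 6 * L <= L * nrm z.2)%N; last first.
    apply: (@Pbd_sub _ _ _ _ _ set0); last by apply: Pbd_set0; exact: sqr_ge0.
    by move=> w [] h; rewrite h in hz.
  apply: (@Pbd_sub _ _ _ _ _ [set w | Cross (dsc w) (scaleZ L z.1) L /\ Cross (dsc w) (scaleZ L z.2) L]).
    by move=> w [].
  apply: Pbd_meas; first by apply: measurableI; exact: Cmeas.
  rewrite (disc_event_indep iid q va _ (@Cross_depends R (scaleZ L z.1) L)
    (@Cross_depends R (scaleZ L z.2) L)).
    by rewrite !Cross_stat expr2 EFinM; apply: lee_pmul.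
  rewrite cat_uniq !boxE_uniq andTb andbT; apply/hasPn => e.
  rewrite !mem_boxE => he2; apply/negP => he1.
  have t1 := nrm_tri (scaleZ L z.2) e.1 0; rewrite !subr0 nrmB in t1.
  have t2 := nrm_tri e.1 (scaleZ L z.1) 0; rewrite !subr0 in t2.
  have t3 := leq_trans t2 (leq_add he1 (leqnn _)); have t4 := leq_trans t1 (leq_add he2 t3).
  by move: t4 hz L0; rewrite !nrm_scaleZ; clear; lia.
have [B [mB BA PB]] : Pbd P [set w | Cross (dsc w) 0 (16 * L)] ((size pairs)%:R * x ^+ 2).
  apply: Pbd_sub (Pbd_list hA) => w /= /(Cross_renorm (fun e => va0 _) L0)[z1 [z2 [h1 h2 h3]]].
  rewrite !add0r => h4 h5; exists (z1, z2) => //.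
  by apply/allpairsP; exists (z1, z2); rewrite /= /grid -lock !mem_boxl !subr0.
apply: (@le_trans _ _ (P B)); first by apply: le_measure; rewrite ?inE.
by move: PB; rewrite size_allpairs natrM -expr2.
Qed.

(** The product of [c ^+ 2] with the probability is at most squared when the scale is multiplied by
    16, and it starts at 1/2 or below. *)
Lemma Cross_decay L j : (0 < L)%N -> (P [set w | Cross (dsc w) 0%R L] <= (1 / 2 / c ^+ 2)%:E)%E ->
  (P [set w | Cross (dsc w) 0%R (16 ^ j * L)] <= ((1 / 2) ^+ (2 ^ j))%:E)%E.
Proof.
move=> L0 h0; have c1 := grid_size_ge1.
have c20 : 0 < c ^+ 2 by rewrite exprn_gt0 // (lt_le_trans ltr01).
have H : (P [set w | Cross (dsc w) 0%R (16 ^ j * L)] <= ((1 / 2) ^+ (2 ^ j) / c ^+ 2)%:E)%E.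
  elim: j => [|j IH]; first by rewrite mul1n expr1.
  have Lj : (0 < 16 ^ j * L)%N by rewrite muln_gt0 expn_gt0.
  have := Cross_square Lj IH; rewrite mulnA -expnS.
  have -> // : c ^+ 2 * ((1 / 2) ^+ (2 ^ j) / c ^+ 2) ^+ 2 = (1 / 2) ^+ (2 ^ j.+1) / c ^+ 2.
  by rewrite expnS mulnC exprM; field; rewrite gt_eqF // (lt_le_trans ltr01).
apply: (le_trans H); rewrite lee_fin ler_pdivrMr // ler_peMr ?exprn_ge0 //.
by rewrite exprn_ege1.
Qed.

End Renorm.

(** * Convergence in probability and the initial scale *)

Section InProbability.
Context (R : realType) (d : measure_display) (Omega : measurableType d) (P : probability Omega R).
Variables (tau : E -> {RV P >-> R}).
Hypothesis tau0 : forall e w, 0 <= tau e w.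

Let tw (w : Omega) (e : E) : R := tau e w.

Lemma ptime_measurable x p : measurable_fun [set: Omega] (fun w => ptime (tw w) x p).
Proof.
elim: p x => [|y p IH] x.
  rewrite (_ : (fun w => _) = cst 0); first exact: measurable_cst.
  by apply/funext => w; rewrite ptime_nil.
rewrite (_ : (fun w => _) = (fun w => tau (edge_of x y) w) \+ (fun w => ptime (tw w) y p)).
  by apply: measurable_funD => //; exact: measurable_funPT.
by apply/funext => w; rewrite ptime_cons.
Qed.

Lemma ptime_lt_measurable x p a : measurable [set w | ptime (tw w) x p < a].
Proof.
rewrite (_ : [set w | _] = [set: Omega] `&` (fun w => ptime (tw w) x p) @^-1` `]-oo, a[%classic).
  by apply: ptime_measurable => //; exact: measurable_itv.
by apply/seteqP; split=> w /=; rewrite in_itv /=; [split|case].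
Qed.

Lemma passage_lt_measurable x y a : measurable [set w | passage (tw w) x y < a].
Proof.
pose F (n : nat) : set Omega := if @unpickle (seq (int * int)) n is Some p then
  if `[< is_path x y p >] then [set w | ptime (tw w) x p < a] else set0 else set0.
rewrite (_ : [set w | _] = \bigcup_n F n).
  apply: bigcup_measurable => n _; rewrite /F; case: unpickle => // p.
  by case: asboolP => // _; exact: ptime_lt_measurable.
apply/seteqP; split=> w /=.
  move=> /passage_lt[p hp pa]; exists (pickle (p : seq (int * int))) => //.
  by rewrite /F pickleK; case: asboolP.
case=> n _; rewrite /F; case: unpickle => // p; case: asboolP => // hp /=.
move=> h; apply: le_lt_trans h; apply: passage_le => // e; exact: tau0.
Qed.

Lemma passage_gt_measurable x y a : measurable [set w | a < passage (tw w) x y].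
Proof.
rewrite (_ : [set w | _] = ~` (\bigcap_n [set w | passage (tw w) x y < a + n.+1%:R^-1])).
  by apply: measurableC; apply: bigcap_measurable => // n _; exact: passage_lt_measurable.
apply/seteqP; split=> w /=.
  move=> h hn; have [n hn'] : exists n : nat, n.+1%:R^-1 < passage (tw w) x y - a.
    have /ltr_add_invr[n hn'] := h.
    by exists n; rewrite ltrBrDl.
  by have := hn n I; rewrite /= ltNge ltW // addrC -ltrBrDr.
move=> h; rewrite ltNge; apply/negP => hle; apply: h => n _ /=.
by rewrite (le_lt_trans hle) // ltrDl invr_gt0.
Qed.

(** The tail unions [B n] decrease to an event on which convergence fails, so their probabilities
    tend to 0. *)
Lemma cvg_probability (f : nat -> Omega -> R) (l : R) :
  (forall n a, measurable [set w | f n w < a]) -> (forall n a, measurable [set w | a < f n w]) ->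
  {ae P, forall w, (fun n => f n w) @ \oo --> l} ->
  forall dl e : R, 0 < dl -> 0 < e -> exists n0, forall n, (n0 <= n)%N ->
    Pbd P [set w | dl < `|f n w - l|] e.
Proof.
move=> m1 m2 ae dl e dl0 e0.
pose A n := [set w | f n w < l - dl] `|` [set w | l + dl < f n w].
have mA n : measurable (A n) by apply: measurableU.
pose B n := \bigcup_(k in [set k | (n <= k)%N]) A k.
have mB n : measurable (B n) by apply: bigcup_measurable.
have cvgB : P \o B @ \oo --> P (\bigcap_n B n).
  apply: nonincreasing_cvg_mu => //.
  - by rewrite (le_lt_trans (probability_le1 _ _)) // ltry.
  - exact: bigcap_measurable.
  - apply/nonincreasing_seqP => n; apply/subsetPset => w [k /= nk Ak].
    by exists k => //=; exact: ltnW.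
have PB0 : P (\bigcap_n B n) = 0%E.
  apply: measure_negligible; first exact: bigcap_measurable.
  apply: negligibleS ae => w hw /= hc.
  have := @cvgr_dist_le _ _ _ _ _ _ _ hc dl dl0.
  case=> N _ hN; have [k /= Nk Ak] := hw N I.
  have := hN k Nk => /=; rewrite distrC ler_norml => /andP[h1 h2].
  by case: Ak => /= h3; [move: h1 h3|move: h2 h3]; lra.
have /fine_cvgP[_] : P \o B @ \oo --> (0 : R)%:E by have := cvgB; rewrite PB0.
move=> /cvgr_dist_lt /(_ e e0)[N _ hN].
exists N => n Nn; apply: (@Pbd_sub _ _ _ _ _ (A n)).
  move=> w /=; rewrite ltNge => h; have [h1|h1] := ltP (f n w) (l - dl); first by left.
  right; rewrite /= ltNge; apply/negP => h2; move/negP: h; apply.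
  by rewrite ler_norml; apply/andP; split; move: h1 h2; lra.
apply: Pbd_meas => //; apply: (@le_trans _ _ (P (B N))).
  by apply: le_measure; rewrite ?inE // => w Aw; exists n.
have := hN N (leqnn N); rewrite /= sub0r normrN => h.
have fP : P (B N) \is a fin_num by apply: fin_num_measure.
rewrite -(fineK fP) lee_fin; apply: le_trans (ltW h); exact: ler_norm.
Qed.

Variable g : R * R -> R.
Hypothesis hconv : forall z : Z2, {ae P, forall w,
  (fun n : nat => passage (fun e => tau e w) origin ((n%:Z * z.1)%R, (n%:Z * z.2)%R) / n%:R)
    @ \oo --> g (z.1%:~R, z.2%:~R)}.

Lemma passage_probability (z : Z2) (dl e : R) : 0 < dl -> 0 < e ->
  exists n0, forall n, (n0 <= n)%N ->
    Pbd P [set w | dl * n%:R < `|passage (tw w) 0 (scaleZ n z) - n%:R * g (rv R z)|] e.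
Proof.
move=> dl0 e0.
have [||n0 h] := @cvg_probability
  (fun n w => passage (tw w) 0 (scaleZ n z) / n%:R) (g (rv R z)) _ _ (hconv z) dl e dl0 e0.
- case=> [|n] a.
    have [a0|a0] := ltP 0 a.
      rewrite (_ : [set w | _] = setT) //; apply/seteqP; split=> // w _ /=.
      by rewrite invr0 mulr0.
    rewrite (_ : [set w | _] = set0) //; apply/seteqP; split=> // w /=.
    by rewrite invr0 mulr0 ltNge a0.
  rewrite (_ : [set w | _] = [set w | passage (tw w) 0 (scaleZ n.+1 z) < a * n.+1%:R]).
    exact: passage_lt_measurable.
  by apply/seteqP; split=> w /=; rewrite ltr_pdivrMr ?ltr0n.
- case=> [|n] a.
    have [a0|a0] := ltP a 0.
      rewrite (_ : [set w | _] = setT) //; apply/seteqP; split=> // w _ /=.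
      by rewrite invr0 mulr0.
    rewrite (_ : [set w | _] = set0) //; apply/seteqP; split=> // w /=.
    by rewrite invr0 mulr0 ltNge a0.
  rewrite (_ : [set w | _] = [set w | a * n.+1%:R < passage (tw w) 0 (scaleZ n.+1 z)]).
    exact: passage_gt_measurable.
  by apply/seteqP; split=> w /=; rewrite ltr_pdivlMr ?ltr0n.
exists (maxn n0 1) => n; rewrite geq_max => /andP[hn n0'].
apply: Pbd_sub (h n hn) => w /=; have nR : 0 < n%:R :> R by rewrite ltr0n.
rewrite -ltr_pdivlMr // => /lt_le_trans; apply.
rewrite -[X in _ / X]ger0_norm // -normf_div mulrBl [_ * g _]mulrC mulfK // gt_eqF //.
Qed.

End InProbability.

Lemma list_eventually (I : eqType) (l : seq I) (Q : I -> nat -> Prop) :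
  (forall i, i \in l -> exists n0, forall n, (n0 <= n)%N -> Q i n) ->
  exists n0, forall n, (n0 <= n)%N -> forall i, i \in l -> Q i n.
Proof.
elim: l => [|i l IH] h; first by exists 0%N.
have [n1 h1] := h i (mem_head _ _).
have [|n2 h2] := IH; first by move=> j jl; apply: h; rewrite inE jl orbT.
exists (maxn n1 n2) => n; rewrite geq_max => /andP[k1 k2] j.
by rewrite inE => /orP[/eqP ->|jl]; [exact: h1|exact: h2].
Qed.

Lemma half_pow_small (R : realType) (c e : R) : 0 <= c -> 0 < e ->
  exists n0, forall n, (n0 <= n)%N -> c * (1 / 2) ^+ n <= e.
Proof.
move=> c0 e0; exists (Num.truncn (c / e)).+1 => n hn.
have ce0 : 0 <= c / e by rewrite divr_ge0 // ltW.
have /andP[_ h] := truncn_itv ce0.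
have h1 : c / e <= n%:R by rewrite (le_trans (ltW h)) // ler_nat.
have h2 : n%:R <= 2 ^+ n :> R by rewrite -natrX ler_nat ltnW // ltn_expl.
rewrite expr_div_n expr1n mul1r ler_pdivrMr ?exprn_gt0 // mulrC -ler_pdivrMr //.
exact: le_trans h2.
Qed.

Lemma expR_small (R : realType) (c a e : R) : 0 <= c -> 0 < a -> 0 < e ->
  exists n0 : nat, forall x, n0%:R <= x -> c * expR (- (a * x)) <= e.
Proof.
move=> c0 a0 e0; exists (Num.truncn (c / e / a)).+1 => x hx.
have ce0 : 0 <= c / e / a by rewrite !divr_ge0 // ltW.
have /andP[_ h] := truncn_itv ce0.
have h1 : c / e <= a * x.
  by rewrite [a * x]mulrC -ler_pdivrMr // (le_trans (ltW h)).
rewrite expRN ler_pdivrMr ?expR_gt0 // mulrC -ler_pdivrMr //; apply: (le_trans h1).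
by have := expR_ge1Dx (a * x); lra.
Qed.

Definition move_by (x : Z2) (b : bool) (j : nat) : Z2 :=
  if b then (x.1 + j%:Z, x.2) else (x.1, x.2 + j%:Z).

Definition seg (x : Z2) (b : bool) (k : nat) : seq E := [seq (move_by x b j, b) | j <- iota 0 k].

Lemma seg_uniq x b k : uniq (seg x b k).
Proof.
rewrite map_inj_uniq ?iota_uniq // => i j; case: x => x1 x2; rewrite /move_by.
by case: b => -[] /addrI; case.
Qed.

Lemma nrm_move x b j : nrm (move_by x b j - x) = j.
Proof. by case: x => x1 x2; rewrite /move_by /nrm; case: b => /=; lia. Qed.

(** The bound is the sum over the whole segment of length [k], whichever part of it is used, so that
    one event controls all [j]. *)
Lemma seg_path (R : realType) x b j k : (j <= k)%N ->
  exists p : seq Z2, [/\ is_path x (move_by x b j) p,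
    forall v : Z2, v \in x :: p -> (nrm (v - x) <= j)%N &
    forall t : E -> R, (forall e, 0 <= t e) -> ptime t x p <= \sum_(e <- seg x b k) t e].
Proof.
move=> jk; suff [p [h1 h2 h3]] : exists p : seq Z2, [/\ is_path x (move_by x b j) p,
    forall v : Z2, v \in x :: p -> (nrm (v - x) <= j)%N &
    forall t : E -> R, ptime t x p = \sum_(e <- seg x b j) t e].
  exists p; split=> // t t0; rewrite h3 -(subnKC jk) /seg iotaD map_cat big_cat /= lerDl.
  exact: sumr_ge0.
elim: j {jk} => [|j [p [[h1 h2] h3 h4]]].
  exists [::]; split.
  - by split=> //; case: x => x1 x2; rewrite /move_by /=; case: b; congr (_, _); lia.
  - by move=> v; rewrite inE => /eqP ->; rewrite subrr.
  - by move=> t; rewrite ptime_nil /seg /= big_nil.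
exists (rcons p (move_by x b j.+1)); split.
- split; last by rewrite last_rcons.
  by rewrite rcons_path h1 h2 adjE /move_by; case: (b) => /=; lia.
- move=> v; rewrite -rcons_cons mem_rcons inE => /orP[/eqP ->|/h3]; first by rewrite nrm_move.
  by move=> h; exact: leqW.
- move=> t; rewrite -cats1 ptime_cat h2 h4 /seg -[j.+1]addn1 iotaD map_cat big_cat /= big_seq1.
  rewrite ptime_cons ptime_nil addr0; congr (_ + t _).
  case: x {h1 h2 h3 h4} => x1 x2; rewrite /edge_of /move_by add0n addn1; case: b => /=.
    have -> : x1 + j%:Z + 1 = x1 + j.+1%:Z by lia.
    by rewrite eqxx.
  case: eqP => [[]|_]; first lia.
  case: eqP => [[]|_]; first lia.
  have -> : x2 + j%:Z + 1 = x2 + j.+1%:Z by lia.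
  by rewrite eqxx.
Qed.

(** On this sphere one coordinate is N k up to sign, hence on the grid; rounding the other one
    leaves a single axis-parallel segment. *)
Lemma sphere_grid k N (y : Z2) : (0 < k)%N -> nrm y = (N * k)%N ->
  exists a b j, [/\ y = move_by (scaleZ k a) b j, (j <= k)%N & (nrm a <= N)%N].
Proof.
move=> k0; have kZ : k%:Z != 0 by rewrite eqz_nat -lt0n.
have dv (z : int) : (`|z| <= N * k)%N -> exists (c : int) (j : nat),
    [/\ z = k%:Z * c + j%:Z, (j <= k)%N & (`|c| <= N)%N].
  move=> hz; exists (z %/ k%:Z)%Z, `|(z %% k%:Z)%Z|%N.
  have e1 := divz_eq z k%:Z; have m1 := modz_ge0 z kZ.
  have kp : 0 < k%:Z by rewrite ltz_nat.
  have l1 := ltz_pmod z kp.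
  split; first by rewrite {1}e1 mulrC; move: m1; move: (_ %% _)%Z (_ * _); clear; lia.
    by move: m1 l1; move: (_ %% _)%Z; clear; lia.
  have h1 : (z %/ k%:Z)%Z <= N%:Z.
    by rewrite -ltzD1 ltz_divLR //; move: hz k0; clear; nia.
  have h2 : - N%:Z <= (z %/ k%:Z)%Z.
    by rewrite lez_divRL //; move: hz; clear; nia.
  by move: h1 h2; move: (_ %/ _)%Z; clear; lia.
case: y => y1 y2 hy.
have [h1 h2] : (`|y1| <= N * k)%N /\ (`|y2| <= N * k)%N.
  by move: hy; rewrite /nrm /=; move: (N * k)%N; clear; lia.
have : (`|y1| = N * k)%N \/ (`|y2| = N * k)%N.
  by move: hy; rewrite /nrm /=; move: (N * k)%N; clear; lia.
case=> he.
  have [c [j [e1 e2 e3]]] := dv _ h2.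
  pose s := if 0 <= y1 then N%:Z else - N%:Z.
  exists (s, c), false, j; split=> //; rewrite /move_by /scaleZ /=.
    by rewrite -e1; congr (_, _); rewrite /s; move: he; clear; case: ifP; nia.
  by rewrite /nrm /= geq_max e3 andbT /s; clear; case: ifP; lia.
have [c [j [e1 e2 e3]]] := dv _ h1.
pose s := if 0 <= y2 then N%:Z else - N%:Z.
exists (c, s), true, j; split=> //; rewrite /move_by /scaleZ /=.
  by rewrite -e1; congr (_, _); rewrite /s; move: he; clear; case: ifP; nia.
by rewrite /nrm /= geq_max e3 /= /s; clear; case: ifP; lia.
Qed.

Lemma ptime_le_add (R : realType) (t t' : E -> R) (x : Z2) p c :
  (forall e : E, e \in edges x p -> t e <= t' e + c) ->
  ptime t x p <= ptime t' x p + (size p)%:R * c.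
Proof.
elim: p x => [|y p IH] x h; first by rewrite !ptime_nil mul0r addr0.
rewrite !ptime_cons /= -natr1 mulrDl mul1r.
have h1 := h (edge_of x y) (mem_head _ _).
have h2 : ptime t y p <= ptime t' y p + (size p)%:R * c.
  by apply: IH => e he; apply: h; rewrite /edges /= inE he orbT.
by move: h1 h2; lra.
Qed.

Section SegSum.
Context (R : realType) (d : measure_display) (Omega : measurableType d) (P : probability Omega R).
Variables (tau : E -> {RV P >-> R}).
Hypothesis iid : iid_edges tau.
Hypothesis tau0 : forall e w, 0 <= tau e w.
Variable alpha : R.
Hypothesis a0 : 0 < alpha.
Hypothesis expint : forall e, (\int[P]_w (expR (alpha * tau e w))%:E < +oo)%E.

(** Solves exp(alpha C) = 2 (M + 1) with M the exponential moment, so that Markov's inequality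
    leaves a factor 1/2 per edge. *)
Definition chernoff_rate : R := ln (2 * (expmoment tau alpha + 1)) / alpha.

Lemma chernoff_rate_ge0 : 0 <= chernoff_rate.
Proof.
have M0 := expmoment_ge0 tau alpha.
by rewrite divr_ge0 ?ln_ge0 ?(ltW a0) //; move: M0; lra.
Qed.

Lemma chernoff_sum (q m : nat) (s : seq E) : (0 < q)%N -> uniq s ->
  Pbd P [set w | chernoff_rate * (size s)%:R <=
    \sum_(e <- s) disc q (fun v : 'I_m.+1 => v%:R / q%:R) tau w e] ((1 / 2) ^+ (size s)).
Proof.
move=> q0 us; pose va (v : 'I_m.+1) : R := v%:R / q%:R.
have M0 := expmoment_ge0 tau alpha; set M := expmoment tau alpha in M0.
set C := chernoff_rate; set k := size s.
pose A (l : seq 'I_m.+1) := C * k%:R <= \sum_(v <- l) va v.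
have [mA PA] := transfer q iid A us.
have AE : [set w | A [seq cell q m (tau e w) | e <- s]] =
    [set w | C * k%:R <= \sum_(e <- s) disc q va tau w e].
  by apply/seteqP; split=> w /=; rewrite /A big_map.
rewrite -AE; apply: Pbd_meas => //; rewrite PA lee_fin.
have p0 : forall v : 'I_m.+1, 0 <= pmf tau q v by exact: pmf_ge0.
have p1 := pmf_sum1 q m iid.
have F0 l : size l = k -> 0 <= \prod_(v <- l) expR (alpha * va v).
  by move=> _; apply: prodr_ge0 => v _; exact: expR_ge0.
have FA l : size l = k -> A l -> expR (alpha * (C * k%:R)) <= \prod_(v <- l) expR (alpha * va v).
  move=> _ Al; have -> : \prod_(v <- l) expR (alpha * va v) = expR (\sum_(v <- l) alpha * va v).
    by elim: l {Al} => [|v l IH]; rewrite ?big_nil ?expR0 // !big_cons IH expRD.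
  by rewrite ler_expR -mulr_sumr ler_pM2l.
have := Exl_markov p0 F0 FA; rewrite (Exl_prod p0) => h.
have hM : (\sum_v pmf tau q v * expR (alpha * va v)) ^+ k <= (M + 1) ^+ k.
  rewrite lerXn2r ?nnegrE //; last first.
  - by apply: (le_trans (pmf_expmoment iid tau0 a0 expint m q0)); rewrite lerDl.
  - by rewrite addr_ge0.
  - by apply: sumr_ge0 => v _; rewrite mulr_ge0 ?expR_ge0.
have {}h := le_trans h hM.
have E1 : expR (alpha * (C * k%:R)) = (2 * (M + 1)) ^+ k.
  rewrite mulrA expRM_natr; congr (_ ^+ k).
  have -> : alpha * C = ln (2 * (M + 1)) by rewrite /C /chernoff_rate mulrC divfK // gt_eqF.
  by rewrite lnK // posrE mulr_gt0 //; move: M0; lra.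
have Mk : 0 < (M + 1) ^+ k by rewrite exprn_gt0 //; move: M0; lra.
rewrite expr_div_n expr1n ler_pdivlMr ?exprn_gt0 // -(ler_pM2r Mk) mul1r.
by move: h; rewrite E1 exprMn mulrC mulrA.
Qed.

End SegSum.

Section Base.
Context (R : realType) (d : measure_display) (Omega : measurableType d) (P : probability Omega R).
Variables (tau : E -> {RV P >-> R}).
Hypothesis iid : iid_edges tau.
Hypothesis tau0 : forall e w, 0 <= tau e w.
Variable alpha : R.
Hypothesis a0 : 0 < alpha.
Hypothesis expint : forall e, (\int[P]_w (expR (alpha * tau e w))%:E < +oo)%E.

Let tw (w : Omega) (e : E) : R := tau e w.

Definition floor_val (q m : nat) (v : 'I_m.+1) : R := v%:R / q%:R.

Lemma floor_val_ge0 q m v : 0 <= @floor_val q m v.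
Proof. by rewrite divr_ge0. Qed.

Lemma disc_floor_le q m w e : (0 < q)%N -> disc q (@floor_val q m) tau w e <= tau e w.
Proof.
move=> q0; rewrite /disc /floor_val cellE /cellv ler_pdivrMr ?ltr0n // [leRHS]mulrC.
have h : 0 <= q%:R * tau e w by rewrite mulr_ge0.
by have /andP[h1 _] := truncn_itv h; apply: le_trans h1; rewrite ler_nat geq_minr.
Qed.

Lemma disc_floor_ge q m w e : (0 < q)%N -> tau e w < m%:R / q%:R ->
  tau e w <= disc q (@floor_val q m) tau w e + q%:R^-1.
Proof.
move=> q0 hm; have q0R : 0 < q%:R :> R by rewrite ltr0n.
have h : 0 <= q%:R * tau e w by rewrite mulr_ge0.
have hm' : q%:R * tau e w < m%:R by rewrite mulrC -ltr_pdivlMr.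
have /andP[h1 h2] := truncn_itv h.
have tm : (Num.truncn (q%:R * tau e w) <= m)%N by rewrite -(ler_nat R) (le_trans h1 (ltW hm')).
rewrite /disc /floor_val cellE /cellv (minn_idPr tm).
rewrite -[X in _ + X]mul1r -mulrDl ler_pdivlMr // [leLHS]mulrC natr1; exact: ltW.
Qed.

Lemma Pbd_P A e : measurable A -> Pbd P A e -> (P A <= e%:E)%E.
Proof.
move=> mA [B [mB AB PB]]; apply: (@le_trans _ _ (P B)); last exact: PB.
by apply: le_measure; rewrite ?inE.
Qed.

Lemma tail_box v N (x : R) :
  Pbd P [set w | exists2 e, e \in boxE v N & x <= tau e w]
    ((size (boxE v N))%:R * (expmoment tau alpha * expR (- (alpha * x)))).
Proof.
apply: (@Pbd_list _ _ _ _ _ _ (fun e => [set w | x <= tau e w])) => e _.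
by apply: Pbd_meas; [exact: tau_measurable_ge | exact: (tail_bound iid a0 expint)].
Qed.

Variables (g : R * R -> R) (c1 : R).
Hypotheses (c10 : 0 < c1) (g_lower : forall z, c1 * mx z <= g z).
Hypothesis hconv : forall z : Z2, {ae P, forall w,
  (fun n : nat => passage (fun e => tau e w) origin ((n%:Z * z.1)%R, (n%:Z * z.2)%R) / n%:R)
    @ \oo --> g (z.1%:~R, z.2%:~R)}.

Let box_path (t : E -> R) (b : Z2) (N : nat) (s : R) : Prop :=
  exists p, [/\ is_path 0 b p, forall v : Z2, v \in 0 :: p -> (nrm v <= N)%N & ptime t 0 p < s].

Let box_path_depends b N s : depends_on (boxE 0 N) (fun t => box_path t b N s).
Proof.
move=> t t' tt [p [h1 h2 h3]]; exists p; split=> //.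
rewrite -(ptime_eq_on tt) //; apply: edges_in_box => x xp; rewrite subr0; exact: h2.
Qed.

(** A cheap crossing at scale L = N k is prolonged by two axis-parallel segments to the grid of step
    k. These cost at most C k each, so two grid points at distance about N k are joined in time 2 C
    k + 1, whereas convergence to [g] demands a time of order c1 N k. As N is fixed, finitely many
    directions occur, and k can be large for all of them. *)
Lemma base_estimate e : 0 < e -> exists L q m : nat, [/\ (0 < L)%N, (0 < q)%N &
  (P [set w | Cross (disc q (@floor_val q m) tau w) 0%R L] <= e%:E)%E].
Proof.
move=> e0; pose C := chernoff_rate tau alpha; have C0 : 0 <= C := chernoff_rate_ge0 tau a0.
(* Half of the norm between the grid points, at least c1 (N - 2) k / 2, is then at least (2 C + 1)
   k; for k >= 2 this covers the cost 2 C k + 1 and a rounding error of 1. *)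
pose N := (Num.truncn (2 * (2 * C + 1) / c1)).+3.
have NC : 2 * (2 * C + 1) <= c1 * (N%:R - 2).
  have x0 : 0 <= 2 * (2 * C + 1) / c1 by rewrite divr_ge0 ?(ltW c10) // mulr_ge0 // addr_ge0 // mulr_ge0.
  have /andP[_ h] := truncn_itv x0; rewrite [leRHS]mulrC -ler_pdivrMr //; apply: (le_trans (ltW h)).
  by rewrite /N -[X in _ <= X - _]natr1 -natr1; lra.
pose D := boxl 0 (2 * N).
(* Moving the two ends to the grid shortens their distance by at most two grid steps. *)
pose pairs := [seq x <- [seq (a, a') | a <- D, a' <- D] | (N <= nrm (x.2 - x.1) + 2)%N].
pose segs := [seq (a, b) | a <- D, b <- [:: true; false]].
have e20 : 0 < e / 2 by rewrite divr_gt0.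
pose np : R := (size pairs)%:R + 1; have np0 : 0 < np by rewrite ltr_wpDl.
pose e1 := e / 2 / np / 2; have e10 : 0 < e1 by rewrite !divr_gt0.
have [k1 hk1] : exists n0, forall n, (n0 <= n)%N -> forall x, x \in pairs ->
    Pbd P [set w | g (rv R (x.2 - x.1)) / 2 * n%:R <
      `|passage (tw w) 0 (scaleZ n (x.2 - x.1)) - n%:R * g (rv R (x.2 - x.1))|] e1.
  apply: list_eventually => x; rewrite mem_filter => /andP[hx _].
  apply: passage_probability => //; rewrite divr_gt0 //.
  apply: lt_le_trans (rv_lower g_lower _); rewrite mulr_gt0 // ltr0n.
  by rewrite -(ltn_add2r 2) (leq_trans _ hx).
have [k2 hk2] := half_pow_small (ler0n R (size segs)) e20.
pose k := (maxn 2 (maxn k1 k2)).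
have k_2 : (2 <= k)%N by rewrite leq_max leqnn.
have k_1 : (k1 <= k)%N by rewrite !leq_max leqnn orbT.
have k_3 : (k2 <= k)%N by rewrite !leq_max leqnn !orbT.
have k0 : (0 < k)%N by apply: leq_trans k_2.
pose L := (N * k)%N; have L0 : (0 < L)%N by rewrite muln_gt0 k0.
(* A simple path in this box has at most [q] edges, so rounding down by at most 1 / q per edge costs
   at most 1 in total. *)
pose q := size (boxl 0 (6 * L)).
have q0 : (0 < q)%N by rewrite /q size_boxl.
have q0R : 0 < q%:R :> R by rewrite ltr0n.
have [m0 hm0] := expR_small (mulr_ge0 (ler0n R (size (boxE 0 (6 * L)))) (expmoment_ge0 tau alpha)) a0 e10.
pose m := (m0 * q)%N.
exists L, q, m; split=> //.
set fl := disc q (@floor_val q m) tau.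
have fl0 w e' : 0 <= fl w e' by exact: floor_val_ge0.
apply: Pbd_P.
  exact: (disc_event iid q _ (boxE_uniq 0 (2 * L)) (@Cross_depends R 0 L)).1.
pose s : R := 2 * C * k%:R + 1.
pose A (x : Z2 * bool) := [set w | C * k%:R <= \sum_(e <- seg (scaleZ k x.1) x.2 k) fl w e].
pose B (x : Z2 * Z2) := [set w | box_path (disc q (@floor_val q m) (shift_rv tau (scaleZ k x.1)) w)
   (scaleZ k (x.2 - x.1)) (6 * L) s].
have scB a a' : scaleZ k (a' - a) = scaleZ k a' - scaleZ k a.
  by case: a a' => [? ?] [? ?]; rewrite /scaleZ /=; congr (_, _); rewrite mulrBr.
have PA x : x \in segs -> Pbd P (A x) ((1 / 2) ^+ k).
  move=> _; have := chernoff_sum iid tau0 a0 expint m q0 (seg_uniq (scaleZ k x.1) x.2 k).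
  by rewrite size_map size_iota.
have PB x : x \in pairs -> Pbd P (B x) (e / 2 / np).
  move=> xp; set b := scaleZ k (x.2 - x.1).
  have [mB eB] := disc_event_shift iid q (@floor_val q m) (scaleZ k x.1) (boxE_uniq 0 (6 * L))
    (@box_path_depends b (6 * L)%N s).
  apply: Pbd_meas => //; rewrite /B eB; apply: Pbd_P.
    exact: (disc_event iid q _ (boxE_uniq 0 (6 * L)) (@box_path_depends b (6 * L)%N s)).1.
  have -> : e / 2 / np = e1 + e1 by rewrite /e1; lra.
  have tb : Pbd P [set w | exists2 e', e' \in boxE 0 (6 * L) & m0%:R <= tau e' w] e1.
    by apply: Pbd_le (tail_box 0 (6 * L) m0%:R); rewrite mulrA; exact: hm0.
  apply: Pbd_sub (PbdU tb (hk1 k k_1 x xp)) => w /= [p [p1 p2 p3]].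
  have [h|h] := EM (exists2 e', e' \in boxE 0 (6 * L) & m0%:R <= tau e' w); first by left.
  right; have [p' [q1 q2 q3 q4 q5]] := ptime_uniq (fl0 w) p1.1.
  have inb (v : Z2) : v \in 0 :: p' -> (nrm v <= 6 * L)%N.
    rewrite inE => /orP[/eqP ->|/q4 vp]; first by rewrite nrm0.
    by apply: p2; rewrite inE vp orbT.
  have sz : (size p' <= q)%N.
    apply: (@leq_trans (size (0 :: p'))) => //; rewrite /q.
    by apply: uniq_leq_size => // v /inb; rewrite mem_boxl subr0.
  have tp : ptime (tw w) 0 p' <= ptime (fl w) 0 p' + 1.
    apply: (@le_trans _ _ (ptime (fl w) 0 p' + (size p')%:R * q%:R^-1)).
      apply: ptime_le_add => e' /edges_base/inb he'; apply: disc_floor_ge => //.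
      rewrite /m natrM mulfK ?gt_eqF // ltNge; apply/negP => he; apply: h.
      by exists e' => //; rewrite mem_boxE subr0.
    by rewrite lerD2l ler_pdivrMr // mul1r ler_nat.
  have T1 : passage (tw w) 0 b <= ptime (tw w) 0 p'.
    apply: passage_le => [e'|]; first exact: tau0.
    by split=> //; rewrite q2; case: p1.
  have xpN : (N <= nrm (x.2 - x.1) + 2)%N by move: xp; rewrite mem_filter => /andP[].
  have gl : c1 * (N%:R - 2) <= g (rv R (x.2 - x.1)).
    apply: le_trans (rv_lower g_lower _); rewrite ler_pM2l // lerBlDr.
    by rewrite -[2]/(2%:R) -natrD ler_nat.
  have kR : 2 <= k%:R :> R by rewrite ler_nat.
  have T2 : ptime (fl w) 0 p' < s by apply: le_lt_trans p3; exact: q5.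
  set G := g _ in gl *; have G1 : 2 * (2 * C + 1) * k%:R <= G * k%:R.
    by rewrite ler_pM2r ?ltr0n //; apply: le_trans gl.
  rewrite distrC; apply: lt_le_trans (ler_norm _).
  by move: T1 T2 tp G1 kR; rewrite /s; lra.
apply: (@Pbd_le _ _ _ _ _ ((size segs)%:R * (1 / 2) ^+ k + (size pairs)%:R * (e / 2 / np))).
  have h1 := hk2 k k_3.
  have h2 : (size pairs)%:R * (e / 2 / np) <= e / 2.
    rewrite mulrCA ler_piMr ?(ltW e20) // ler_pdivrMr // mul1r /np lerDl //.
  by move: h1 h2; lra.
apply: Pbd_sub (PbdU (Pbd_list PA) (Pbd_list PB)) => w /= [u [p [p1 p2 p3 p4 p5]]].
have [h|h] := EM (exists2 x, x \in segs & A x w); first by left.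
right; have [|pa [pb [pE ey _]]] := @path_nrm_hits 0 L u p p2.
  by rewrite p1 /= p3 leq_pmull.
set y := last u pa in ey; rewrite subr0 in ey.
have [a [b1 [j1 [yE j1k aN]]]] := sphere_grid k0 ey.
have zE : nrm (last u p) = (2 * N * k)%N by rewrite -mulnA -/L -p3 subr0.
have [a' [b2 [j2 [zzE j2k a'N]]]] := sphere_grid k0 zE.
have pby : path adj y pb by move: p2; rewrite pE cat_path => /andP[].
have lpb : last y pb = last u p by rewrite pE last_cat.
have [s1 [s1p s1b s1t]] := seg_path R (scaleZ k a) b1 j1k.
have [s2 [s2p s2b s2t]] := seg_path R (scaleZ k a') b2 j2k.
rewrite -yE in s1p; rewrite -zzE -lpb in s2p.
pose s2r := rev (belast (scaleZ k a') s2).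
have s2rp : is_path (last y pb) (scaleZ k a') s2r.
  by case: (s2p) => h1 h2; rewrite -{1}h2; split; [exact: rev_path_adj|exact: last_rev_belast].
have aD : a \in D by rewrite mem_boxl subr0 (leq_trans aN) // leq_pmull.
have a'D : a' \in D by rewrite mem_boxl subr0.
have tA x : x \in segs -> \sum_(e <- seg (scaleZ k x.1) x.2 k) fl w e < C * k%:R.
  by move=> xs; rewrite ltNge; apply/negP => hA; apply: h; exists x.
have tA1 := tA (a, b1) (allpairs_f pair aD _); have tA2 := tA (a', b2) (allpairs_f pair a'D _).
have bb (b : bool) : b \in [:: true; false] by case: b.
have {}tA1 := tA1 (bb b1); have {}tA2 := tA2 (bb b2).
pose Q := s1 ++ (pb ++ s2r).
have Qp : is_path (scaleZ k a) (scaleZ k a') Q.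
  by apply: is_path_cat s1p _; apply: is_path_cat s2rp; split.
have Qt : ptime (fl w) (scaleZ k a) Q < s.
  rewrite !ptime_cat s1p.2 -s2p.2 /s2r ptime_rev; last exact: s2p.1.
  have h1 := s1t _ (fl0 w); have h2 := s2t _ (fl0 w).
  have h3 : ptime (fl w) y pb < 1.
    by apply: le_lt_trans p5; rewrite pE ptime_cat lerDr ptime_ge0.
  by move: h1 h2 h3 tA1 tA2 => /=; rewrite /s; lra.
have ka : (nrm (scaleZ k a) <= L)%N by rewrite nrm_scaleZ /L mulnC leq_mul2r aN orbT.
have ka' : (nrm (scaleZ k a') <= 2 * L)%N by rewrite nrm_scaleZ /L mulnC mulnA leq_mul2r a'N orbT.
have kL : (k <= L)%N by rewrite /L leq_pmull.
have Qb (v : Z2) : v \in scaleZ k a :: Q -> (nrm v <= 4 * L)%N.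
  rewrite -cat_cons mem_cat => /orP[/s1b hv|].
    have := nrm_tri v (scaleZ k a) 0; rewrite !subr0.
    by move: hv ka kL j1k; clear; lia.
  rewrite mem_cat => /orP[hv|].
    have := p4 v; rewrite subr0 pE -cat_cons mem_cat hv orbT => /(_ isT); clear; lia.
  rewrite /s2r mem_rev => /mem_belast/s2b hv.
  have := nrm_tri v (scaleZ k a') 0; rewrite !subr0.
  by move: hv ka' kL j2k; clear; lia.
have aa : (N <= nrm (a' - a) + 2)%N.
  rewrite -(leq_pmul2l k0) mulnDr -nrm_scaleZ scB.
  have t1 := nrm_tri (last u p) (scaleZ k a') 0; rewrite !subr0 in t1.
  have t2 := nrm_tri (scaleZ k a') (scaleZ k a) y.
  have t3 := nrm_tri (last u p) (scaleZ k a') y.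
  have t4 := nrm_tri (scaleZ k a) y 0.
  have t5 := nrm_tri (last u p) y 0; rewrite !subr0 in t5.
  have u1 : nrm (y - scaleZ k a) = j1 by rewrite yE nrm_move.
  have u2 : nrm (last u p - scaleZ k a') = j2 by rewrite zzE nrm_move.
  rewrite u2 in t3.
  rewrite (nrmB (scaleZ k a) y) u1 in t2.
  by move: t2 t3 t5 ey zE j1k j2k; rewrite /L; clear; nia.
exists (a, a').
  by rewrite mem_filter aa; apply: allpairs_f.
exists (map (fun v => v - scaleZ k a) Q); split.
- rewrite /= scB -(subrr (scaleZ k a)); split.
    by rewrite path_shift; case: Qp.
  by rewrite (last_map (fun v : Z2 => v - scaleZ k a)); case: Qp => _ ->.
- move=> v; rewrite -[0](subrr (scaleZ k a)) -(map_cons (fun v : Z2 => v - scaleZ k a)).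
  move=> /mapP[v' /Qb hv' ->]; have := nrmD v' (- scaleZ k a); rewrite nrmN.
  by move: hv' ka; clear; lia.
- rewrite -[X in _ < X]/s; have := ptime_shift (fl w) (scaleZ k a) 0 (map (fun v => v - scaleZ k a) Q).
  rewrite -map_comp map_id_in; last by move=> v _ /=; rewrite subrK.
  by rewrite add0r => <-.
Qed.

Definition slow (t : E -> R) (v : Z2) (l : nat) : Prop :=
  forall p : seq Z2, path adj v p -> (l <= nrm (last v p - v))%N -> 1 <= ptime t v p.

Lemma slow_probability : exists L : nat, (0 < L)%N /\ forall (j : nat) (v : Z2),
  Pbd P [set w | ~ slow (tw w) v (2 * (16 ^ j * L))] ((1 / 2) ^+ (2 ^ j)).
Proof.
have c0 : 0 < (size grid)%:R ^+ 2 :> R by rewrite exprn_gt0 // (lt_le_trans ltr01) // grid_size_ge1.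
have [L [q [m [L0 q0 hP]]]] := base_estimate (divr_gt0 (divr_gt0 ltr01 (ltr0Sn R 1)) c0).
exists L; split=> // j v.
apply: (@Pbd_sub _ _ _ _ _ [set w | Cross (disc q (@floor_val q m) tau w) v (16 ^ j * L)]).
  move=> w /= /existsNP[p /not_implyP[hp /not_implyP[hl /negP]]]; rewrite -ltNge => pt.
  apply: (@Cross_path _ _ _ _ v p) => //.
  - by move=> e; exact: floor_val_ge0.
  - by rewrite subrr nrm0.
  - apply: le_lt_trans pt; apply: ptime_le => e _; exact: disc_floor_le.
apply: Pbd_meas.
  exact: (disc_event iid q _ (boxE_uniq v (2 * (16 ^ j * L))) (@Cross_depends R v (16 ^ j * L))).1.
by rewrite (Cross_stat iid); apply: (Cross_decay iid) => // ?; exact: floor_val_ge0.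
Qed.

End Base.

(** * Concentration at a fixed scale *)

Section Chain.
Variable R : realType.
Implicit Type t : E -> R.

(** Greedy choice: the next center is the first vertex at distance [l] from the current one, and
    [slow] charges time 1 for reaching it. So time bounds the number of boxes of radius [l] that
    cover the path. *)
Lemma chain t l (u : Z2) p : (0 < l)%N -> path adj u p ->
  (forall v : Z2, v \in u :: p -> slow t v l) -> (forall e, 0 <= t e) ->
  exists cs : seq Z2, [/\ (size cs)%:R <= ptime t u p + 1,
    forall v : Z2, v \in u :: p -> exists2 c, c \in cs & (nrm (v - c) <= l)%N &
    forall v : Z2, v \in u :: p -> (nrm (v - u) <= size cs * l)%N].
Proof.
move=> l0; have [n] := ubnP (size p); elim: n u p => // n IH u p szp up sl t0.
have [/allP hall|/allPn[v vp hv]] := boolP (all (fun v : Z2 => nrm (v - u) < l)%N (u :: p)).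
  exists [:: u]; split.
  - by rewrite lerDr ptime_ge0.
  - by move=> v /hall hv; exists u; [rewrite mem_head|exact: ltnW].
  - by move=> v /hall hv; rewrite mul1n ltnW.
have [pa [pb [pE vE]]] := path_split vp.
have upa : path adj u pa by move: up; rewrite pE cat_path => /andP[].
have [|p1 [p2 [paE e h]]] := @path_nrm_hits u l u pa upa.
  by rewrite subrr nrm0 vE /= leqNgt.
set y := last u p1 in e.
have pE' : p = p1 ++ (p2 ++ pb) by rewrite pE paE catA.
have p10 : (0 < size p1)%N.
  by rewrite lt0n size_eq0; apply/eqP => p1n; move: e l0; rewrite /y p1n /= subrr nrm0 => <-.
have yp : path adj y (p2 ++ pb) by move: up; rewrite pE' cat_path => /andP[].
have y1 : path adj u p1 by move: up; rewrite pE' cat_path => /andP[].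
have yin v' : v' \in y :: p2 ++ pb -> v' \in u :: p.
  rewrite in_cons pE' => /orP[/eqP ->|h']; rewrite -cat_cons mem_cat ?h' ?orbT //.
  by rewrite mem_last.
have [|v' /yin /sl //|//|cs [c1 c2 c3]] := IH y (p2 ++ pb) _ yp.
  by move: szp; rewrite pE' size_cat; move: p10; clear; lia.
exists (u :: cs); split.
- rewrite /= -natr1 pE' ptime_cat.
  have : 1 <= ptime t u p1 by apply: sl; rewrite ?mem_head // e.
  by move: c1; lra.
- move=> v'; rewrite pE' -cat_cons mem_cat => /orP[/h hv'|hv'].
    by exists u; rewrite ?mem_head.
  by have [|c cc hc] := c2 v'; [rewrite inE hv' orbT|exists c; rewrite // inE cc orbT].
- move=> v'; rewrite pE' -cat_cons mem_cat => /orP[/h hv'|hv'].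
    by rewrite (leq_trans hv') //= mulSn leq_addr.
  apply: leq_trans (nrm_tri v' y u) _; rewrite e /= mulSn addnC leq_add2l.
  by apply: c3; rewrite inE hv' orbT.
Qed.

Lemma slow_shift t v u l : slow t (u + v) l -> slow (fun e => t (shiftE v e)) u l.
Proof.
move=> h p pu hl; rewrite -ptime_shift; apply: h; first by rewrite path_shift.
by rewrite (last_map (fun x : Z2 => x + v)) opprD addrACA subrr addr0.
Qed.

Variables (An K l : nat).
Hypotheses (l0 : (0 < l)%N) (K0 : (0 < K)%N).

(** A straight path with weights at most K + 1 takes 2 An (K + 1); the 2 leaves room for two units
    of slack. *)
Definition time_cap := (2 * An * K.+1 + 2)%N.
Definition box_radius := (time_cap * l)%N.
(* Rounding weights up to multiples of [1 / resol] adds at most 1 to the time of a simple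
   path of the box. *)
Definition resol := locked (size (boxl 0 box_radius.+1)).
Definition cap := (resol * K)%N.

Definition good_conf t := [/\ forall e, 0 <= t e,
  forall e, e \in boxE 0 box_radius.+1 -> t e < K%:R &
  forall u, u \in boxl 0 box_radius.+1 -> slow t u l].

Lemma length_le_box : (An <= box_radius)%N.
Proof. by rewrite /box_radius /time_cap; move: l0 K0; clear; nia. Qed.

(** Applied with [s] equal to [t] and with [s] a rounding of [t] from above. A path leaving the box
    would, up to its exit, need more centers in [chain] than its time allows. *)
Lemma confined t s (p : seq Z2) : good_conf t -> (forall e, 0 <= s e) ->
  (forall e, e \in boxE 0 box_radius.+1 -> t e <= s e) -> path adj 0 p -> ptime s 0 p < (time_cap%:R : R) ->
  (forall v : Z2, v \in 0 :: p -> (nrm v <= box_radius)%N) /\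
  (uniq (0 :: p) -> (size p <= time_cap * (l.*2.+1) ^ 2)%N).
Proof.
move=> [t0 tK tsl] s0 ts hp hs.
have sub p1 p2 : p = p1 ++ p2 -> (forall v : Z2, v \in 0 :: p1 -> (nrm v <= box_radius.+1)%N) ->
    exists cs : seq Z2, [/\ (size cs <= time_cap)%N,
    forall v : Z2, v \in 0 :: p1 -> exists2 c, c \in cs & (nrm (v - c) <= l)%N &
    forall v : Z2, v \in 0 :: p1 -> (nrm (v - 0) <= size cs * l)%N].
  move=> pE hin; have hp1 : path adj 0 p1 by move: hp; rewrite pE cat_path => /andP[].
  have [|cs [k1 k2 k3]] := chain l0 hp1 _ t0.
    by move=> v /hin hv; apply: tsl; rewrite mem_boxl subr0.
  exists cs; split=> //; rewrite -ltnS -(ltr_nat R) -natr1.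
  have : ptime t 0 p1 <= ptime s 0 p1.
    by apply: ptime_le => e /edges_base/hin he; apply: ts; rewrite mem_boxE subr0.
  have : ptime s 0 p1 <= ptime s 0 p by rewrite pE ptime_cat lerDl ptime_ge0.
  by move: k1 hs; lra.
have inN (v : Z2) : v \in 0 :: p -> (nrm v <= box_radius)%N.
  move=> vp; rewrite leqNgt; apply/negP => hv.
  have [pa [pb [pE vE]]] := path_split vp.
  have hpa : path adj 0 pa by move: hp; rewrite pE cat_path => /andP[].
  have [|p1 [p2 [paE e h]]] := @path_nrm_hits 0 box_radius.+1 0 pa hpa.
    by rewrite subrr nrm0 vE subr0.
  have [||cs [k1 _ k3]] := sub p1 (p2 ++ pb); [by rewrite pE paE catA|by move=> v' /h; rewrite subr0|].
  have := k3 _ (mem_last 0 p1); rewrite e ltnNge => /negP; apply.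
  by rewrite /box_radius leq_mul2r k1 orbT.
split=> // us.
have [||cs [k1 k2 _]] := sub p [::]; [by rewrite cats0|by move=> v /inN; exact: leqW|].
apply: (@leq_trans (size (0 :: p))) => //.
apply: (@leq_trans (size (flatten [seq boxl c l | c <- cs]))).
  apply: uniq_leq_size => // v /k2[c cc hc]; apply/flattenP.
  by exists (boxl c l); [exact: map_f|rewrite mem_boxl].
have -> : size (flatten [seq boxl c l | c <- cs]) = (size cs * l.*2.+1 ^ 2)%N.
  elim: (cs) => // c cs' IH; rewrite map_cons -[flatten (_ :: _)]/(boxl c l ++ flatten _).
  by rewrite size_cat IH size_boxl mulSn.
by rewrite leq_mul2r k1 orbT.
Qed.

(** Rounding up, in contrast to [floor_val]: a path that is cheap for the rounded weights is cheap
    for the true ones, so [slow] still confines it. *)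
Definition ceil_val (v : 'I_cap.+1) : R := (v.+1)%:R / resol%:R.

Lemma resol_gt0 : (0 < resol)%N. Proof. by rewrite /resol -lock size_boxl. Qed.

Lemma ceil_val_ge0 v : 0 <= ceil_val v. Proof. by rewrite divr_ge0. Qed.

Lemma ceil_val_le v : ceil_val v <= K.+1%:R.
Proof.
rewrite ler_pdivrMr ?ltr0n ?resol_gt0 // -natrM ler_nat.
have h : (v <= K * resol)%N by rewrite mulnC -ltnS ltn_ord.
by rewrite mulSn -add1n leq_add ?resol_gt0.
Qed.

Lemma ceil_cell x : 0 <= x -> x < K%:R ->
  x <= ceil_val (cell resol cap x) <= x + resol%:R^-1.
Proof.
move=> x0 xK; have q0 : 0 < resol%:R :> R by rewrite ltr0n resol_gt0.
have h : 0 <= resol%:R * x by rewrite mulr_ge0 // ltW.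
have /andP[h1 h2] := truncn_itv h.
have tm : (Num.truncn (resol%:R * x) <= cap)%N.
  by rewrite -(ler_nat R) (le_trans h1) // /cap natrM ler_pM2l // ltW.
rewrite /ceil_val cellE /cellv (minn_idPr tm); apply/andP; split.
  by rewrite ler_pdivlMr // mulrC ltW.
rewrite ler_pdivrMr // [(x + _) * _]mulrDl mulVf ?gt_eqF // -natr1 lerD2r.
by rewrite [x * _]mulrC.
Qed.

End Chain.

Section ScaleConc.
Variable R : realType.
Implicit Type t : E -> R.

Lemma ptimeE t x p : ptime t x p = \sum_(e <- edges x p) t e.
Proof. by rewrite /edges big_map. Qed.

Lemma size_edges x p : size (edges x p) = size p.
Proof. by rewrite /edges size_map size2_zip /=. Qed.

Lemma sum_index (I : eqType) (V : nmodType) (s l : seq I) (x0 : I) (h : nat -> V) :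
  uniq s -> uniq l -> {subset l <= s} ->
  \sum_(e <- l) h (index e s) = \sum_(i in [set i : 'I_(size s) | nth x0 s i \in l]%SET) h i.
Proof.
move=> us ul sub; rewrite (perm_big [seq e <- s | e \in l]) /=; last first.
  apply: uniq_perm => //; first exact: filter_uniq.
  by move=> e; rewrite mem_filter; case el: (e \in l) => //; rewrite sub.
rewrite big_filter (big_nth x0) big_mkord; apply: eq_big => [i|i _]; first by rewrite inE.
by rewrite index_uniq.
Qed.

Variables (An K l : nat).
Hypotheses (l0 : (0 < l)%N) (K0 : (0 < K)%N).
Variable x : Z2.
Hypothesis xA : (nrm x <= An)%N.

Notation N1 := (box_radius An K l).+1.
Notation s := (boxE 0 N1).
Notation q := (resol An K l).
Notation m := (cap An K l).
Notation tcap := (time_cap An K).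
Notation va := (@ceil_val R An K l).
Notation cf := (conf va s).

(** A property of the list alone, hence an event of the product space, which provides the
    certificate for [concentration]: a near-optimal path with few edges. *)
Definition good_list (y : seq 'I_m.+1) : bool := `[< exists p : seq Z2,
  [/\ is_path 0 x p, uniq (0 :: p), ptime (cf y) 0 p <= passage (cf y) 0 x + 1,
      (size p <= tcap * (l.*2.+1) ^ 2)%N & forall v : Z2, v \in 0 :: p -> (nrm v <= box_radius An K l)%N] >].

Lemma cf_ge0 y e : 0 <= cf y e. Proof. exact: ceil_val_ge0. Qed.

Lemma cf_passage y : 0 <= passage (cf y) 0 x <= (2 * An * K.+1)%:R.
Proof.
rewrite passage_ge0 /=; last exact: cf_ge0.
have [p [hp szp _]] := straight_path 0 x.
apply: le_trans (passage_le (cf_ge0 y) hp) _.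
apply: (@le_trans _ _ (\sum_(e <- edges 0 p) K.+1%:R)).
  by rewrite ptimeE; apply: ler_sum => e _; exact: ceil_val_le.
rewrite big_const_seq count_predT iter_addr_0 size_edges.
rewrite -mulrnA ler_nat mulnC leq_mul2r; apply/orP; right; apply: leq_trans szp _.
by rewrite subr0 -mul2n leq_mul2l.
Qed.

Lemma good_list_approx t y : good_conf An K l t ->
  (forall e, e \in s -> t e <= cf y e <= t e + q%:R^-1) ->
  good_list y /\ `|passage t 0 x - passage (cf y) 0 x| <= 2.
Proof.
move=> gc hy; have t0 : forall e, 0 <= t e by case: gc.
have /andP[p0 pA] := cf_passage y.
have NTE : (tcap%:R : R) = (2 * An * K.+1)%:R + 2 by rewrite /time_cap natrD.
have [p [hp lp] pt] : exists2 p, is_path 0 x p & ptime (cf y) 0 p < passage (cf y) 0 x + 1.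
  by apply: passage_lt; rewrite ltrDl.
have [p' [hp' lp' up' _ pt']] := ptime_uniq (cf_ge0 y) hp.
have hle e : e \in s -> t e <= cf y e by move=> /hy/andP[].
have [|h1 h2] := confined l0 gc (cf_ge0 y) hle hp'.
  by rewrite NTE; apply: le_lt_trans pt' _; apply: lt_le_trans pt _; lra.
have Tp' : ptime (cf y) 0 p' <= passage (cf y) 0 x + 1 by apply: le_trans pt' (ltW pt).
have ips (r : seq Z2) : (forall v : Z2, v \in 0 :: r -> (nrm v <= box_radius An K l)%N) ->
    forall e, e \in edges 0 r -> e \in s.
  by move=> h e /edges_base/h he; rewrite mem_boxE subr0 leqW.
split.
  apply/asboolP; exists p'; split=> //; first by split; rewrite ?lp'.
  exact: h2.
have up : passage t 0 x <= passage (cf y) 0 x + 1.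
  apply: le_trans Tp'; apply: (@le_trans _ _ (ptime t 0 p')).
    by apply: passage_le => //; split; rewrite ?lp'.
  by apply: ptime_le => e /(ips _ h1)/hle.
have [r [hr lr] rt] : exists2 p, is_path 0 x p & ptime t 0 p < passage t 0 x + 1.
  by apply: passage_lt; rewrite ltrDl.
have [r' [hr' lr' ur' _ rt']] := ptime_uniq t0 hr.
have [|k1 _] := confined l0 gc t0 (fun e _ => lexx _) hr'.
  by rewrite NTE; apply: le_lt_trans rt' _; apply: lt_le_trans rt _; lra.
have q0 : 0 < q%:R :> R by rewrite ltr0n resol_gt0.
have szr : (size r' <= q)%N.
  rewrite /resol -lock; apply: (@leq_trans (size (0 :: r'))) => //.
  by apply: uniq_leq_size => // v /k1 h; rewrite mem_boxl subr0 leqW.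
have : passage (cf y) 0 x <= ptime t 0 r' + 1.
  apply: (@le_trans _ _ (ptime (cf y) 0 r')).
    by apply: passage_le; [exact: cf_ge0|split; rewrite ?lr'].
  apply: (@le_trans _ _ (\sum_(e <- edges 0 r') (t e + q%:R^-1))).
    rewrite ptimeE big_seq [leRHS]big_seq; apply: ler_sum => e /(ips _ k1)/hy/andP[_].
    by [].
  rewrite big_split /= -ptimeE lerD2l big_const_seq count_predT iter_addr_0 size_edges.
  by rewrite -[_ *+ size r']mulr_natl ler_pdivrMr // mul1r ler_nat.
by rewrite ler_norml; move: up rt rt'; lra.
Qed.

(** The certificate is the edge set of the near-optimal path: each altered edge on it adds at most K
    + 1, and changes elsewhere leave its time as it is. *)
Lemma good_list_certif y : size y = size s -> good_list y -> exists S : {set 'I_(size s)},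
  #|S|%:R <= Num.sqrt (tcap * (l.*2.+1) ^ 2)%:R ^+ 2 :> R /\ forall y', size y' = size s ->
  passage (cf y') 0 x <= passage (cf y) 0 x + 1 +
    K.+1%:R * \sum_(i in S) (nth ord0 y i != nth ord0 y' i)%:R.
Proof.
move=> _ /asboolP[p [[hp lp] up pt szp inb]].
pose e0 : E := (0, true).
have us : uniq s := boxE_uniq _ _.
have ue := edges_uniq hp up.
have sub : {subset edges 0 p <= s}.
  by move=> e /edges_base/inb he; rewrite mem_boxE subr0 leqW.
exists [set i : 'I_(size s) | nth e0 s i \in edges 0 p]%SET; split.
  rewrite sqr_sqrtr // ler_nat -sum1_card -(sum_index e0 (fun=> 1%N) us ue sub).
  by rewrite sum1_size size_edges.
move=> y' _; apply: (@le_trans _ _ (ptime (cf y') 0 p)).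
  by apply: passage_le; [exact: cf_ge0|split].
rewrite -(sum_index e0 (fun i => (nth ord0 y i != nth ord0 y' i)%:R) us ue sub).
apply: (@le_trans _ _ (ptime (cf y) 0 p + K.+1%:R * \sum_(e <- edges 0 p)
  (nth ord0 y (index e s) != nth ord0 y' (index e s))%:R)); last by rewrite lerD2r.
rewrite !ptimeE mulr_sumr -big_split /=; apply: ler_sum => e _; rewrite /conf.
case: eqP => [->|_]; first by rewrite mulr0 addr0.
rewrite mulr1 -[leLHS]add0r lerD ?ceil_val_ge0 //; exact: ceil_val_le.
Qed.

Context (d : measure_display) (Omega : measurableType d) (P : probability Omega R).
Variables (tau : E -> {RV P >-> R}).
Hypothesis iid : iid_edges tau.

(** One center serves all [v], because the discretised weights seen from [v] have the same law for
    every [v]. Of the constant 4, half comes from [concentration] and half from rounding. *)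
Lemma scale_concentration (delta u : R) : 0 < u -> delta <= 1 / 4 ->
  (forall v : Z2, Pbd P [set w | ~ good_conf An K l (fun e => tau (shiftE v e) w)] delta) ->
  exists mm : R, forall v : Z2,
  Pbd P [set w | K.+1%:R * Num.sqrt (tcap * (l.*2.+1) ^ 2)%:R * u + 4 <
                 `|passage (fun e => tau e w) v (v + x) - mm|]
    (delta + 6 * expR (- (u ^+ 2 / 8))).
Proof.
move=> u0 d14 hbad; set M := Num.sqrt _.
have us : uniq s := boxE_uniq _ _.
pose disc v w := map (fun e => cell q m (tau (shiftE v e) w)) s.
pose pm := pmf tau q (m := m).
have trans v (A : pred (seq 'I_m.+1)) : measurable [set w | A (disc v w)] /\
    P [set w | A (disc v w)] = (Prl pm (size s) A)%:E.
  have [h1 h2] := @transfer _ _ _ _ (shift_rv tau v) q m (iid_shift iid v) s A us.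
  split=> //; rewrite h2; congr (Prl _ _ _)%:E.
  by apply/funext => v'; exact: pmf_shift.
have approx v w : good_conf An K l (fun e => tau (shiftE v e) w) ->
    good_list (disc v w) /\
    `|passage (fun e => tau e w) v (v + x) - passage (cf (disc v w)) 0 x| <= 2.
  move=> gc; have -> : passage (fun e => tau e w) v (v + x) =
      passage (fun e => tau (shiftE v e) w) 0 x.
    by rewrite -(passage_shift (fun e => tau e w)) add0r [x + v]addrC.
  apply: good_list_approx => // e es; rewrite (@conf_disc _ _ _ _ q m va s (shift_rv tau v)) //.
  case: gc => h0 hK _; exact: ceil_cell (h0 e) (hK e es).
have hG : Prl pm (size s) (fun y => ~~ good_list y) <= 1 / 4.
  apply: le_trans d14; have [h1 h2] := trans 0 (fun y => ~~ good_list y).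
  rewrite -lee_fin -h2; apply: Pbd_P => //; apply: Pbd_sub (hbad 0).
  by move=> w /= /negP h gc; case: (approx 0 w gc) => /h.
have pm0 : forall v, 0 <= pm v by move=> v; exact: pmf_ge0.
have pm1 : \sum_v pm v = 1 by exact: pmf_sum1.
have hB y : size y = size s -> 0 <= passage (cf y) 0 x < tcap%:R.
  move=> _; have /andP[-> h] := cf_passage y; apply: le_lt_trans h _.
  by rewrite ltr_nat /time_cap addn2 ltnS.
have M0 : 0 < M by rewrite sqrtr_gt0 ltr0n muln_gt0 expn_gt0 andbT /time_cap addn2.
have [mm [h1 h2]] := concentration pm0 pm1 (ler0n _ K.+1) M0 u0 good_list_certif hB hG.
exists mm => v; set e := expR _ in h1 h2 *; set c := _ * u in h1 h2 *.
pose A1 y := good_list y && (passage (cf y) 0 x < mm - (c + 2)).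
pose A2 y := mm + (c + 2) < passage (cf y) 0 x.
apply: (@Pbd_sub _ _ _ _ _ ([set w | ~ good_conf An K l (fun e => tau (shiftE v e) w)] `|`
  ([set w | A1 (disc v w)] `|` [set w | A2 (disc v w)]))); last first.
  apply: PbdU => //; apply: (@Pbd_le _ _ _ _ _ (2 * e + 4 * e)); first by lra.
  have [m1 e1] := trans v A1; have [m2 e2] := trans v A2.
  by apply: PbdU; apply: Pbd_meas => //; rewrite ?e1 ?e2 lee_fin.
move=> w /= hw; have [gc|] := pselect (good_conf An K l (fun e => tau (shiftE v e) w)); last by left.
right; have [gl] := approx v w gc; rewrite /A1 /A2 gl /=.
move: hw; set a := passage _ v _; set b := passage _ 0 x.
rewrite ltNge => /negP h k; have [k1|k1] := ltP b (mm - (c + 2)); [by left|right].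
rewrite ltNge; apply/negP => k2; apply: h; move: k; rewrite !ler_norml; lra.
Qed.

End ScaleConc.

(** * Near additivity of the centers *)

Section Balance.

(** Greedy signs: by the parallelogram identity one of z + q and z - q has squared Euclidean norm at
    most the sum of those of z and q. So the discrepancy grows like the square root of the number of
    pieces. *)
Lemma balance (qs : seq Z2) r : (forall q : Z2, q \in qs -> (nrm q <= r)%N) ->
  exists qa qb : seq Z2, perm_eq (qa ++ qb) qs /\
    (nrm (\sum_(q <- qa) q - \sum_(q <- qb) q) ^ 2 <= 2 * r ^ 2 * size qs)%N.
Proof.
pose sq (z : Z2) : int := z.1 ^+ 2 + z.2 ^+ 2.
suff H : (forall q : Z2, q \in qs -> (nrm q <= r)%N) -> exists qa qb : seq Z2,
    perm_eq (qa ++ qb) qs /\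
    sq (\sum_(q <- qa) q - \sum_(q <- qb) q) <= (2 * r ^ 2 * size qs)%:Z.
  move=> /H[qa [qb [h1 h2]]]; exists qa, qb; split=> //.
  rewrite -lez_nat; apply: le_trans h2; set z := _ - _; rewrite /sq.
  have sqz (a : int) : (`|a|%N ^ 2)%:Z = a ^+ 2.
    by rewrite PoszM -expr2; have := abszE a; move=> ->; rewrite real_normK ?num_real.
  by rewrite /nrm; case: leqP => _; rewrite sqz ?lerDl ?lerDr ?sqr_ge0.
elim: qs => [_|q qs IH hq].
  by exists [::], [::]; rewrite !big_nil subrr muln0.
have [|qa [qb [h1 h2]]] := IH; first by move=> v hv; apply: hq; rewrite inE hv orbT.
have qr : sq q <= (2 * r ^ 2)%:Z.
  have : (nrm q <= r)%N by apply: hq; rewrite mem_head.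
  rewrite /nrm geq_max /sq => /andP[k1 k2].
  by move: k1 k2; case: (q) => a b /=; clear; rewrite !expr2; nia.
set z := _ - _ in h2.
have par : sq (z + q) + sq (z - q) = 2 * sq z + 2 * sq q by rewrite /sq /=; ring.
have e1 : (2 * r ^ 2 * size (q :: qs))%:Z = (2 * r ^ 2 * size qs)%:Z + (2 * r ^ 2)%:Z.
  by rewrite /= mulnS PoszD addrC.
have [hp|hp] : sq (z + q) <= (2 * r ^ 2 * size (q :: qs))%:Z \/
    sq (z - q) <= (2 * r ^ 2 * size (q :: qs))%:Z.
  rewrite e1; move: par h2 qr; clear.
  move: (sq (z + q)) (sq (z - q)) (sq z) (sq q) (_%:Z) (_%:Z) => a b a' b' B B' h1 h2 h3.
  by case: (leP a (B' + B)) => h4; [left|right; move: h1 h2 h3 h4; lra].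
- exists (q :: qa), qb; split; first by rewrite /= perm_cons.
  by rewrite big_cons -addrA addrC.
- exists qa, (q :: qb); split; last by rewrite big_cons opprD [- q + _]addrC addrA.
  by rewrite perm_catC /= perm_cons perm_catC.
Qed.

End Balance.

Section Halving.
Variable R : realType.
Variables (An K l c Nb w N1 : nat) (t : E -> R) (m : Z2 -> R) (u : R).
Let r := (c.+1 * l)%N.
Hypotheses (l0 : (0 < l)%N) (K0 : (0 < K)%N) (rAn : (r <= An)%N).
Hypotheses (hNb : (2 * An * K + 1 < Nb * c)%N) (hw : (2 * r ^ 2 * Nb <= w ^ 2)%N).
Hypotheses (hbox : (box_radius An K l < N1)%N) (N1w : (Nb * r + w <= N1)%N).
Hypotheses (t0 : forall e, 0 <= t e) (tK : forall e, e \in boxE 0 N1 -> t e < K%:R).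
Hypotheses (tsl : forall v, v \in boxl 0 N1 -> slow t v l) (u0 : 0 <= u).
Hypothesis approx : forall v q, (nrm v <= N1)%N -> (nrm q <= An)%N ->
  `|passage t v (v + q) - m q| <= u.

Let r0 : (0 < r)%N. Proof. by rewrite muln_gt0. Qed.

(** Each piece ends at its first vertex at distance [r] from its start. By [chain] it then has at
    least c + 1 centers and costs at least [c], which bounds the number of pieces. *)
Lemma cut_path v p : path adj v p -> (forall y : Z2, y \in v :: p -> (nrm y <= N1)%N) ->
  exists qs : seq Z2, [/\ last v p = v + \sum_(q <- qs) q,
    forall q : Z2, q \in qs -> (nrm q <= r)%N,
    \sum_(q <- qs) m q <= ptime t v p + (size qs)%:R * u &
    (size qs)%:R * c%:R <= ptime t v p + c%:R].
Proof.
have [n] := ubnP (size p); elim: n v p => // n IH v p szp vp inb.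
have piece (a : Z2) pa : is_path v a pa -> (nrm (a - v) <= r)%N -> m (a - v) <= ptime t v pa + u.
  move=> ha hr; have := approx (inb v (mem_head _ _)) (leq_trans hr rAn).
  by rewrite [v + _]addrC subrK ler_norml; have := passage_le t0 ha; lra.
have [lr|lr] := leqP r (nrm (last v p - v)); last first.
  exists [:: last v p - v]; rewrite !big_seq1 !mul1r; split.
  - by rewrite addrC subrK.
  - by move=> q; rewrite inE => /eqP ->; exact: ltnW.
  - by apply: piece; rewrite // ltnW.
  - by rewrite lerDr ptime_ge0.
have [|p1 [p2 [pE e h]]] := @path_nrm_hits v r v p vp; first by rewrite subrr nrm0 lr.
have y1 : path adj v p1 by move: vp; rewrite pE cat_path => /andP[].
set y := last v p1 in e.
have p10 : (0 < size p1)%N.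
  by rewrite lt0n size_eq0; apply/eqP => p1n; move: e r0; rewrite /y p1n /= subrr nrm0 => <-.
have yp : path adj y p2 by move: vp; rewrite pE cat_path => /andP[].
have inp z : z \in v :: p1 -> z \in v :: p by rewrite pE -cat_cons mem_cat => ->.
have [||qs [h1 h2 h3 h4]] := IH y p2 _ yp.
- by move: szp p10; rewrite pE size_cat; clear; lia.
- move=> z; rewrite in_cons => hz; apply: inb; rewrite pE -cat_cons mem_cat.
  by case/orP: hz => [/eqP ->|->]; rewrite ?orbT // mem_last.
have ct : c%:R <= ptime t v p1.
  have [|cs [k1 _ k3]] := chain l0 y1 _ t0.
    by move=> z /inp/inb hz; apply: tsl; rewrite mem_boxl subr0.
  have := k3 y (mem_last _ _); rewrite e /r leq_mul2r gtn_eqF //= => hc.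
  by move: hc; rewrite -(ler_nat R) -natr1; move: k1; lra.
exists (y - v :: qs); split.
- by rewrite pE last_cat h1 big_cons addrA [v + _]addrC subrK.
- by move=> q; rewrite inE => /orP[/eqP ->|/h2 //]; rewrite e.
- rewrite big_cons pE ptime_cat /= -natr1 mulrDl mul1r.
  have : m (y - v) <= ptime t v p1 + u by apply: piece; rewrite ?e.
  by move: h3; lra.
- by rewrite pE ptime_cat /= -natr1 mulrDl mul1r; move: h4; lra.
Qed.

Lemma walk v (qs : seq Z2) : (forall q : Z2, q \in qs -> (nrm q <= r)%N) ->
  (nrm v + size qs * r <= N1)%N ->
  passage t v (v + \sum_(q <- qs) q) <= \sum_(q <- qs) m q + (size qs)%:R * u /\
  (nrm (\sum_(q <- qs) q) <= size qs * r)%N.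
Proof.
elim: qs v => [|q qs IH] v hq hv.
  by rewrite !big_nil addr0 passage0 // mul0r addr0 lexx.
have qr : (nrm q <= r)%N by apply: hq; rewrite mem_head.
have [||h1 h2] := IH (v + q).
- by move=> z hz; apply: hq; rewrite inE hz orbT.
- by apply: leq_trans hv; rewrite /= mulSn addnA leq_add2r (leq_trans (nrmD _ _)) // leq_add2l.
rewrite !big_cons /= mulSn; split; last by rewrite (leq_trans (nrmD _ _)) // leq_add.
have := @approx v q; rewrite ler_norml => /(_ _ _)/andP[||_].
- exact: leq_trans (leq_addr _ _) hv.
- exact: leq_trans qr rAn.
have := passage_triangle v (v + q) (v + (q + \sum_(j <- qs) j)) t0.
by rewrite addrA -natr1 mulrDl mul1r; move: h1; lra.
Qed.

Lemma passage_box v y N : (nrm v + nrm (y - v) <= N1)%N -> (nrm (y - v) <= N)%N ->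
  passage t v y <= (2 * N * K)%:R.
Proof.
move=> hv hN; have [p [hp szp inb]] := straight_path v y.
apply: le_trans (passage_le t0 hp) _.
apply: (@le_trans _ _ (\sum_(e <- edges v p) K%:R)).
  rewrite ptimeE big_seq [leRHS]big_seq; apply: ler_sum => e /edges_base/inb he.
  apply: ltW; apply: tK; rewrite mem_boxE subr0; apply: leq_trans hv.
  by rewrite -(subrK v e.1) (leq_trans (nrmD _ _)) // addnC leq_add2l.
rewrite big_const_seq count_predT iter_addr_0 size_edges.
rewrite -mulrnA ler_nat mulnC leq_mul2r; apply/orP; right; apply: leq_trans szp _.
by rewrite -mul2n leq_mul2l.
Qed.

(** For the inequality that the triangle inequality does not give, [balance] splits the increments
    of a near-geodesic to 2x into two groups with sums close to x. Each group is walked from the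
    origin; together the walks cost as much as the geodesic, up to multiples of [u] for each piece
    and the cost of closing gaps of size at most [w]. *)
Lemma halving x : (nrm (x + x)%R <= An)%N ->
  `|m (x + x) - 2 * m x| <= (2 * Nb + 3)%:R * u + (4 * w * K)%:R + 1.
Proof.
move=> hx.
have AnN : (An <= N1)%N by exact: leq_trans (length_le_box _ l0 K0) (ltnW hbox).
have nxx : nrm (x + x) = (2 * nrm x)%N.
  have -> : x + x = scaleZ 2 x by case: (x) => a b; rewrite /scaleZ; congr (_, _) => /=; ring.
  exact: nrm_scaleZ.
have xA : (nrm x <= An)%N by apply: leq_trans hx; rewrite nxx mul2n -addnn leq_addr.
have z0 : (nrm 0 <= N1)%N by [].
have a1 := approx z0 hx; have a2 := approx z0 xA; have a3 := approx (leq_trans xA AnN) xA.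
rewrite !add0r in a1 a2.
have tri := passage_triangle 0 x (x + x) t0.
have B0 : 0 <= (4 * w * K)%:R :> R by [].
have Nb3 : (2 * Nb + 3)%:R * u = 2 * (Nb%:R * u) + 3 * u :> R by rewrite natrD natrM; ring.
have Nbu : 0 <= Nb%:R * u by rewrite mulr_ge0.
rewrite Nb3.
suff : 2 * m x <= m (x + x) + 2 * (Nb%:R * u) + 3 * u + (4 * w * K)%:R + 1.
  by move: a1 a2 a3 tri; rewrite !ler_norml; lra.
have gc : good_conf An K l t.
  split=> //.
  - by move=> e; rewrite mem_boxE => he; apply: tK; rewrite mem_boxE (leq_trans he).
  - by move=> v; rewrite mem_boxl => he; apply: tsl; rewrite mem_boxl (leq_trans he).
have hT : passage t 0 (x + x) <= (2 * An * K)%:R.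
  by apply: passage_box; rewrite subr0 ?nrm0 ?add0n // (leq_trans hx).
have [p [hp lp] pt] : exists2 p, is_path 0 (x + x) p & ptime t 0 p < passage t 0 (x + x) + 1.
  by apply: passage_lt; rewrite ltrDl.
have [|inb _] := confined l0 gc t0 (fun e _ => lexx _) hp.
  apply: lt_le_trans pt _; apply: le_trans (lerD hT (lexx 1)) _.
  by rewrite natr1 ler_nat /time_cap mulnS; clear; lia.
have [|qs [h1 h2 h3 h4]] := cut_path hp.
  by move=> y /inb hy; apply: leq_trans hy (ltnW hbox).
rewrite lp add0r in h1.
have szq : (size qs <= Nb)%N.
  rewrite leqNgt; apply/negP => hlt.
  have : (Nb.+1 * c)%:R <= (2 * An * K + 1)%:R + c%:R :> R.
    apply: (@le_trans _ _ ((size qs)%:R * c%:R)); first by rewrite -natrM ler_nat leq_mul2r hlt orbT.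
    by apply: le_trans h4 _; rewrite lerD2r natrD; move: pt hT; lra.
  by rewrite -natrD ler_nat mulSn addnC leq_add2r leqNgt hNb.
have [qa [qb [hp' hs]]] := balance h2.
have szab : (size qa + size qb = size qs)%N by rewrite -size_cat; exact: perm_size.
have sumE : x + x = \sum_(q <- qa) q + \sum_(q <- qb) q.
  by rewrite h1 -(perm_big _ hp') big_cat.
have sumM : \sum_(q <- qs) m q = \sum_(q <- qa) m q + \sum_(q <- qb) m q.
  by rewrite -(perm_big _ hp') big_cat.
have dw : (nrm (\sum_(q <- qa) q - \sum_(q <- qb) q) <= w)%N.
  rewrite -leq_sqr (leq_trans hs) // (leq_trans _ hw) // leq_mul2l szq orbT //.
have half qc qd : {subset qc <= qs} -> (size qc <= Nb)%N ->
    x + x = \sum_(q <- qc) q + \sum_(q <- qd) q ->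
    (nrm (\sum_(q <- qc) q - \sum_(q <- qd) q)%R <= w)%N ->
    m x <= \sum_(q <- qc) m q + (size qc)%:R * u + (2 * w * K)%:R + u.
  move=> sub szc; set Sc := \sum_(q <- qc) q; set Sd := \sum_(q <- qd) q => e hd.
  have szr : (size qc * r <= Nb * r)%N by rewrite leq_mul2r szc orbT.
  have [||k1 k2] := @walk 0 qc.
  - by move=> q /sub; exact: h2.
  - by rewrite nrm0 add0n (leq_trans szr) // (leq_trans _ N1w) // leq_addr.
  rewrite add0r -/Sc in k1 k2.
  have hd' : (nrm (x - Sc)%R <= w)%N.
    apply: leq_trans hd; have -> : Sc - Sd = scaleZ 2 (Sc - x).
      have -> : Sd = x + x - Sc by rewrite e addrC addKr.
      case: (Sc) (x) => a b [a' b']; rewrite /scaleZ; congr (_, _) => /=; ring.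
    by rewrite nrm_scaleZ nrmB mul2n -addnn leq_addr.
  have k3 : passage t Sc x <= (2 * w * K)%:R.
    apply: passage_box => //; apply: leq_trans N1w; apply: leq_add => //.
    exact: leq_trans k2 szr.
  by have := passage_triangle 0 Sc x t0; move: a2 k1 k3; rewrite ler_norml; lra.
have sa : {subset qa <= qs} by move=> q hq; rewrite -(perm_mem hp') mem_cat hq.
have sb : {subset qb <= qs} by move=> q hq; rewrite -(perm_mem hp') mem_cat hq orbT.
have s1 : (size qa <= Nb)%N by apply: leq_trans szq; rewrite -szab leq_addr.
have s2 : (size qb <= Nb)%N by apply: leq_trans szq; rewrite -szab leq_addl.
have ha := half qa qb sa s1 sumE dw.
have hb : m x <= \sum_(q <- qb) m q + (size qb)%:R * u + (2 * w * K)%:R + u.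
  by apply: (half qb qa sb s2); [rewrite [RHS]addrC|rewrite nrmB].
have szu : (size qa)%:R * u + (size qb)%:R * u = (size qs)%:R * u by rewrite -mulrDl -natrD szab.
have szu' : (size qs)%:R * u <= Nb%:R * u by rewrite ler_wpM2r // ler_nat.
have wE : (4 * w * K)%:R = 2 * (2 * w * K)%:R :> R by rewrite -natrM !mulnA.
by rewrite wE; move: a1 pt h3; rewrite sumM ler_norml; lra.
Qed.

End Halving.

(** * Rate of convergence to the norm *)

(* Scale [k]: displacements are at most [A k^44], weights are below [k], and a path of
   displacement [2 L k^4] costs at least 1.  A geodesic is cut into about [k^14] pieces
   whose passage times fluctuate by [k^29], and halving it leaves an error [k^42] in the
   endpoint, which costs [k * k^42]: both losses are of order [k^43]. *)
Section Params.
Variables (A L k : nat).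
Hypotheses (A0 : (0 < A)%N) (L0 : (0 < L)%N) (kL : (4 * L <= k)%N).

Definition scale_length := (A * k ^ 44)%N.
Definition scale_slow := (2 * (k ^ 4 * L))%N.
Definition scale_cuts := (k ^ 31)%N.
Definition scale_pieces := ((2 * A + 1) * k ^ 14)%N.
Definition scale_gap := (8 * L * (2 * A + 1) * k ^ 42)%N.
Definition scale_box := (box_radius scale_length k scale_slow + (scale_pieces * (scale_cuts.+1 * scale_slow) + scale_gap)).+1.

Let k1 : (1 < k)%N. Proof. by move: kL L0; clear; lia. Qed.
Let kp n : (0 < k ^ n)%N. Proof. by rewrite expn_gt0 (ltnW k1). Qed.

Lemma scale_slow_gt0 : (0 < scale_slow)%N. Proof. by rewrite /scale_slow muln_gt0 /= muln_gt0 kp L0. Qed.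

Lemma scale_piece_le : (scale_cuts.+1 * scale_slow <= 4 * L * k ^ 35)%N.
Proof.
rewrite /scale_cuts /scale_slow -[35%N]/(31 + 4)%N expnD; move: (kp 31) (kp 4); clear.
move: (k ^ 31)%N (k ^ 4)%N => x y x0 y0.
apply: (@leq_trans (2 * x * (2 * (y * L)))); last by rewrite leq_eqVlt; apply/orP; left; apply/eqP; ring.
by rewrite leq_mul2r; apply/orP; right; lia.
Qed.

Lemma scale_piece_length : (scale_cuts.+1 * scale_slow <= scale_length)%N.
Proof.
apply: leq_trans scale_piece_le _; apply: (@leq_trans (k * k ^ 35)); first by rewrite leq_mul2r kL orbT.
rewrite -expnS; apply: (@leq_trans (k ^ 44)); first by rewrite leq_exp2l.
by rewrite leq_pmull.
Qed.

Lemma scale_pieces_gt : (2 * scale_length * k + 1 < scale_pieces * scale_cuts)%N.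
Proof.
have e1 : (2 * scale_length * k = 2 * A * k ^ 45)%N by rewrite /scale_length [in RHS]expnSr; ring.
have e2 : (scale_pieces * scale_cuts = (2 * A + 1) * k ^ 45)%N by rewrite /scale_pieces /scale_cuts -mulnA -expnD.
have h : (k ^ 0 < k ^ 45)%N by rewrite ltn_exp2l.
by rewrite e1 e2 [((2 * A + 1) * _)%N]mulnDl mul1n ltn_add2l.
Qed.

(** The square root of the number of pieces, k^7, times the length of a piece, of order k^35. *)
Lemma scale_gap_ge : (2 * (scale_cuts.+1 * scale_slow) ^ 2 * scale_pieces <= scale_gap ^ 2)%N.
Proof.
apply: (@leq_trans (2 * (4 * L * k ^ 35) ^ 2 * scale_pieces)).
  by rewrite leq_mul2r leq_mul2l leq_sqr scale_piece_le !orbT.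
have e42 : (k ^ 42 = k ^ 35 * k ^ 7)%N by rewrite -expnD.
have e14 : (k ^ 14 = k ^ 7 * k ^ 7)%N by rewrite -expnD.
rewrite /scale_pieces /scale_gap e42 e14; move: (k ^ 35)%N (k ^ 7)%N => y q.
set B := (2 * A + 1)%N.
have -> : (2 * (4 * L * y) ^ 2 * (B * (q * q)) = (32 * (L * y * q) ^ 2) * B)%N by ring.
have -> : ((8 * L * B * (y * q)) ^ 2 = (32 * (L * y * q) ^ 2) * (2 * B * B))%N by ring.
by rewrite leq_mul2l -{1}(mul1n B) leq_mul2r; apply/orP; right; apply/orP; right; rewrite /B; lia.
Qed.

Definition time_cap_const := (4 * A + 2)%N.

Lemma scale_time_cap_le : (time_cap scale_length k <= time_cap_const * k ^ 45)%N.
Proof.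
rewrite /time_cap /scale_length /time_cap_const [(k ^ 45)%N]expnSr; move: (kp 44) k1; clear; move: (k ^ 44)%N => y y0 k1.
have : (2 * (A * y) * k.+1 <= 2 * (A * y) * (2 * k))%N by rewrite leq_mul2l; apply/orP; right; lia.
have : (1 <= y * k)%N by rewrite muln_gt0 y0 ltnW.
have : (2 * (A * y) * (2 * k) = 4 * A * (y * k))%N by ring.
rewrite [((4 * A + 2) * _)%N]mulnDl; lia.
Qed.

Definition box_const := (2 * L * time_cap_const + 12 * L * (2 * A + 1) + 1)%N.

Lemma scale_box_le : (scale_box <= box_const * k ^ 49)%N.
Proof.
have h1 : (box_radius scale_length k scale_slow <= 2 * L * time_cap_const * k ^ 49)%N.
  apply: (@leq_trans (time_cap_const * k ^ 45 * scale_slow)); first by rewrite leq_mul2r scale_time_cap_le orbT.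
  by rewrite /scale_slow -[49%N]/(45 + 4)%N expnD leq_eqVlt; apply/orP; left; apply/eqP; ring.
have h2 : (scale_pieces * (scale_cuts.+1 * scale_slow) <= 4 * L * (2 * A + 1) * k ^ 49)%N.
  apply: (@leq_trans (scale_pieces * (4 * L * k ^ 35))); first by rewrite leq_mul2l scale_piece_le orbT.
  by rewrite /scale_pieces -[49%N]/(14 + 35)%N expnD leq_eqVlt; apply/orP; left; apply/eqP; ring.
have h3 : (scale_gap <= 8 * L * (2 * A + 1) * k ^ 49)%N.
  by rewrite /scale_gap leq_mul2l leq_exp2l // orbT.
have e : (box_const * k ^ 49 = 2 * L * time_cap_const * k ^ 49 + (4 * L * (2 * A + 1) * k ^ 49 +
  8 * L * (2 * A + 1) * k ^ 49) + k ^ 49)%N by rewrite /box_const; ring.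
rewrite e /scale_box -addn1; apply: leq_add; last exact: kp.
by apply: leq_add => //; exact: leq_add.
Qed.

Variable R : realType.

Definition dev_const : nat := (10 * L * time_cap_const + 4)%N.
Definition dev : R := dev_const%:R * k%:R ^+ 29.

Lemma dev_ge : k.+1%:R * Num.sqrt (time_cap scale_length k * (scale_slow.*2.+1) ^ 2)%:R * k%:R + 4 <= dev.
Proof.
have hs : Num.sqrt (time_cap scale_length k * (scale_slow.*2.+1) ^ 2)%:R <= (5 * L * time_cap_const * k ^ 27)%:R :> R.
  rewrite -[leRHS]ger0_norm // -sqrtr_sqr ler_wsqrtr // -natrX ler_nat.
  (* Passing from k^45 to k^46 gives an even exponent, so that the square root is a power of k. *)
  apply: (@leq_trans (time_cap_const * k ^ 46 * (5 * L * k ^ 4) ^ 2)).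
    apply: leq_mul; first by rewrite (leq_trans scale_time_cap_le) // leq_mul2l leq_exp2l // orbT.
    rewrite leq_sqr /scale_slow -mul2n; move: (kp 4) L0; clear; move: (k ^ 4)%N => y y0 L0.
    have : (0 < L * y)%N by rewrite muln_gt0 L0 y0.
    have -> : (2 * (2 * (y * L)) = 4 * (L * y))%N by ring.
    rewrite -mulnA; lia.
  have e27 : (k ^ 27 = k ^ 23 * k ^ 4)%N by rewrite -expnD.
  have e46 : (k ^ 46 = k ^ 23 * k ^ 23)%N by rewrite -expnD.
  rewrite e27 e46; move: (k ^ 23)%N (k ^ 4)%N => y q.
  have -> : (time_cap_const * (y * y) * (5 * L * q) ^ 2 = time_cap_const * (5 * L * y * q) ^ 2)%N by ring.
  have -> : ((5 * L * time_cap_const * (y * q)) ^ 2 = time_cap_const * time_cap_const * (5 * L * y * q) ^ 2)%N by ring.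
  by rewrite leq_mul2r leq_pmull ?orbT // /time_cap_const addn2.
have k29 : 1 <= k%:R ^+ 29 :> R by rewrite -natrX ler1n kp.
rewrite /dev /dev_const natrD mulrDl; apply: lerD; last by rewrite ler_peMr.
apply: (@le_trans _ _ ((2 * k)%:R * (5 * L * time_cap_const * k ^ 27)%:R * k%:R)).
  rewrite ler_wpM2r // ler_pM // ler_nat; move: k1; clear; lia.
rewrite -natrX -!natrM ler_nat -[29%N]/(1 + 27 + 1)%N !expnD !expn1.
by rewrite leq_eqVlt; apply/orP; left; apply/eqP; ring.
Qed.

Definition err_const : nat := ((2 * (2 * A + 1) + 3) * dev_const + 32 * L * (2 * A + 1) + 1)%N.

Lemma err_le : (2 * scale_pieces + 3)%:R * dev + (4 * scale_gap * k)%:R + 1 <= err_const%:R * k%:R ^+ 43.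
Proof.
have h1 : (2 * scale_pieces + 3)%:R * dev <= ((2 * (2 * A + 1) + 3) * dev_const)%:R * k%:R ^+ 43.
  rewrite /dev -!natrX -!natrM ler_nat -[43%N]/(14 + 29)%N expnD.
  have : (2 * scale_pieces + 3 <= (2 * (2 * A + 1) + 3) * k ^ 14)%N.
    by rewrite /scale_pieces [((2 * (2 * A + 1) + 3) * _)%N]mulnDl [(2 * (_ * k ^ _))%N]mulnA leq_add2l leq_pmulr.
  move: (k ^ 29)%N (k ^ 14)%N => y q h.
  apply: (@leq_trans ((2 * (2 * A + 1) + 3) * q * (dev_const * y))); first by rewrite leq_mul2r h orbT.
  by rewrite leq_eqVlt; apply/orP; left; apply/eqP; ring.
have h2 : (4 * scale_gap * k)%:R = (32 * L * (2 * A + 1))%:R * k%:R ^+ 43 :> R.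
  by rewrite -natrX -natrM /scale_gap [(k ^ 43)%N]expnSr; congr _%:R; ring.
have h3 : 1 <= k%:R ^+ 43 :> R by rewrite -natrX ler1n kp.
rewrite h2 /err_const [X in _ <= X * _]natrD [X in _ <= (X + _) * _]natrD [X in _ <= X]mulrDl [X in _ <= X + _]mulrDl.
rewrite [X in _ <= _ + X]mul1r.
by apply: lerD => //; apply: lerD.
Qed.

End Params.

Lemma poly_expR (R : realType) (C a : R) p : 0 <= C -> 0 < a ->
  exists k0, forall k, (k0 <= k)%N -> C * k%:R ^+ p <= expR (a * k%:R).
Proof.
move=> C0 a0; pose b := a / p.+1%:R; have b0 : 0 < b by rewrite divr_gt0.
exists (Num.truncn (C / b ^+ p.+1)).+1 => k hk.
have e : a * k%:R = p.+1%:R * (b * k%:R).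
  by rewrite /b mulrA mulrCA divff ?mulr1 ?pnatr_eq0.
rewrite e expRM_natl.
have h : b * k%:R <= expR (b * k%:R) by apply: le_trans (expR_ge1Dx _); rewrite lerDr.
apply: (@le_trans _ _ ((b * k%:R) ^+ p.+1)); last by apply: lerXn2r => //; rewrite nnegrE ?expR_ge0 // mulr_ge0 // ltW.
rewrite exprMn [k%:R ^+ p.+1]exprS [leRHS]mulrA ler_wpM2r ?exprn_ge0 // -ler_pdivrMl ?exprn_gt0 //.
rewrite mulrC; apply: ltW; apply: lt_le_trans (truncnS_gt _) _; last by rewrite ler_nat.
Qed.

Section ScaleProbability.
Context (R : realType) (d : measure_display) (Omega : measurableType d) (P : probability Omega R).
Variables (tau : E -> {RV P >-> R}).
Hypothesis iid : iid_edges tau.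
Hypothesis tau0 : forall e w, 0 <= tau e w.
Variable alpha : R.
Hypothesis a0 : 0 < alpha.
Hypothesis expint : forall e, (\int[P]_w (expR (alpha * tau e w))%:E < +oo)%E.

Let tw (w : Omega) (e : E) : R := tau e w.

Variable L : nat.
Hypothesis L0 : (0 < L)%N.
Hypothesis slowP : forall (j : nat) (v : Z2),
  Pbd P [set w | ~ slow (tw w) v (2 * (16 ^ j * L))] ((1 / 2) ^+ (2 ^ j)).

Lemma scale_slow_pow j : scale_slow L (2 ^ j) = (2 * (16 ^ j * L))%N.
Proof. by rewrite /scale_slow -expnM mulnC -[(16 ^ j)%N]/((2 ^ 4) ^ j)%N -expnM [(4 * j)%N]mulnC [RHS]mulnC. Qed.

(** The three entries are rates for the tail of the weights, the failures of [slow], and Talagrand's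
    bound with deviation parameter k. *)
Definition rate : R := Num.min alpha (Num.min (ln 2) (1 / 8)).

Lemma rate_gt0 : 0 < rate.
Proof. by rewrite /rate !lt_min a0 ln_gt0 ?ltr1n //=; lra. Qed.

Lemma rate_alpha (k : nat) : expR (- (alpha * k%:R)) <= expR (- (rate * k%:R)).
Proof. by rewrite ler_expR lerN2 ler_wpM2r // /rate ge_min lexx. Qed.

Lemma rate_half (k : nat) : (1 / 2) ^+ k <= expR (- (rate * k%:R)).
Proof.
have -> : (1 / 2) ^+ k = expR (- (ln 2 * k%:R)) :> R.
  have -> : - (ln 2 * k%:R) = k%:R * - ln 2 :> R by ring.
  by rewrite expRM_natl expRN lnK ?posrE // div1r.
by rewrite ler_expR lerN2 ler_wpM2r // /rate !ge_min lexx /= orbT.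
Qed.

Lemma rate_square (k : nat) : expR (- (k%:R ^+ 2 / 8)) <= expR (- (rate * k%:R)).
Proof.
rewrite ler_expR lerN2; apply: (@le_trans _ _ (1 / 8 * k%:R)).
  by rewrite ler_wpM2r // /rate !ge_min lexx !orbT.
by case: k => [|k]; rewrite ?mulr0 ?expr0n ?mul0r // expr2 mul1r mulrC ler_pM2r ?invr_gt0 // ler_peMl // ler1n.
Qed.

Definition bad_box (v : Z2) (N k l : nat) : set Omega :=
  [set w | (exists2 e, e \in boxE v N & k%:R <= tau e w) \/
           (exists2 y, y \in boxl v N & ~ slow (tw w) y l)].

Definition badc : R := 2 * expmoment tau alpha + 1.

Lemma bad_box_bound v N j : Pbd P (bad_box v N (2 ^ j) (scale_slow L (2 ^ j)))
  ((N.*2.+1 ^ 2)%:R * (badc * expR (- (rate * (2 ^ j)%:R)))).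
Proof.
set k := (2 ^ j)%N; have M0 := expmoment_ge0 tau alpha.
apply: (@Pbd_le _ _ _ _ _ ((size (boxE v N))%:R * (expmoment tau alpha * expR (- (alpha * k%:R))) +
   (size (boxl v N))%:R * (1 / 2) ^+ k)); last first.
  apply: PbdU; first exact: (tail_box iid a0 expint v N k%:R).
  apply: (@Pbd_list _ _ _ _ _ _ (fun y => [set w | ~ slow (tw w) y (scale_slow L k)])) => y _.
  by rewrite /k scale_slow_pow; exact: slowP.
rewrite size_boxE size_boxl natrM; set n := (_ ^ 2)%:R; have n0 : 0 <= n by [].
have -> : n * (badc * expR (- (rate * k%:R))) =
  2 * n * (expmoment tau alpha * expR (- (rate * k%:R))) + n * expR (- (rate * k%:R)).
  by rewrite /badc; ring.
apply: lerD; last by rewrite ler_wpM2l // rate_half.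
by rewrite ler_wpM2l ?mulr_ge0 // ler_wpM2l // rate_alpha.
Qed.

Variable A : nat.
Hypothesis A0 : (0 < A)%N.

Let bc : R := (9 * box_const A L ^ 2)%:R.

Lemma box_poly N k : (4 * L <= k)%N -> (N <= scale_box A L k)%N ->
  (N.*2.+1 ^ 2)%:R <= bc * k%:R ^+ 98 :> R.
Proof.
move=> kL hN; have k0 : (0 < k)%N by move: kL L0; clear; lia.
rewrite /bc -natrX -natrM ler_nat.
have h : (N <= box_const A L * k ^ 49)%N by apply: leq_trans hN _; exact: scale_box_le.
have h1 : (0 < box_const A L * k ^ 49)%N by rewrite muln_gt0 expn_gt0 k0 /box_const addn1.
have -> : (9 * box_const A L ^ 2 * k ^ 98 = (3 * (box_const A L * k ^ 49)) ^ 2)%N.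
  by rewrite -[98%N]/(49 + 49)%N expnD; ring.
by rewrite leq_sqr; move: h h1; clear; lia.
Qed.

(** Half of the rate is spent on polynomial factors: the exponent 98 = 2 * 49 counts the vertices of
    the box, and 186 = 98 + 88 the pairs of a vertex and a displacement. *)
Let B (C : R) p (k : nat) := C * k%:R ^+ p <= expR (rate / 2 * k%:R).

Let B_use C p k : 0 <= C -> B C p k ->
  C * k%:R ^+ p * expR (- (rate * k%:R)) <= expR (- (rate / 2 * k%:R)).
Proof.
move=> C0 h; have -> : - (rate / 2 * k%:R) = rate / 2 * k%:R + - (rate * k%:R) by lra.
by rewrite [leRHS]expRD ler_wpM2r ?expR_ge0.
Qed.

Let c1 : R := bc * badc + 6.
Let c2 : R := 4 * (bc * (9 * A ^ 2)%:R).

Let badc0 : 0 <= badc.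
Proof. by rewrite /badc addr_ge0 // mulr_ge0 // expmoment_ge0. Qed.

Let k_ok k := [/\ (4 * L <= k)%N, B c1 98 k, B c2 186 k & B 4 0 k].

Let k_large : exists k0, forall k, (k0 <= k)%N -> k_ok k.
Proof.
have r2 : 0 < rate / 2 by rewrite divr_gt0 // rate_gt0.
have [|ka ha] := @poly_expR R c1 _ 98 _ r2; first by rewrite addr_ge0 // mulr_ge0.
have [|kb hb] := @poly_expR R c2 _ 186 _ r2; first by rewrite /c2 !mulr_ge0.
have [//|kc hc] := @poly_expR R 4 _ 0 _ r2.
exists (maxn (4 * L) (maxn ka (maxn kb kc))) => k; rewrite !geq_max => /and4P[h1 h2 h3 h4].
by split=> //; [exact: ha|exact: hb|exact: hc].
Qed.

Let quarter k : k_ok k -> expR (- (rate / 2 * k%:R)) <= 1 / 4.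
Proof.
case=> _ _ _; rewrite /B expr0 mulr1 expRN => h.
by rewrite div1r lef_pV2 ?posrE ?expR_gt0.
Qed.

Let bad_small v N j : k_ok (2 ^ j) -> (N <= scale_box A L (2 ^ j))%N ->
  Pbd P (bad_box v N (2 ^ j) (scale_slow L (2 ^ j)))
    (bc * (2 ^ j)%:R ^+ 98 * (badc * expR (- (rate * (2 ^ j)%:R)))).
Proof.
move=> [kL _ _ _] hN; apply: Pbd_le (bad_box_bound v N j).
by rewrite ler_wpM2r ?box_poly // mulr_ge0 // expR_ge0.
Qed.

Let dv j : R := dev A L (2 ^ j) R.

(** Any value with this concentration will do; the quantifier over [v] makes it a function of the
    displacement alone. *)
Definition center (j : nat) (x : Z2) : R := xget 0 [set mm | forall v : Z2,
  Pbd P [set w | dv j < `|passage (tw w) v (v + x) - mm|] (expR (- (rate / 2 * (2 ^ j)%:R)))].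

Lemma centerP j x : k_ok (2 ^ j) -> (nrm x <= scale_length A (2 ^ j))%N -> forall v : Z2,
  Pbd P [set w | dv j < `|passage (tw w) v (v + x) - center j x|]
    (expR (- (rate / 2 * (2 ^ j)%:R))).
Proof.
move=> hk; have [kL h1 h2 h3] := hk; set k := (2 ^ j)%N in hk kL h1 h2 h3 *; move=> xA.
suff /xgetPex : exists mm, [set mm | forall v : Z2,
  Pbd P [set w | dv j < `|passage (tw w) v (v + x) - mm|] (expR (- (rate / 2 * k%:R)))] mm by exact.
have k0 : (0 < k)%N by rewrite expn_gt0.
have k1 : 1 <= k%:R :> R by rewrite ler1n.
have lg : (0 < scale_slow L k)%N by exact: scale_slow_gt0.
set e := bc * k%:R ^+ 98 * (badc * expR (- (rate * k%:R))).
have e1 : e + 6 * expR (- (rate * k%:R)) <= expR (- (rate / 2 * k%:R)).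
  apply: le_trans (B_use _ h1); last by rewrite addr_ge0 // mulr_ge0.
  rewrite /e /c1; have X0 := expR_ge0 (- (rate * k%:R)).
  have Y1 : 1 <= k%:R ^+ 98 :> R by rewrite exprn_ege1.
  have : 6 * expR (- (rate * k%:R)) * 1 <= 6 * expR (- (rate * k%:R)) * k%:R ^+ 98.
    by rewrite ler_wpM2l // mulr_ge0.
  move: X0; set X := expR _; set Y := _ ^+ 98 => X0 h.
  have -> : (bc * badc + 6) * Y * X = bc * Y * (badc * X) + 6 * X * Y by ring.
  by rewrite lerD2l -[leLHS]mulr1.
have e4 : e <= 1 / 4.
  apply: le_trans (quarter hk); apply: le_trans e1.
  by rewrite lerDl mulr_ge0 // expR_ge0.
have kR : 0 < k%:R :> R by rewrite ltr0n.
have hb (v : Z2) : Pbd P [set w | ~ good_conf (scale_length A k) k (scale_slow L k) (fun e => tau (shiftE v e) w)] e.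
  apply: Pbd_sub (@bad_small v (box_radius (scale_length A k) k (scale_slow L k)).+1 j hk _); last first.
    by rewrite /scale_box ltnS leq_addr.
  move=> w /= h; apply: contrapT => /not_orP[/forall2NP n1 /forall2NP n2]; apply: h.
  split=> [e'|e'|u]; first exact: tau0.
  - rewrite mem_boxE subr0 => he; rewrite ltNge; apply/negP => hle.
    have [] := n1 (shiftE v e') => //; rewrite mem_boxE /= addrK he.
    by case.
  - rewrite mem_boxl subr0 => hu; have [] := n2 (u + v).
      by rewrite mem_boxl addrK hu => -[].
    by move/contrapT; exact: slow_shift.
have [mm hmm] := @scale_concentration R (scale_length A k) k (scale_slow L k) lg x xA d Omega P tau iid e k%:R kR e4 hb.
exists mm => v; apply: Pbd_le (Pbd_sub _ (hmm v)).
  by apply: le_trans e1; rewrite lerD2l ler_wpM2l // rate_square.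
move=> w /=; apply: le_lt_trans; exact: dev_ge.
Qed.

(** The claim is deterministic. With positive probability there is no bad edge or vertex and all
    passage times from the box are near their centers; one such outcome feeds [halving]. *)
Lemma center_double j x : k_ok (2 ^ j) -> (nrm (x + x)%R <= scale_length A (2 ^ j))%N ->
  `|center j (x + x) - 2 * center j x| <= (err_const A L)%:R * (2 ^ j)%:R ^+ 43.
Proof.
move=> hk; have [kL h1 h2 h3] := hk; move=> hx.
set k := (2 ^ j)%N in hk kL h1 h2 h3 hx *.
have k0 : (0 < k)%N by rewrite expn_gt0.
have kR : 1 <= k%:R :> R by rewrite ler1n.
pose N1 := scale_box A L k; pose prs := [seq (v, q) | v <- boxl 0 N1, q <- boxl 0 (scale_length A k)].
have B1 := bad_small 0 hk (leqnn N1).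
have B2 : Pbd P [set w | exists2 z, z \in prs & dv j < `|passage (tw w) z.1 (z.1 + z.2) - center j z.2|]
    ((size prs)%:R * expR (- (rate / 2 * k%:R))).
  apply: (@Pbd_list _ _ _ _ _ _
    (fun z => [set w | dv j < `|passage (tw w) z.1 (z.1 + z.2) - center j z.2|])) => _ /allpairsP[[v q] [_ hq ->]].
  by apply: centerP => //; move: hq; rewrite mem_boxl subr0.
have [|w hw] := Pbd_ex (PbdU B1 B2).
  have : (size prs)%:R * expR (- (rate / 2 * k%:R)) <= 1 / 4.
    rewrite expRN ler_pdivrMr ?expR_gt0 // -ler_pdivrMl; last by lra.
    apply: le_trans h2; rewrite /c2 invf_div divr1 -!mulrA ler_wpM2l //.
    rewrite size_allpairs !size_boxl natrM mulrA -[186%N]/(98 + 88)%N exprD.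
    have -> : bc * (9 * A ^ 2)%:R * (k%:R ^+ 98 * k%:R ^+ 88) =
        bc * k%:R ^+ 98 * ((9 * A ^ 2)%:R * k%:R ^+ 88) by ring.
    apply: ler_pM => //; first exact: box_poly.
    have -> : (9 * A ^ 2)%:R * k%:R ^+ 88 = ((3 * scale_length A k) ^ 2)%:R :> R.
      rewrite -[in LHS]natrX -[in LHS]natrM -[88%N]/(44 + 44)%N expnD /scale_length; congr _%:R; ring.
    rewrite ler_nat leq_sqr.
    have : (0 < scale_length A k)%N by rewrite /scale_length muln_gt0 A0 expn_gt0 k0.
    clear; lia.
  have : bc * k%:R ^+ 98 * (badc * expR (- (rate * k%:R))) <= 1 / 4.
    apply: le_trans (quarter hk); apply: le_trans (B_use _ h1); last by rewrite addr_ge0 // mulr_ge0.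
    rewrite /c1 [_ * (badc * _)]mulrA ler_wpM2r ?expR_ge0 // mulrAC ler_wpM2r ?exprn_ge0 //.
    by rewrite lerDl.
  by rewrite -/k; lra.
have hw1 : ~ bad_box 0 N1 k (scale_slow L k) w by move=> h; apply: hw; left.
have hw2 z : z \in prs -> `|passage (tw w) z.1 (z.1 + z.2) - center j z.2| <= dv j.
  by move=> hz; rewrite leNgt; apply/negP => h; apply: hw; right; exists z.
apply: le_trans _ (err_le A L0 kL R).
apply: (@halving R (scale_length A k) k (scale_slow L k) (scale_cuts k) (scale_pieces A k) (scale_gap A L k) N1 (tw w)) => //.
- exact: scale_slow_gt0.
- exact: scale_piece_length.
- exact: scale_pieces_gt L0 kL.
- exact: scale_gap_ge.
- by rewrite /N1 /scale_box ltnS leq_addr.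
- by rewrite /N1 /scale_box leqW // leq_addl.
- by move=> e; exact: tau0.
- move=> e he; rewrite ltNge; apply/negP => hle; apply: hw1; left; exists e => //.
- by move=> v hv; apply: contrapT => h; apply: hw1; right; exists v.
- by rewrite /dev mulr_ge0 // exprn_ge0.
- move=> v q hv hq; apply: (hw2 (v, q)).
  by apply: allpairs_f; rewrite mem_boxl subr0.
Qed.

Lemma scale_estimates : exists (C a : R) (j0 : nat) (m : nat -> Z2 -> R), [/\ 0 < C, 0 < a,
  forall j v x, (j0 <= j)%N -> (nrm x <= A * (2 ^ j) ^ 44)%N ->
    Pbd P [set w | C * (2 ^ j)%:R ^+ 43 < `|passage (tw w) v (v + x) - m j x|]
      (expR (- (a * (2 ^ j)%:R))) &
  forall j x, (j0 <= j)%N -> (nrm (x + x)%R <= A * (2 ^ j) ^ 44)%N ->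
    `|m j (x + x) - 2 * m j x| <= C * (2 ^ j)%:R ^+ 43].
Proof.
have [k0 hk0] := k_large.
have hk j : (k0 <= j)%N -> k_ok (2 ^ j).
  by move=> h; apply: hk0; apply: leq_trans h _; rewrite ltnW // ltn_expl.
exists (dev_const A L + err_const A L)%:R, (rate / 2), k0, center; split.
- by rewrite ltr0n /dev_const addnA addn4 addSn.
- by rewrite divr_gt0 // rate_gt0.
- move=> j v x /hk hj xA; apply: Pbd_sub (centerP hj xA v) => w /=; apply: le_lt_trans.
  rewrite /dv /dev ler_pM ?exprn_ge0 ?ler_nat ?leq_addr // ler_weXn2l //.
  by rewrite ler1n expn_gt0.
- move=> j x /hk hj xA; apply: le_trans (center_double hj xA) _.
  by rewrite ler_wpM2r ?exprn_ge0 // ler_nat leq_addl.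
Qed.

End ScaleProbability.

(** * Telescoping of the centers over the scales *)

Section Telescope.
Context (R : realType) (d : measure_display) (Omega : measurableType d) (P : probability Omega R).
Variables (tau : E -> {RV P >-> R}).
Hypothesis tau0 : forall e w, 0 <= tau e w.

Let tw (w : Omega) (e : E) : R := tau e w.

Variable g : R * R -> R.
Hypothesis hconv : forall z : Z2, {ae P, forall w,
  (fun n : nat => passage (tw w) origin ((n%:Z * z.1)%R, (n%:Z * z.2)%R) / n%:R)
    @ \oo --> g (z.1%:~R, z.2%:~R)}.

Variables (A e j0 : nat) (C a : R) (m : nat -> Z2 -> R).
Hypotheses (C0 : 0 < C) (a0 : 0 < a) (A0 : (0 < A)%N).
Hypothesis deviation : forall j v x, (j0 <= j)%N -> (nrm x <= A * (2 ^ j) ^ e.+1)%N ->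
  Pbd P [set w | C * (2 ^ j)%:R ^+ e < `|passage (tw w) v (v + x) - m j x|]
    (expR (- (a * (2 ^ j)%:R))).
Hypothesis doubling : forall j x, (j0 <= j)%N -> (nrm (x + x)%R <= A * (2 ^ j) ^ e.+1)%N ->
  `|m j (x + x) - 2 * m j x| <= C * (2 ^ j)%:R ^+ e.

Lemma scaleZ_double n x : scaleZ (2 * n) x = scaleZ n x + scaleZ n x.
Proof. by case: x => x y; rewrite /scaleZ mul2n -addnn; congr (_, _) => /=; rewrite PoszD mulrDl. Qed.

Lemma scaleZM n n' x : scaleZ n (scaleZ n' x) = scaleZ (n * n') x.
Proof. by rewrite /scaleZ /= !PoszM !mulrA. Qed.

Lemma doubling_iter j x i : (j0 <= j)%N -> (nrm (scaleZ (2 ^ i) x) <= A * (2 ^ j) ^ e.+1)%N ->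
  `|m j (scaleZ (2 ^ i) x) - 2 ^+ i * m j x| <= (2 ^+ i - 1) * (C * (2 ^ j)%:R ^+ e).
Proof.
move=> hj; elim: i => [|i IH].
  have -> : scaleZ (2 ^ 0) x = x by case: (x) => u v; rewrite /scaleZ !mul1r.
  by rewrite expr0 mul1r !subrr normr0 mul0r.
rewrite [(2 ^ i.+1)%N]expnS scaleZ_double [2 ^+ i.+1]exprS => h; have h' : (nrm (scaleZ (2 ^ i) x) <= A * (2 ^ j) ^ e.+1)%N.
  by apply: leq_trans h; rewrite -scaleZ_double !nrm_scaleZ -mulnA leq_pmull.
move: (doubling hj h) (IH h').
rewrite !ler_norml; move: (C * _) (m j (_ + _)) (m j (scaleZ _ _)) (2 ^+ i) (m j x) => b u v q y.
move=> /andP[h1 h2] /andP[h3 h4]; apply/andP; split; lra.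
Qed.

(** Raising j by 1 allows displacements larger by the factor b = 2^(e+1), while the error grows by
    2^e only. So the quotients of the centers of b^i x at scale j + i by b^i change by amounts that
    decay like 2^(-i); convergence in probability identifies their limit as g x. *)
Lemma deviation_limit : exists (C' : R) (j1 : nat), 0 < C' /\
  forall j x, (j1 <= j)%N -> (nrm x <= A * (2 ^ j) ^ e.+1)%N ->
  `|m j x - g (rv R x)| <= C' * (2 ^ j)%:R ^+ e.
Proof.
have [n1 hn1] := @expR_small R 1 a (1 / 4) ler01 a0 ltac:(lra).
exists (6 * C * 2 ^+ e), (maxn j0 n1); split; first by rewrite !mulr_gt0 // exprn_gt0.
move=> j x; rewrite geq_max => /andP[hj0 hjn] hx.
pose b := (2 ^ e.+1)%N; pose y i := scaleZ (b ^ i) x.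
pose D i : R := C * (2 ^ (j + i))%:R ^+ e.
have quarter i : expR (- (a * (2 ^ (j + i))%:R)) <= 1 / 4 :> R.
  rewrite -[leLHS]mul1r; apply: hn1; rewrite ler_nat; apply: (leq_trans hjn).
  by apply: (leq_trans (leq_addr i j)); rewrite ltnW // ltn_expl.
have bE i : (b ^ i * (2 ^ j) ^ e.+1 = (2 ^ (j + i)) ^ e.+1)%N.
  by rewrite /b -!expnM -expnD; congr (2 ^ _)%N; ring.
have yi i : (nrm (y i) <= A * (2 ^ (j + i)) ^ e.+1)%N.
  by rewrite /y nrm_scaleZ -bE mulnCA leq_mul2l hx orbT.
have ji i : (j0 <= j + i)%N by rewrite (leq_trans hj0) ?leq_addr.
have D0 i : 0 <= D i by rewrite mulr_ge0 ?(ltW C0) // exprn_ge0.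
have DS i : D i <= D i.+1.
  rewrite ler_wpM2l ?(ltW C0) // lerXn2r ?nnegrE // ler_nat leq_exp2l // addnS //.
(* Centers of the same displacement at consecutive scales are compared through one outcome whose
   passage time is close to both. *)
have compare i : `|m (j + i.+1)%N (y i) - m (j + i)%N (y i)| <= D i + D i.+1.
  have yi' : (nrm (y i) <= A * (2 ^ (j + i.+1)) ^ e.+1)%N.
    apply: leq_trans (yi i) _; rewrite leq_mul2l leq_exp2r // leq_exp2l // addnS leqnSn orbT //.
  have [|w hw] := Pbd_ex (PbdU (deviation 0 (ji i) (yi i)) (deviation 0 (ji i.+1) yi')).
    by move: (quarter i) (quarter i.+1); lra.
  have h1 : `|passage (tw w) 0 (0 + y i) - m (j + i)%N (y i)| <= D i.
    by rewrite leNgt; apply/negP => h; apply: hw; left.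
  have h2 : `|passage (tw w) 0 (0 + y i) - m (j + i.+1)%N (y i)| <= D i.+1.
    by rewrite leNgt; apply/negP => h; apply: hw; right.
  move: h1 h2; rewrite !ler_norml; lra.
have bR : (b%:R : R) = 2 ^+ e.+1 by rewrite /b natrX.
have step i : `|m (j + i.+1)%N (y i.+1) - b%:R * m (j + i)%N (y i)| <= b%:R * (3 * D i.+1).
  have h : (nrm (scaleZ (2 ^ e.+1) (y i)) <= A * (2 ^ (j + i.+1)) ^ e.+1)%N.
    by have := yi i.+1; rewrite /y scaleZM expnS.
  have := doubling_iter (ji i.+1) h; rewrite -/b {1}/y scaleZM -expnS -/(y i.+1) -bR.
  have b1 : 1 <= b%:R :> R by rewrite ler1n expn_gt0.
  have : b%:R * `|m (j + i.+1)%N (y i) - m (j + i)%N (y i)| <= b%:R * (D i + D i.+1).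
    by rewrite ler_pM2l // (lt_le_trans ltr01).
  have : b%:R * D i <= b%:R * D i.+1 by rewrite ler_pM2l // (lt_le_trans ltr01).
  rewrite -[X in X * `|_|](gtr0_norm (lt_le_trans ltr01 b1)) -normrM -/(D i.+1).
  by rewrite !ler_norml; move: (D0 i.+1); lra.
pose be i := m (j + i)%N (y i) / b%:R ^+ i.
have b0 i : 0 < b%:R ^+ i :> R by rewrite exprn_gt0 // ltr0n expn_gt0.
have DE i : D i = C * (2 ^ j)%:R ^+ e * b%:R ^+ i * (1 / 2) ^+ i.
  rewrite /D expnD natrM exprMn -!mulrA; congr (_ * (_ * _)).
  rewrite bR -exprMn exprS mulrAC div1r divff // mul1r natrX -!exprM mulnC //.
have bstep i : `|be i.+1 - be i| <= 6 * (C * 2 ^+ e * (2 ^ j)%:R ^+ e) * (1 / 2) ^+ i.+1.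
  have bne : b%:R != 0 :> R by rewrite bR expf_neq0.
  have e1 : be i.+1 - be i = (m (j + i.+1)%N (y i.+1) - b%:R * m (j + i)%N (y i)) / b%:R ^+ i.+1.
    by rewrite /be exprS; field; rewrite bne expf_neq0.
  rewrite e1 normrM [`|_^-1|]gtr0_norm ?invr_gt0 // ler_pdivrMr //.
  apply: le_trans (step i) _; rewrite (DE i.+1) [X in X * (3 * _)]bR exprS.
  by rewrite le_eqVlt; apply/orP; left; apply/eqP; ring.
have sum i : `|be i - be 0%N| <= 6 * (C * 2 ^+ e * (2 ^ j)%:R ^+ e) * (1 - (1 / 2) ^+ i).
  elim: i => [|i IH]; first by rewrite !subrr normr0 mulr0.
  have h : 1 - (1 / 2) ^+ i.+1 = 1 - (1 / 2) ^+ i + (1 / 2) ^+ i.+1 :> R by rewrite exprS; lra.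
  rewrite h mulrDr; apply: le_trans (lerD IH (bstep i)).
  have -> : be i.+1 - be 0%N = (be i - be 0%N) + (be i.+1 - be i) by ring.
  exact: ler_normD.
have be0 : be 0%N = m j x.
  rewrite /be /y expr0 divr1 addn0 expn0; congr (m j _).
  by case: (x) => u v; rewrite /scaleZ !mul1r.
apply/ler_addgt0Pr => eps eps0.
have e2 : 0 < eps / 2 by rewrite divr_gt0.
have [n0 hn0] := passage_probability tau0 hconv x e2 (ltac:(lra) : 0 < 1 / 4 :> R).
have [|i0 hi0] := @half_pow_small R (C * (2 ^ j)%:R ^+ e) (eps / 2) _ e2.
  by rewrite mulr_ge0 ?(ltW C0) // exprn_ge0.
pose i := maxn n0 i0.
have ni : (n0 <= b ^ i)%N.
  apply: (@leq_trans i); first by rewrite leq_maxl.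
  by rewrite ltnW // ltn_expl // /b -[1%N]/(2 ^ 0)%N ltn_exp2l.
have [|w hw] := Pbd_ex (PbdU (hn0 _ ni) (deviation 0 (ji i) (yi i))).
  by move: (quarter i); lra.
have h1 : `|passage (tw w) 0 (y i) - (b ^ i)%:R * g (rv R x)| <= eps / 2 * (b ^ i)%:R.
  by rewrite leNgt; apply/negP => h; apply: hw; left.
have h2 : `|passage (tw w) 0 (y i) - m (j + i)%N (y i)| <= D i.
  by rewrite leNgt; apply/negP => h; apply: hw; right; rewrite /= add0r.
have h3 : D i <= eps / 2 * b%:R ^+ i.
  by rewrite DE mulrAC ler_pM2r //; apply: hi0; rewrite leq_maxr.
have h4 : `|be i - g (rv R x)| <= eps.
  have -> : be i - g (rv R x) = (m (j + i)%N (y i) - (b ^ i)%:R * g (rv R x)) / b%:R ^+ i.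
    by rewrite natrX mulrBl mulrAC divff ?mul1r // gt_eqF.
  rewrite normrM [`|_^-1|]gtr0_norm ?invr_gt0 // ler_pdivrMr //.
  by move: h1 h2 h3; rewrite !natrX !ler_norml; lra.
have h5 : 6 * C * 2 ^+ e * (2 ^ j)%:R ^+ e = 6 * (C * 2 ^+ e * (2 ^ j)%:R ^+ e) :> R by ring.
have h6 : 6 * (C * 2 ^+ e * (2 ^ j)%:R ^+ e) * (1 - (1 / 2) ^+ i) <= 6 * (C * 2 ^+ e * (2 ^ j)%:R ^+ e) :> R.
  by rewrite ler_piMr ?gerBl ?exprn_ge0 // !mulr_ge0 ?(ltW C0) ?exprn_ge0.
by move: (sum i) h4 h6; rewrite be0 h5 !ler_norml; lra.
Qed.

Lemma deviation_from_norm : exists (C' : R) (j1 : nat), 0 < C' /\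
  forall j v x, (j1 <= j)%N -> (nrm x <= A * (2 ^ j) ^ e.+1)%N ->
  Pbd P [set w | C' * (2 ^ j)%:R ^+ e < `|passage (tw w) v (v + x) - g (rv R x)|]
    (expR (- (a * (2 ^ j)%:R))).
Proof.
have [C' [j1 [C'0 h]]] := deviation_limit.
exists (C + C'), (maxn j0 j1); split; first exact: addr_gt0.
move=> j v x; rewrite geq_max => /andP[h0 h1] hx.
apply: Pbd_sub (deviation v h0 hx) => w /=; rewrite !ltNge => /negP k; apply/negP => k'; apply: k.
by have := h j x h1 hx; move: k'; rewrite mulrDl !ler_norml; lra.
Qed.

End Telescope.

(** * Almost sure approximation and the size of holes *)

Section BorelCantelli.
Context (R : realType) (d : measure_display) (Omega : measurableType d) (P : probability Omega R).

(** [Pbd] provides measurable covers, and the Borel-Cantelli lemma is applied to these. *)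
Lemma ae_eventually_not (F : nat -> set Omega) (Q : R) N : 0 <= Q ->
  (forall i, (N <= i)%N -> Pbd P (F i) (Q / 2 ^+ i.+1)) ->
  {ae P, forall w, exists N', forall i, (N' <= i)%N -> ~ F i w}.
Proof.
move=> Q0 hF; pose ok i (B : set Omega) := (N <= i)%N -> F i `<=` B.
have [B hB] : {B : nat -> set Omega & forall i,
    [/\ measurable (B i), ok i (B i) & (P (B i) <= (Q / (2 ^ i.+1)%:R)%:E)%E]}.
  apply: (choice (P := fun i B => [/\ measurable B, ok i B & (P B <= (Q / (2 ^ i.+1)%:R)%:E)%E])) => i.
  have [/hF[B [h1 h2 h3]]|h] := leqP N i.
    by exists B; split=> //; rewrite natrX.
  by exists set0; split=> //; [rewrite /ok leqNgt h|rewrite measure0 lee_fin divr_ge0].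
exists (lim_sup_set B); split.
- by apply: bigcap_measurable => // n _; apply: bigcup_measurable => k _; case: (hB k).
- apply: lim_sup_set_cvg0; first by move=> k; case: (hB k).
  apply: (@le_lt_trans _ _ (\sum_(0 <= k <oo) (Q / (2 ^ (k + 1))%:R)%:E)%E).
    by apply: lee_nneseries => // k _; rewrite addn1; case: (hB k).
  have /(cvg_lim (@ereal_hausdorff R)) e := @cvg_geometric_eseries_half R Q 0.
  by have : (limn (eseries (fun k => (Q / (2 ^ (k + 1))%:R)%:E)) < +oo)%E by rewrite e ltry.
- move=> w /= hw n _; apply: contrapT => h; apply: hw; exists (maxn N n) => i.
  rewrite geq_max => /andP[Ni ni] Fi; apply: h; exists i => //.
  by have [_ /(_ Ni) k _] := hB i; exact: k.
Qed.

Variables (tau : E -> {RV P >-> R}) (g : R * R -> R) (A e j1 : nat) (C a : R).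
Hypotheses (a0 : 0 < a) (A0 : (0 < A)%N).
Let tw (w : Omega) (e : E) : R := tau e w.
Hypothesis deviation : forall j v x, (j1 <= j)%N -> (nrm x <= A * (2 ^ j) ^ e.+1)%N ->
  Pbd P [set w | C * (2 ^ j)%:R ^+ e < `|passage (tw w) v (v + x) - g (rv R x)|]
    (expR (- (a * (2 ^ j)%:R))).

(** Chosen so that exp(-a 2^(start i)) beats the number of events at radius 2^i, a fixed power of
    2^i. Hence 2^(start i) is of order i, that is of order log t, and this is the origin of the
    polylogarithm. *)
Definition start_rate : nat := (Num.truncn ((2 * e + 6)%:R / a)).+1.
Definition start (i : nat) : nat := (trunc_log 2 (start_rate * i)).+1.

Lemma start_gt i : (start_rate * i < 2 ^ start i)%N.
Proof. exact: trunc_log_ltn. Qed.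

Lemma start_le i : (0 < i)%N -> (2 ^ start i <= 2 * (start_rate * i))%N.
Proof. by move=> i0; rewrite expnS leq_mul2l trunc_logP // muln_gt0. Qed.

Lemma start_ge i j : (2 ^ j <= i)%N -> (j <= start i)%N.
Proof.
move=> h; apply: leqW; apply: trunc_log_max => //; apply: leq_trans h _.
by rewrite leq_pmull.
Qed.

Definition fluctuates (i : nat) : set Omega := [set w | exists j v x,
  [/\ (start i <= j <= i)%N, (nrm v <= 2 ^ i)%N, (nrm x <= A * (2 ^ j) ^ e.+1)%N &
      C * (2 ^ j)%:R ^+ e < `|passage (tw w) v (v + x) - g (rv R x)|]].

Lemma exp2_expR i : 2 ^+ i <= expR i%:R :> R.
Proof.
rewrite -[i%:R]mulr1 expRM_natl lerXn2r ?nnegrE ?expR_ge0 //.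
by apply: le_trans (expR_ge1Dx 1); lra.
Qed.

Lemma fluctuates_bound i : (2 ^ j1 <= i)%N ->
  Pbd P (fluctuates i) ((162 * A ^ 2)%:R / 2 ^+ i.+1).
Proof.
move=> hi; pose prs := [seq (j, vx) | j <- iota 0 i.+1,
  vx <- [seq (v, x) | v <- boxl 0 (2 ^ i), x <- boxl 0 (A * (2 ^ i) ^ e.+1)]].
pose X (z : nat * (Z2 * Z2)) : set Omega := [set w | [/\ (start i <= z.1)%N,
  (nrm z.2.2 <= A * (2 ^ z.1) ^ e.+1)%N &
  C * (2 ^ z.1)%:R ^+ e < `|passage (tw w) z.2.1 (z.2.1 + z.2.2) - g (rv R z.2.2)|]].
pose q := expR (- (a * (start_rate * i)%:R)).
have XP z : z \in prs -> Pbd P (X z) q.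
  move=> _; have [/andP[h1 h2]|h] := boolP ((start i <= z.1)%N && (nrm z.2.2 <= A * (2 ^ z.1) ^ e.+1)%N).
    apply: Pbd_sub (Pbd_le _ (deviation z.2.1 _ h2)); first by move=> w [].
      rewrite ler_expR lerN2 ler_pM2l // ler_nat.
      by apply: (leq_trans (ltnW (start_gt i))); rewrite leq_exp2l.
    exact: leq_trans (start_ge hi) h1.
  apply: Pbd_sub (Pbd_set0 _ (expR_ge0 _)) => w [h1 h2 _] /=.
  by move/negP: h; apply; rewrite h1.
apply: Pbd_sub (Pbd_le _ (Pbd_list XP)).
  move=> w [j [v [x [/andP[h1 h2] h3 h4 h5]]]]; exists (j, (v, x)); last by split.
  apply: allpairs_f; first by rewrite mem_iota /= add0n ltnS.
  apply: allpairs_f; rewrite mem_boxl subr0 // (leq_trans h4) // leq_mul2l.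
  by rewrite leq_exp2r // leq_exp2l // h2 orbT.
have szp : (size prs <= 81 * A ^ 2 * (2 ^ i) ^ (2 * e + 5))%N.
  rewrite size_allpairs size_iota size_allpairs !size_boxl.
  have y0 : (0 < 2 ^ i)%N by rewrite expn_gt0.
  have z0 : (0 < A * (2 ^ i) ^ e.+1)%N by rewrite muln_gt0 A0 expn_gt0 y0.
  apply: (@leq_trans (2 ^ i * ((3 * 2 ^ i) ^ 2 * (3 * (A * (2 ^ i) ^ e.+1)) ^ 2))).
    apply: leq_mul; first exact: ltn_expl.
    by apply: leq_mul; rewrite leq_sqr; [move: y0|move: z0]; clear; lia.
  have -> : (2 * e + 5 = 1 + (2 + 2 * e.+1))%N by clear; lia.
  rewrite !expnD expn1 [(2 * e.+1)%N]mulnC expnM; move: ((2 ^ i) ^ e.+1)%N (2 ^ i)%N => u v.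
  by rewrite leq_eqVlt; apply/orP; left; apply/eqP; ring.
(* One power of 2^i more than the number of events, which makes the total geometric in i. *)
have hq : q <= (2 ^+ i) ^- (2 * e + 6).
  apply: (@le_trans _ _ (expR (- ((2 * e + 6)%:R * i%:R)))).
    rewrite ler_expR lerN2 natrM mulrA ler_wpM2r // mulrC -ler_pdivrMr //.
    by apply: ltW; exact: truncnS_gt.
  rewrite expRN expRM_natl lef_pV2 ?posrE ?exprn_gt0 ?expR_gt0 //.
  by rewrite lerXn2r ?nnegrE ?expR_ge0 ?exprn_ge0 // exp2_expR.
apply: (@le_trans _ _ ((81 * A ^ 2 * (2 ^ i) ^ (2 * e + 5))%:R * (2 ^+ i) ^- (2 * e + 6))).
  by apply: ler_pM => //; rewrite ?expR_ge0 // ler_nat.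
have y0 : 0 < 2 ^+ i :> R by rewrite exprn_gt0.
have -> : (2 * e + 6 = (2 * e + 5).+1)%N by clear; lia.
rewrite natrM !natrX exprS [_ ^+ i.+1]exprS.
have -> : (162 * A ^ 2)%:R = 2 * (81 * A ^ 2)%:R :> R by rewrite -natrM mulnA.
rewrite le_eqVlt; apply/orP; left; apply/eqP.
by field; rewrite !expf_neq0 // pnatr_eq0.
Qed.

Lemma ae_no_fluctuation :
  {ae P, forall w, exists N, forall i, (N <= i)%N -> ~ fluctuates i w}.
Proof. exact: ae_eventually_not fluctuates_bound. Qed.

End BorelCantelli.

(** The least power of 2 that satisfies the first bound; minimality gives the upper bound. *)
Lemma dyadic_scale (R : realType) (c t : R) : 0 < c -> 3 + c <= t ->
  exists i, [/\ (0 < i)%N, 8 * (t + 3 + c) <= c * (2 ^ i)%:R, c * (2 ^ i)%:R <= 32 * t &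
    t <= c * (2 ^ i)%:R].
Proof.
move=> c0 ct.
have ex : exists i, 8 * (t + 3 + c) <= c * (2 ^ i)%:R.
  exists (Num.truncn (8 * (t + 3 + c) / c)).+1.
  rewrite [leRHS]mulrC -ler_pdivrMr //; apply: ltW; apply: lt_le_trans (truncnS_gt _) _.
  by rewrite ler_nat ltnW // ltn_expl.
case: (ex_minnP ex) => i hi imin.
have i0 : (0 < i)%N.
  by case: (i) hi => // h; move: h ct c0; rewrite expn0; lra.
exists i; split=> //; last by move: hi ct c0; lra.
have : c * (2 ^ i.-1)%:R < 8 * (t + 3 + c).
  by rewrite ltNge; apply/negP => /imin; rewrite leqNgt prednK // leqnn.
by rewrite -{2}(prednK i0) expnS natrM; move: ct; lra.
Qed.

Lemma sum_le4 (R : realType) (a b c d t : R) : 0 <= a -> 0 <= b -> 0 <= c -> 0 <= d ->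
  a + b + c + d <= t -> [/\ a <= t, b <= t, c <= t & d <= t].
Proof. by move=> a0 b0 c0 d0 h; split; lra. Qed.

(** * From the approximation of the metric to the size of holes *)

Section Conclusion.
Variable R : realType.

Lemma M_max_le (t : E -> R) (s : R) (N : nat) :
  (forall C : set Z2, component (~` ball_B t s) C -> finite_set C -> forall w1 w2 p, is_path w1 w2 p ->
     (forall v : Z2, v \in w1 :: p -> C v) -> (nrm (w2 - w1) <= N)%N) ->
  (M_max t s <= ((N.*2.+1 ^ 2)%:R)%:E)%E.
Proof.
move=> h; apply: ge_ereal_sup => _ [->|[C [cC fC] <-]]; first by rewrite lee_fin.
rewrite lee_fin ler_nat; have [_ [w1 Cw1] con _] := cC.
rewrite -(size_boxl w1 N); apply: uniq_leq_size; first exact: finmap.fset_uniq.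
move=> w2 hw; have Cw2 : C w2 by move: hw; rewrite (in_fset_set fC) inE.
by have [p [hp pC]] := con w1 w2 Cw1 Cw2; rewrite mem_boxl; exact: h cC fC _ _ _ hp pC.
Qed.

Lemma component_hole (t : E -> R) (s : R) (C : set Z2) : component (~` ball_B t s) C ->
  finite_set C -> exists Y0, hole_in (passage t) s (fun v => `[< C v >]) Y0.
Proof.
move=> [CS _ _ Cadj] /finite_seqP[l CE].
exists (\max_(v <- l) nrm v).+1; split.
- by move=> v /asboolP/CS; rewrite /ball_B /= => /negP; rewrite -ltNge.
- move=> x y /asboolP Cx hy xy; apply/asboolP; apply: (Cadj x y) => //.
  by rewrite /ball_B /=; apply/negP; rewrite -ltNge.
- by move=> v /asboolP; rewrite CE /= => vl; rewrite ltnS; exact: leq_bigmax_seq.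
Qed.

Variables (g : R * R -> R) (c1 C a : R) (e : nat).
Hypotheses (c10 : 0 < c1) (C0 : 0 < C) (a0 : 0 < a).
Let delta : R := e.+1%:R^-1.
(** The 8 is the range of displacements in [metric_approx]; 2^(e+1) is the loss when k is rounded
    down to some (2^j)^(e+1). *)
Let A := (8 * 2 ^ e.+1)%N.

(** With 2^j at most k^delta, the error 2^(j e) is at most k^(delta e) = k^(1 - delta). *)
Lemma scale_power (j k : nat) : ((2 ^ j) ^ e.+1 <= k)%N -> (0 < k)%N ->
  C * (2 ^ j)%:R ^+ e <= k%:R * (C * powR k%:R (- delta)).
Proof.
move=> hk k0; pose x : R := powR k%:R delta.
have x0 : 0 < x by rewrite powR_gt0 // ltr0n.
have xE : x ^+ e.+1 = k%:R.
  by rewrite -powR_mulrn ?ltW // -powRrM mulVf ?pnatr_eq0 // powRr1.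
have jx : (2 ^ j)%:R <= x.
  rewrite leNgt; apply/negP => h.
  have : x ^+ e.+1 < (2 ^ j)%:R ^+ e.+1 by rewrite ltrXn2r // ltW.
  by rewrite xE -natrX ltr_nat ltnNge hk.
rewrite mulrCA ler_pM2l // powRN -/x -xE exprSr mulfK ?gt_eqF //.
by rewrite lerXn2r ?nnegrE // ltW.
Qed.

Context (d : measure_display) (Omega : measurableType d) (P : probability Omega R).
Variables (tau : E -> {RV P >-> R}).
Hypothesis tau0 : forall e w, 0 <= tau e w.
Hypothesis holes : holes_bounded delta C g c1 (fun=> True).

Let tw (w : Omega) (e : E) : R := tau e w.

Lemma approx_of_no_fluctuation w i t : ~ fluctuates tau g A e C a i w ->
  8 * (t + 3 + c1) <= c1 * (2 ^ i)%:R -> c1 * (2 ^ i)%:R <= 32 * t ->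
  metric_approx delta C g c1 (passage (tw w)) (2 ^ i) ((2 ^ start e a i) ^ e.+1) t.
Proof.
move=> nf h1 h2; split=> //.
  by apply: passage_length_metric => e'; exact: tau0.
move=> k v x /andP[rk ki] hv hx; rewrite leNgt; apply/negP => h; apply: nf.
have k0 : (0 < k)%N by apply: leq_trans rk; rewrite !expn_gt0.
have b1 : (1 < 2 ^ e.+1)%N by rewrite -[X in (X < _)%N](expn0 2) ltn_exp2l.
pose j := trunc_log (2 ^ e.+1) k.
have pw n : ((2 ^ e.+1) ^ n = (2 ^ n) ^ e.+1)%N by rewrite -!expnM mulnC.
have jk : ((2 ^ j) ^ e.+1 <= k)%N by rewrite -pw; exact: trunc_logP.
have kj : (k < 2 ^ e.+1 * (2 ^ j) ^ e.+1)%N by rewrite -pw -expnS; exact: trunc_log_ltn.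
exists j, v, x; split=> //.
- apply/andP; split; first by apply: trunc_log_max => //; rewrite pw.
  rewrite -(@leq_exp2l 2) //; apply: leq_trans ki; apply: leq_trans jk.
  by rewrite -{1}(expn1 (2 ^ j)) leq_pexp2l // expn_gt0.
- by rewrite (leq_trans hx) // /A -mulnA leq_mul2l ltnW.
- exact: le_lt_trans (scale_power jk k0) h.
Qed.

(** The radius 2^i is comparable to t and [r0] is at most a constant times i^(e+1), so a hole has at
    most a constant times i^(2e+2) vertices. One more factor i absorbs this constant, and i <= (ln
    t)^2 absorbs the ratio of i to ln t. *)
Lemma M_max_polylog w : (exists N, forall i, (N <= i)%N -> ~ fluctuates tau g A e C a i w) ->
  exists t0 : R, forall t : R, t0 <= t ->
    (M_max (tw w) t <= (powR (ln t) (2 * (2 * e + 3))%:R)%:E)%E.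
Proof.
move=> [N nf]; have [A' [rmin [T hb]]] := holes.
have ln2 : 0 < ln 2 :> R by rewrite ln_gt0 // ltr1n.
pose B := (2 * start_rate e a)%N.
have [|k0 hk0] := @poly_expR R (`|T| * (32 / c1) * B%:R ^+ e.+1) (ln 2) e.+1 _ ln2.
  by rewrite mulr_ge0 ?exprn_ge0 // mulr_ge0 // divr_ge0 // ltW.
pose D := ((2 * A' + 1) ^ 2 * (B ^ e.+1) ^ 2)%N.
pose N2 := (maxn N (maxn rmin (maxn k0 D))).+1.
have p1 : 0 <= c1 * (2 ^ N2)%:R by rewrite mulr_ge0 // ltW.
have p2 : 0 <= 32 / c1 by rewrite divr_ge0 // ltW.
have p3 : 0 <= expR (2 / ln 2) :> R by rewrite expR_ge0.
have p0 : 0 <= 3 + c1 by rewrite addr_ge0 // ltW.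
exists (3 + c1 + c1 * (2 ^ N2)%:R + 32 / c1 + expR (2 / ln 2)) => t.
case/(sum_le4 p0 p1 p2 p3) => t1 t2 t3 t4.
have tpos : 0 < t by apply: lt_le_trans t4; exact: expR_gt0.
have [i [i0 hi hi2 ti]] := dyadic_scale c10 t1.
have iN : (N2 <= i)%N.
  rewrite -(@leq_exp2l 2) // -(ler_nat R) -(ler_pM2l c10).
  exact: le_trans t2 ti.
have [iN1 [irm [ik iD]]] : (N <= i)%N /\ (rmin <= i)%N /\ (k0 <= i)%N /\ (D <= i)%N.
  by move: (ltnW iN); rewrite !geq_max => /and4P[].
set r0 := ((2 ^ start e a i) ^ e.+1)%N.
have r00 : (0 < r0)%N by rewrite !expn_gt0.
have r0i : (i <= r0)%N.
  apply: (@leq_trans (2 ^ start e a i)); last by rewrite -{1}(expn1 (2 ^ _)) leq_pexp2l // expn_gt0.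
  by apply: leq_trans (ltnW (start_gt e a i)); rewrite leq_pmull.
have r0B : (r0 <= B ^ e.+1 * i ^ e.+1)%N.
  by rewrite -expnMn leq_exp2r // /B -mulnA start_le.
have Tt : T * r0%:R <= t.
  have h : 2 ^+ i * (c1 / 32) <= t.
    by move: hi2; rewrite natrX mulrA ler_pdivrMr // [_ * c1]mulrC [t * _]mulrC.
  apply: le_trans h; rewrite -ler_pdivrMr ?divr_gt0 // invf_div.
  have -> : 2 ^+ i = expR (ln 2 * i%:R) :> R.
    by rewrite mulrC expRM_natl lnK // posrE.
  apply: le_trans (hk0 i ik); apply: (@le_trans _ _ (`|T| * (B ^ e.+1 * i ^ e.+1)%:R * (32 / c1))).
    rewrite ler_wpM2r //; apply: (@le_trans _ _ (`|T| * r0%:R)); first by rewrite ler_wpM2r // ler_norm.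
    by rewrite ler_wpM2l // ler_nat.
  by rewrite natrM !natrX le_eqVlt; apply/orP; left; apply/eqP; ring.
have ma := approx_of_no_fluctuation (nf i iN1) hi hi2.
have hM : (M_max (tw w) t <= ((((A' * r0).*2.+1) ^ 2)%:R)%:E)%E.
  apply: M_max_le => C' cC fC w1 w2 p hp pC.
  have [Y0 hY] := component_hole cC fC; apply: ltnW.
  apply: (hb _ _ _ _ ma _ r00 Tt _ _ hY _ _ _ I hp); first exact: leq_trans irm r0i.
  by move=> v /pC; exact: asboolT.
apply: le_trans hM _; rewrite lee_fin.
have hs : (((A' * r0).*2.+1) ^ 2 <= i ^ (2 * e + 3))%N.
  apply: (@leq_trans (((2 * A' + 1) * (B ^ e.+1 * i ^ e.+1)) ^ 2)).
    rewrite leq_sqr; apply: (@leq_trans ((2 * A' + 1) * r0)); last by rewrite leq_mul2l r0B orbT.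
    by rewrite mulnDl mul1n -addn1 -mul2n mulnA leq_add2l.
  have -> : (2 * e + 3 = 1 + e.+1 * 2)%N by clear; lia.
  rewrite expnD expn1 expnM; apply: (@leq_trans (D * (i ^ e.+1) ^ 2)); last by rewrite leq_mul2r iD orbT.
  by rewrite /D !expnMn mulnA.
apply: (@le_trans _ _ (i ^ (2 * e + 3))%:R); first by rewrite ler_nat.
have lt2 : 2 / ln 2 <= ln t by rewrite -[leLHS]expRK ler_ln // posrE expR_gt0.
have lt0 : 0 <= ln t by apply: le_trans lt2; rewrite divr_ge0 // ltW.
have il : i%:R <= ln t ^+ 2.
  have h : 2 ^+ i <= t ^+ 2.
    rewrite -(ler_pM2l c10) -natrX; apply: (le_trans hi2).
    by rewrite expr2 mulrA ler_pM2r // mulrC -ler_pdivrMr.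
  have {h} : i%:R * ln 2 <= 2 * ln t.
    have : ln (2 ^+ i) <= ln (t ^+ 2) by rewrite ler_ln // posrE exprn_gt0.
    by rewrite !lnXn // -[ln 2 *+ i]mulr_natl -[ln t *+ 2]mulr_natl.
  rewrite -ler_pdivlMr // => h; apply: (le_trans h).
  by rewrite mulrAC expr2 ler_wpM2r.
rewrite powR_mulrn // exprM natrX; apply: lerXn2r => //; rewrite nnegrE // exprn_ge0 //.
Qed.

End Conclusion.

Theorem theorem2 (R : realType) (d : measure_display) (Omega : measurableType d)
  (P : probability Omega R) (tau : E -> {RV P >-> R}) :
  iid_edges tau ->
  (forall e w, 0 <= tau e w) ->
  (forall e, P (tau e @^-1` [set 0%R : R]) < (1 / 2 : R)%:E)%E ->
  (exists alpha : R, 0 < alpha /\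
     forall e, (\int[P]_w (expR (alpha * tau e w))%:E < +oo)%E) ->
  (exists g : R * R -> R, is_norm2 g /\
     (forall z : Z2, {ae P, forall w,
        (fun n : nat => passage (fun e => tau e w) origin
                          ((n%:Z * z.1)%R, (n%:Z * z.2)%R) / n%:R)
          @ \oo --> g (z.1%:~R, z.2%:~R)}) /\
     uniform_curvature g) ->
  exists C : R, 0 < C /\
    {ae P, forall w, exists t0 : R, forall t : R, t0 <= t ->
       (M_max (fun e => tau e w) t <= (powR (ln t) C)%:E)%E}.
Proof.
move=> iid tau0 _ [alpha [a0 expint]] [g [gn [hconv curv]]].
have [c1 c10 low] := norm_lower gn; have [c2 c20 upp] := norm_upper gn.
have [L [L0 slowP]] := slow_probability iid tau0 a0 expint c10 low hconv.
(* The exponent of the errors in [scale_estimates]; displacements there go up to a multiple of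
   k^44. *)
pose e := 43%N.
have A0 : (0 < 8 * 2 ^ e.+1)%N by rewrite muln_gt0 expn_gt0.
have [C [a [j0 [m [C0 ap dev dbl]]]]] := scale_estimates iid tau0 a0 expint L0 slowP A0.
have [C' [j1 [C'0 dev']]] := deviation_from_norm (e := e) tau0 hconv C0 ap dev dbl.
exists (2 * (2 * e + 3))%:R; split; first by rewrite ltr0n.
have d0 : 0 < e.+1%:R^-1 :> R by rewrite invr_gt0.
have d1 : e.+1%:R^-1 <= 1 :> R by rewrite invf_le1 // ler1n.
have holes := holes_bounded_all C'0 d0 d1 gn curv c10 c20 low upp.
have nf := ae_no_fluctuation (e := e) ap A0 dev'.
apply: filterS nf => w; exact: (M_max_polylog c10 C'0 tau0 holes).
Qed.
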